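(* Consider the following drone network model. - Coordinates are $(x,y,z)$ with the ground at $z=0$, the typical user at $\mathbf{o}=(0,0,0)$, and $\mathbf{o}'=(0,0,h)$ for a height $h>0$. - At time $0$, drone base stations (DBSs) lie in the plane $z=h$. Their horizontal positions form a homogeneous PPP of density $\lambda_0>0$ in $\mathbb{R}^2$. - The serving DBS is the DBS closest to $\mathbf{o}'$ at time $0$. Let $u_0$ be its horizontal distance to $\mathbf{o}'$. - The serving DBS moves in the plane $z=h$ straight toward $\mathbf{o}'$ at constant speed $v>0$ and stops on reaching $\mathbf{o}'$. Thus its horizontal distance to $\mathbf{o}'$ at time $t$ is $u_0(t)=[u_0-vt]^+=\max\{u_0-vt,0\}$. - Every other DBS (an interferer) moves in the plane $z=h$ on a straight line at speed $v$. Its direction is uniform on $[0,2\pi)$, independent across DBSs and independent of the initial positions. - For a DBS whose horizontal distance to $\mathbf{o}'$ at time $t$ is $u_{\mathbf{x}}(t)$, the distance to $\mathbf{o}$ is $r_{\mathbf{x}}(t)=\sqrt{u_{\mathbf{x}}(t)^2+h^2}$. For the serving DBS, $r_0(t)=\sqrt{u_0(t)^2+h^2}$. The SINR at time $t$ is $$\mathrm{SINR}(t)=\frac{P h_0 r_0(t)^{-\alpha}}{I(t)+N_0},\qquad I(t)=\sum_{\text{interferers }\mathbf{x}}P h_{\mathbf{x}} r_{\mathbf{x}}(t)^{-\alpha}.$$ The parameters satisfy the following. - $P>0$ is the common transmit power. - $N_0\ge 0$ is the noise power. - $\alpha>2$. - The fading gains $h_0,h_{\mathbf{x}}$ are i.i.d.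 $\mathrm{Exp}(1)$, independent of the positions and movement directions. Let $P_{\rm C}(\gamma,t)=\mathbb{P}[\mathrm{SINR}(t)\ge\gamma]$ for $\gamma>0$. Then $$P_{\rm C}(\gamma,t)=\int_0^{vt}2\pi\lambda_0u_0\,e^{-\pi\lambda_0u_0^2-\frac{\gamma h^\alpha}{P}N_0-2\pi\lambda_0\mathcal{A}}\,{\rm d}u_0+\int_{vt}^{\infty}2\pi\lambda_0u_0\,e^{-\pi\lambda_0u_0^2-\frac{\gamma((u_0-vt)^2+h^2)^{\alpha/2}}{P}N_0-2\pi\lambda_0\mathcal{B}}\,{\rm d}u_0,$$ where $$\mathcal{A}=\int_0^\infty g_1(u)\,{\rm d}u-\int_{vt-u_0}^{vt+u_0}g_1(u)\,\frac{1}{\pi}\cos^{-1}\!\left(\frac{-u_0^2+u^2+v^2t^2}{2uvt}\right){\rm d}u,$$ $$\mathcal{B}=\int_{u_0+vt}^\infty g_2(u)\,{\rm d}u+\int_{u_0-vt}^{u_0+vt}g_2(u)\,\frac{1}{\pi}\cos^{-1}\!\left(\frac{u_0^2-u^2-v^2t^2}{2uvt}\right){\rm d}u,$$ $$g_1(u)=\frac{u}{1+\frac{1}{\gamma}\left(\frac{u^2+h^2}{h^2}\right)^{\alpha/2}},\qquad g_2(u)=\frac{u}{1+\frac{1}{\gamma}\left(\frac{u^2+h^2}{(u_0-vt)^2+h^2}\right)^{\alpha/2}},$$ and $\cos^{-1}$ takes values in $[0,\pi]$. Moreover, the rate $R(t)=\mathbb{E}[\ln(1+\mathrm{SINR}(t))]$,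 with the expectation over the point process, the movement directions and the fading, satisfies $$R(t)=\int_0^\infty\frac{P_{\rm C}(\gamma,t)}{1+\gamma}\,{\rm d}\gamma.$$ *)

(* Defs.v *)
From HB Require Import structures.
From mathcomp Require Import all_boot all_order all_algebra.
From mathcomp Require Import all_classical all_reals all_analysis.
Set Implicit Arguments. Unset Strict Implicit. Unset Printing Implicit Defensive.
Import Order.TTheory GRing.Theory Num.Theory.
Import numFieldNormedType.Exports.
Local Open Scope classical_set_scope.
Local Open Scope ring_scope.

Section DroneModel.
Variable R : realType.

(* A marked DBS: ((x, y), theta, g) = initial horizontal position (x,y)
   (relative to o'), movement direction theta, fading gain g. *)
Definition mpt := (R * R * R * R)%type.
Definition px (p : mpt) : R := p.1.1.1.
Definition py (p : mpt) : R := p.1.1.2.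
Definition pdir (p : mpt) : R := p.1.2.
Definition pfad (p : mpt) : R := p.2.

(* Intensity measure of the independently marked PPP:
   lam0 * Leb(R^2) (x) Unif[0,2pi) (x) Exp(1), written as an iterated
   Lebesgue integral (Tonelli). *)
Definition intensity (lam0 : R) (A : set mpt) : \bar R :=
  (lam0%:E * \int[@lebesgue_measure R]_x \int[@lebesgue_measure R]_y
     \int[@lebesgue_measure R]_(th in `[0%R, (2 * pi)%R[%classic)
       \int[@lebesgue_measure R]_(g in `[0%R, +oo[%classic)
         ((\1_A (x, y, th, g) : R) * (2 * pi)^-1 * expR (- g))%:E)%E.

Definition is_PPP d (T : measurableType d) (Pr : probability T R)
    (mu : set mpt -> \bar R) (Phi : T -> set mpt) : Prop :=
  forall (n : nat) (A : 'I_n -> set mpt) (k : 'I_n -> nat),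
    (forall i, measurable (A i)) ->
    (forall i, (mu (A i) < +oo)%E) ->
    (forall i j, i != j -> A i `&` A j = set0) ->
    let E := [set w | forall i, @counting _ R (Phi w `&` A i) = (k i)%:R%:E] in
    measurable E /\
    Pr E = (\prod_(i < n)
              (expR (- fine (mu (A i))) * fine (mu (A i)) ^+ k i / (k i)`!%:R))%:E.

Definition hdist0 (p : mpt) : R := Num.sqrt (px p ^+ 2 + py p ^+ 2).

Definition serving (C : set mpt) (p : mpt) : Prop :=
  C p /\ forall q, C q -> q <> p -> hdist0 p < hdist0 q.

Definition mpt0 : mpt := (0, 0, 0, 0).

Definition serv_pl (h v alpha t : R) (p : mpt) : R :=
  (Num.max (hdist0 p - v * t) 0 ^+ 2 + h ^+ 2) `^ (- (alpha / 2)).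

Definition intf_pl (h v alpha t : R) (q : mpt) : R :=
  ((px q + v * t * cos (pdir q)) ^+ 2 + (py q + v * t * sin (pdir q)) ^+ 2
     + h ^+ 2) `^ (- (alpha / 2)).

Definition interference (h v alpha Pw t : R) (C : set mpt) (p : mpt) : \bar R :=
  (\esum_(q in C `\ p) (Pw * pfad q * intf_pl h v alpha t q)%:E)%E.

(* SINR(t) of a configuration; set to 0 on the (null) event where there is no
   unique closest DBS or the interference is infinite. *)
Definition SINR (h v alpha Pw N0 t : R) (C : set mpt) : R :=
  let p := xget mpt0 (serving C) in
  if `[< serving C p >] then
    let I := interference h v alpha Pw t C p in
    if (I \is a fin_num)%E then
      Pw * pfad p * serv_pl h v alpha t p / (fine I + N0)
    else 0
  else 0.

Definition g1 (h alpha gam u : R) : R :=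
  u / (1 + gam^-1 * ((u ^+ 2 + h ^+ 2) / h ^+ 2) `^ (alpha / 2)).

Definition g2 (h v alpha gam t u0 u : R) : R :=
  u / (1 + gam^-1 * ((u ^+ 2 + h ^+ 2) / ((u0 - v * t) ^+ 2 + h ^+ 2)) `^ (alpha / 2)).

Definition calA (h v alpha gam t u0 : R) : R :=
  Rintegral lebesgue_measure `[0, +oo[%classic (g1 h alpha gam)
  - Rintegral lebesgue_measure `[v * t - u0, v * t + u0]%classic
      (fun u => g1 h alpha gam u / pi *
         acos ((- u0 ^+ 2 + u ^+ 2 + v ^+ 2 * t ^+ 2) / (2 * u * v * t))).

Definition calB (h v alpha gam t u0 : R) : R :=
  Rintegral lebesgue_measure `[u0 + v * t, +oo[%classic (g2 h v alpha gam t u0)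
  + Rintegral lebesgue_measure `[u0 - v * t, u0 + v * t]%classic
      (fun u => g2 h v alpha gam t u0 u / pi *
         acos ((u0 ^+ 2 - u ^+ 2 - v ^+ 2 * t ^+ 2) / (2 * u * v * t))).

Definition PC_formula (lam0 h v alpha Pw N0 gam t : R) : \bar R :=
  ((\int[@lebesgue_measure R]_(u0 in `[0%R, (v * t)%R]%classic)
      (2 * pi * lam0 * u0 *
         expR (- (pi * lam0 * u0 ^+ 2) - gam * h `^ alpha / Pw * N0
               - 2 * pi * lam0 * calA h v alpha gam t u0))%:E)
  + (\int[@lebesgue_measure R]_(u0 in `[(v * t)%R, +oo[%classic)
      (2 * pi * lam0 * u0 *
         expR (- (pi * lam0 * u0 ^+ 2)
               - gam * ((u0 - v * t) ^+ 2 + h ^+ 2) `^ (alpha / 2) / Pw * N0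
               - 2 * pi * lam0 * calB h v alpha gam t u0))%:E))%E.

End DroneModel.

(* Main.v *)
(** Cut the plane around the typical user into thin annuli. On the event that the
    nearest station is the only point of its annulus, conditioning on it reduces
    [SINR >= gam] to the statement that its fading gain exceeds [s * (I + N0)] for a
    rate [s] fixed by its position, so the memoryless exponential law turns the
    probability into a Laplace functional of the Poisson process of the stations
    outside the annulus. No Palm calculus is needed: approximating the path
    gains of the interferers from below by step functions, the event becomes one about
    finitely many independent Poisson counts. The annulus probabilities sum to the
    coverage probability up to a factor and an error that both tend to their
    limits as the annuli get thin.

    In the Laplace functional, averaging over the fading, translating the plane by
    the displacement of the interferer, and averaging over its direction leaves a
    radial integral weighted by the proportion of directions compatible with an
    initial position outside the exclusion disk; this proportion is the arccosine
    of the formula. The rate follows from the layer-cake formula. *)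

Require Import Defs.
From HB Require Import structures.
From mathcomp Require Import all_boot all_order all_algebra.
From mathcomp Require Import all_classical all_reals all_analysis.
From mathcomp Require Import finmap measurable_realfun ring lra.
Set Implicit Arguments.
Unset Strict Implicit.
Unset Printing Implicit Defensive.
Import Order.TTheory GRing.Theory Num.Theory.
Import numFieldNormedType.Exports.
Local Open Scope classical_set_scope.
Local Open Scope ring_scope.

(** * Measurability *)

(** The obstacle is that [is_PPP] gives only the joint laws of counts in finitely many disjoint sets
    of finite intensity. Apart from the assumed measurability of the SINR, no functional of the
    process is known to be measurable, so each event is cut with an almost sure one on which it is a
    countable combination of counting events. The exponential tail is what makes counts suffice: the
    intensity of annulus points able to stand an interference [x] is a mixture of
    [expR (- (s * x))], and for [x] a weighted sum of counts this exponential factors over the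
    cells, leaving Poisson generating functions. Approximation from below makes the events decrease,
    so that continuity from above gives the limit. Annuli are cut in squared distance, hence all
    have the same intensity [c]. The counts then give a geometric series, and [expR (- c)] controls
    both defects: further points in the annulus of the serving station, and configurations whose
    nearest point is not alone in its annulus. *)

Lemma measurable_cosR (R : realType) : measurable_fun [set: R] (@cos R).
Proof. by apply: continuous_measurable_fun; exact: continuous_cos. Qed.

Lemma measurable_sinR (R : realType) : measurable_fun [set: R] (@sin R).
Proof. by apply: continuous_measurable_fun; exact: continuous_sin. Qed.

Section Measurability.
Context d (T : measurableType d) (R : realType).
Implicit Types f g : T -> R.

Lemma mfun_add f g : measurable_fun [set: T] f -> measurable_fun [set: T] g ->
  measurable_fun [set: T] (fun x => f x + g x).
Proof. exact: measurable_realfun.measurable_funD. Qed.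

Lemma mfun_opp f : measurable_fun [set: T] f ->
  measurable_fun [set: T] (fun x => - f x).
Proof. exact: measurable_realfun.measurable_funN. Qed.

Lemma mfun_mul f g : measurable_fun [set: T] f -> measurable_fun [set: T] g ->
  measurable_fun [set: T] (fun x => f x * g x).
Proof. exact: measurable_realfun.measurable_funM. Qed.

Lemma mfun_max f g : measurable_fun [set: T] f -> measurable_fun [set: T] g ->
  measurable_fun [set: T] (fun x => Num.max (f x) (g x)).
Proof. exact: measurable_maxr. Qed.

Lemma mfun_comp (h : R -> R) f : measurable_fun [set: R] h ->
  measurable_fun [set: T] f -> measurable_fun [set: T] (fun x => h (f x)).
Proof. by move=> mh mf; apply: (measurableT_comp mh mf). Qed.

Lemma mfun_sqrt f : measurable_fun [set: T] f ->
  measurable_fun [set: T] (fun x => Num.sqrt (f x)).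
Proof. by apply: mfun_comp; apply: continuous_measurable_fun; exact: sqrt_continuous. Qed.

Lemma mfun_cos f : measurable_fun [set: T] f ->
  measurable_fun [set: T] (fun x => cos (f x)).
Proof. by apply: mfun_comp; exact: measurable_cosR. Qed.

Lemma mfun_sin f : measurable_fun [set: T] f ->
  measurable_fun [set: T] (fun x => sin (f x)).
Proof. by apply: mfun_comp; exact: measurable_sinR. Qed.

Lemma mfun_expR f : measurable_fun [set: T] f ->
  measurable_fun [set: T] (fun x => expR (f x)).
Proof. by apply: mfun_comp; exact: measurable_expR. Qed.

Lemma mfun_ln f : measurable_fun [set: T] f ->
  measurable_fun [set: T] (fun x => ln (f x)).
Proof. by apply: mfun_comp; exact: measurable_ln. Qed.

Lemma mfun_powR (a : R) f : measurable_fun [set: T] f ->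
  measurable_fun [set: T] (fun x => f x `^ a).
Proof. by apply: (mfun_comp (h := fun x => x `^ a)); exact: measurable_powR. Qed.

Lemma mfun_exp n f : measurable_fun [set: T] f ->
  measurable_fun [set: T] (fun x => f x ^+ n).
Proof. by apply: (mfun_comp (h := fun x => x ^+ n)); exact: exprn_measurable. Qed.

Lemma mfun_inv f : measurable_fun [set: T] f ->
  measurable_fun [set: T] (fun x => (f x)^-1).
Proof.
apply: (mfun_comp (h := fun x => x^-1)).
(* The inverse is discontinuous at 0; on each half-line it is a power function with exponent [-1],
   up to sign. *)
rewrite (_ : (fun x : R => x^-1) =
  (fun x : R => if 0 <= x then x `^ (-1) else - ((- x) `^ (-1)))).
  apply: measurable_fun_ifT.
  - by apply: measurable_fun_ler => //; exact: measurable_cst.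
  - exact: measurable_powR.
  - apply: measurableT_comp; first exact: oppr_measurable.
    apply: (@measurableT_comp _ _ _ _ _ _ (fun x : R => x `^ (-1))).
      exact: measurable_powR.
    exact: oppr_measurable.
apply/funext => x; case: ifPn => x0; first by rewrite powR_inv1.
rewrite powR_inv1 ?invrN ?opprK// oppr_ge0.
by move: x0; rewrite -ltNge => /ltW.
Qed.

Lemma mfun_bool (b : T -> bool) : measurable_fun [set: T] b ->
  measurable_fun [set: T] (fun x => (b x)%:R : R).
Proof.
move=> mb; rewrite (_ : (fun x => (b x)%:R : R) = (fun x => if b x then 1 else 0)).
  by apply: measurable_fun_ifT => //; exact: measurable_cst.
by apply/funext => x; case: (b x).
Qed.

Lemma mfun_le f g : measurable_fun [set: T] f -> measurable_fun [set: T] g ->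
  measurable_fun [set: T] (fun x => f x <= g x).
Proof. exact: measurable_fun_ler. Qed.

Lemma mfun_lt f g : measurable_fun [set: T] f -> measurable_fun [set: T] g ->
  measurable_fun [set: T] (fun x => f x < g x).
Proof. exact: measurable_fun_ltr. Qed.

Lemma mfun_if (b : T -> bool) f g : measurable_fun [set: T] b ->
  measurable_fun [set: T] f -> measurable_fun [set: T] g ->
  measurable_fun [set: T] (fun x => if b x then f x else g x).
Proof. exact: measurable_fun_ifT. Qed.

Lemma mfun_and (b c : T -> bool) :
  measurable_fun [set: T] b -> measurable_fun [set: T] c ->
  measurable_fun [set: T] (fun x => b x && c x).
Proof. exact: measurable_and. Qed.

Lemma mfun_EFin f : measurable_fun [set: T] f ->
  measurable_fun [set: T] (fun x => (f x)%:E).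
Proof. by move=> mf; exact/measurable_EFinP. Qed.

Lemma mfun_fine (f : T -> \bar R) : measurable_fun [set: T] f ->
  measurable_fun [set: T] (fun x => fine (f x)).
Proof. by move=> mf; apply: (@measurableT_comp _ _ _ _ _ _ fine). Qed.

Lemma measurable_pred (b : T -> bool) : measurable_fun [set: T] b ->
  measurable [set x | b x].
Proof. by move=> mb; rewrite -[X in measurable X]setTI; exact: mb. Qed.

End Measurability.

Section MeasurabilityProd.
Context d d1 d2 (T : measurableType d) (T1 : measurableType d1)
  (T2 : measurableType d2).

Lemma mfun_fst (f : T -> T1 * T2) : measurable_fun [set: T] f ->
  measurable_fun [set: T] (fun x => (f x).1).
Proof. by move=> mf; apply: (@measurableT_comp _ _ _ _ _ _ fst) => //; exact: measurable_fst. Qed.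

Lemma mfun_snd (f : T -> T1 * T2) : measurable_fun [set: T] f ->
  measurable_fun [set: T] (fun x => (f x).2).
Proof. by move=> mf; apply: (@measurableT_comp _ _ _ _ _ _ snd) => //; exact: measurable_snd. Qed.

Lemma mfun_pair (f : T -> T1) (g : T -> T2) : measurable_fun [set: T] f ->
  measurable_fun [set: T] g -> measurable_fun [set: T] (fun x => (f x, g x)).
Proof. exact: measurable_fun_pair. Qed.

End MeasurabilityProd.

Ltac mfun_step :=
  match goal with
  | H : ?G |- ?G => exact: H
  | |- measurable_fun _ (fun x => ?c) => exact: measurable_cst
  | |- measurable_fun _ (fun x => x) => exact: measurable_id
  | |- measurable_fun _ (fun x => fst (@?f x)) => apply: mfun_fst
  | |- measurable_fun _ (fun x => snd (@?f x)) => apply: mfun_snd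
  | |- measurable_fun _ (fun x => (@?f x, @?g x)) => apply: mfun_pair
  | |- measurable_fun _ (fun x => EFin (@?f x)) => apply: mfun_EFin
  | |- measurable_fun _ (fun x => fine (@?f x)) => apply: mfun_fine
  | |- measurable_fun _ (fun x => (@?f x + @?g x)%R) => apply: mfun_add
  | |- measurable_fun _ (fun x => (- @?f x)%R) => apply: mfun_opp
  | |- measurable_fun _ (fun x => (@?f x * @?g x)%R) => apply: mfun_mul
  | |- measurable_fun _ (fun x => (@?f x ^+ _)%R) => apply: mfun_exp
  | |- measurable_fun _ (fun x => ((@?f x)^-1)%R) => apply: mfun_inv
  | |- measurable_fun _ (fun x => Num.max (@?f x) (@?g x)) => apply: mfun_max
  | |- measurable_fun _ (fun x => Num.sqrt (@?f x)) => apply: mfun_sqrt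
  | |- measurable_fun _ (fun x => cos (@?f x)) => apply: mfun_cos
  | |- measurable_fun _ (fun x => sin (@?f x)) => apply: mfun_sin
  | |- measurable_fun _ (fun x => expR (@?f x)) => apply: mfun_expR
  | |- measurable_fun _ (fun x => ln (@?f x)) => apply: mfun_ln
  | |- measurable_fun _ (fun x => powR (@?f x) _) => apply: mfun_powR
  | |- measurable_fun _ (fun x => (nat_of_bool (@?f x))%:R%R) => apply: mfun_bool
  | |- measurable_fun _ (fun x => (@?f x <= @?g x)%R) => apply: mfun_le
  | |- measurable_fun _ (fun x => (@?f x < @?g x)%R) => apply: mfun_lt
  | |- measurable_fun _ (fun x => if @?f x then _ else _) => apply: mfun_if
  | |- measurable_fun _ (fun x => andb (@?f x) (@?g x)) => apply: mfun_and
  | |- _ => exact: measurable_fst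
  | |- _ => exact: measurable_cosR
  | |- _ => exact: measurable_sinR
  | |- _ => exact: measurable_snd
  | |- _ => exact: measurable_id
  end.
Ltac mfun := repeat mfun_step.

(** * Polar integration *)

Section Lebesgue.
Context {R : realType}.
Local Notation leb := (@lebesgue_measure R).
Local Open Scope ereal_scope.

Lemma integral_FTC (f F : R -> R) (a b : R) : (a <= b)%R ->
  (forall x : R, is_derive x 1%R F (f x)) -> continuous f ->
  \int[leb]_(x in `[a, b]) (f x)%:E = (F b - F a)%:E.
Proof.
move=> ab dF cf; move: ab; rewrite le_eqVlt => /predU1P[->|ab].
  by rewrite set_itv1 integral_set1 subrr.
have cF x : {for x, continuous F}.
  apply: differentiable_continuous; apply/derivable1_diffP.
  by have := dF x => -[].
rewrite (@continuous_FTC2 _ f F)//.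
- exact: continuous_subspaceT.
- split.
  + by move=> x _; have := dF x => -[].
  + exact/cvg_at_right_filter/cF.
  + exact/cvg_at_left_filter/cF.
- by move=> x _; rewrite derive1E; have := dF x => -[].
Qed.

Lemma lebesgue_shift (c : R) (A : set R) : measurable A ->
  pushforward leb (fun x : R => x + c : measurableTypeR R)%R A = leb A.
Proof.
move=> mA; have mf : measurable_fun [set: R] (fun x : R => x + c : measurableTypeR R)%R.
  by apply: measurable_funD => //; exact: measurable_cst.
apply/esym/(@lebesgue_measure_unique _
  (pushforward leb (fun x : R => x + c : measurableTypeR R)%R)) => //= _ [[a b]] _ <-.
rewrite /pushforward /=.
rewrite (_ : _ @^-1` _ = `](a - c)%R, (b - c)%R]%classic).
  by rewrite !lebesgue_measure_itv/= !lte_fin ltrD2r -!EFinD opprB addrC subrKA addrC.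
by apply/seteqP; split => x /=; rewrite !in_itv/= lerBrDr ltrBlDr.
Qed.

Lemma ge0_integral_shift (c : R) (f : R -> \bar R) :
  measurable_fun [set: R] f -> (forall x, 0 <= f x) ->
  \int[leb]_x f (x + c)%R = \int[leb]_x f x.
Proof.
move=> mf f0.
have mp : measurable_fun [set: R] (fun x : R => x + c : measurableTypeR R)%R.
  by apply: measurable_funD => //; exact: measurable_cst.
rewrite -[LHS](@ge0_integral_pushforward _ _ (measurableTypeR R) (measurableTypeR R) _ _ mp leb setT f)//.
by apply: eq_measure_integral => A mA _; exact: lebesgue_shift.
Qed.

Lemma integral_circle (r : R) : (0 < r)%R ->
  \int[leb]_(x in `[(- r)%R, r]%classic) (2 * Num.sqrt (r ^+ 2 - x ^+ 2))%:E = (pi * r ^+ 2)%:E.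
Proof.
move=> r0; have pi0 := @pi_gt0 R.
pose F (x : R) := (r * sin x)%R.
have dF (x : R) : is_derive x 1%R F (r * cos x)%R.
  by apply: is_derive_eq.
have dF1 : F^`()%classic = (fun x => r * cos x)%R.
  by apply/funext => x; rewrite derive1E; have := dF x => -[].
have cF' : continuous F^`()%classic.
  rewrite dF1 => x; apply: (@continuousM _ R^o (cst r) cos); [exact: cst_continuous|exact: continuous_cos].
have cF : continuous F.
  by move=> x; apply: differentiable_continuous; apply/derivable1_diffP; have := dF x => -[].
have Fpi : F (pi / 2)%R = r by rewrite /F sin_pihalf mulr1.
have FNpi : F (- (pi / 2))%R = (- r)%R by rewrite /F sinN sin_pihalf mulrN1.
have -> : `[(- r)%R, r]%classic = `[F (- (pi / 2))%R, F (pi / 2)%R]%classic.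
  by rewrite Fpi FNpi.
rewrite (@integration_by_substitution_increasing R F (fun x => 2 * Num.sqrt (r ^+ 2 - x ^+ 2))%R); last first.
- apply: continuous_subspaceT.
  have c1 : continuous (fun x : R => r ^+ 2 - x ^+ 2)%R.
    by move=> y; apply: (@cvgB _ R^o); [exact: cvg_cst|exact: exprn_continuous].
  have c2 : continuous (Num.sqrt \o (fun x : R => r ^+ 2 - x ^+ 2)%R).
    by move=> y; apply: continuous_comp; [exact: c1|exact: sqrt_continuous].
  by move=> y; apply: (@cvgM _ R^o); [exact: cvg_cst|exact: c2].
- split.
  + by move=> x _; have := dF x => -[].
  + exact/cvg_at_right_filter/cF.
  + exact/cvg_at_left_filter/cF.
- by apply/cvg_ex; eexists; apply/cvg_at_left_filter/cF'.
- by apply/cvg_ex; eexists; apply/cvg_at_right_filter/cF'.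
- by move=> x _; exact: cF'.
- move=> x y xI yI xy; rewrite /F ltr_pM2l//.
  by rewrite ltr_sin.
- lra.
(* Primitive of [2 * r ^+ 2 * cos x ^+ 2], the integrand after the substitution [r * sin x]. *)
pose G (x : R) := (r ^+ 2 * (x + sin x * cos x))%R.
transitivity (\int[leb]_(x in `[(- (pi / 2))%R, (pi / 2)%R]%classic) (r ^+ 2 * (2 * cos x ^+ 2))%:E).
  apply: eq_integral => x; rewrite in_setE/= in_itv/= => /andP[x1 x2].
  rewrite /= dF1 /= [X in X%:E]/GRing.mul /=; congr EFin.
  have c0 : (0 <= cos x)%R by apply: cos_ge0_pihalf; rewrite x1 x2.
  have -> : (r ^+ 2 - F x ^+ 2 = (r * cos x) ^+ 2)%R.
    by rewrite /F !exprMn cos2sin2; ring.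
  rewrite sqrtr_sqr ger0_norm ?mulr_ge0// ?ltW//.
  by ring.
have dG (x : R) : is_derive x 1%R G (r ^+ 2 * (2 * cos x ^+ 2))%R.
  apply: is_derive_eq; rewrite /GRing.scale/= cos2sin2.
  have := cos2sin2 x; set c := cos x; set s := sin x => cs.
  have -> : (c * c = 1 - s ^+ 2)%R by rewrite -cs.
  by ring.
have cG : continuous (fun x : R => r ^+ 2 * (2 * cos x ^+ 2))%R.
  have c1 : continuous (fun x : R => cos x ^+ 2)%R.
    by move=> y; apply: (@cvgM _ R^o); exact: continuous_cos.
  have c2 : continuous (fun x : R => 2 * cos x ^+ 2)%R.
    by move=> y; apply: (@cvgM _ R^o); [exact: cvg_cst|exact: c1].
  by move=> y; apply: (@cvgM _ R^o); [exact: cvg_cst|exact: c2].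
rewrite (integral_FTC (F := G))//; last lra.
by rewrite /G sinN cosN cos_pihalf sin_pihalf; congr EFin; field.
Qed.

Definition radius (p : R * R) : R := Num.sqrt (p.1 ^+ 2 + p.2 ^+ 2).

Lemma measurable_radius : measurable_fun [set: R * R] radius.
Proof.
by rewrite /radius; mfun.
Qed.

Lemma radius_ge0 p : (0 <= radius p)%R.
Proof. exact: sqrtr_ge0. Qed.

Lemma radius_lt (r x y : R) : (0 <= r)%R ->
  (radius (x, y) < r)%R = (x ^+ 2 + y ^+ 2 < r ^+ 2)%R.
Proof.
move=> r0; rewrite !ltNge; congr (~~ _).
by rewrite /radius /= -{1}(ger0_norm r0) -sqrtr_sqr ler_sqrt// addr_ge0// sqr_ge0.
Qed.

Lemma lebesgue2_disk (r : R) : (0 <= r)%R ->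
  (leb \x leb) [set p | radius p < r]%R = (pi * r ^+ 2)%:E.
Proof.
move=> r0.
transitivity (\int[leb]_x (2 * Num.sqrt (r ^+ 2 - x ^+ 2))%:E).
  apply: eq_integral => x _ /=.
  have [rx|rx] := leP (r ^+ 2)%R (x ^+ 2)%R.
    rewrite ler0_sqrtr ?mulr0 ?subr_le0//.
    rewrite (_ : xsection _ _ = set0) ?measure0//.
    apply/seteqP; split => y //=; rewrite /xsection/= in_setE /= radius_lt// => rxy.
    have := sqr_ge0 y; move: rx rxy; lra.
  set s := Num.sqrt _; have s0 : (0 <= s)%R by exact: sqrtr_ge0.
  have s2 : (s ^+ 2 = r ^+ 2 - x ^+ 2)%R by rewrite sqr_sqrtr// subr_ge0 ltW.
  rewrite (_ : xsection _ _ = `](- s)%R, s[%classic); last first.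
    apply/seteqP; split => y /=; rewrite /xsection/= in_setE /= radius_lt// in_itv/=.
      move=> rxy; rewrite -ltr_norml -(ger0_norm s0) -ltr_sqr ?nnegrE// !real_normK ?num_real//.
      by rewrite s2; lra.
    rewrite -ltr_norml -{1}(ger0_norm s0) -ltr_sqr ?nnegrE// !real_normK ?num_real//.
    by rewrite s2; lra.
  rewrite lebesgue_measure_itv/= lte_fin; case: ifPn => [_|]; first by rewrite -EFinD; congr EFin; ring.
  by rewrite -leNgt => ?; congr EFin; lra.
have [->|rn0] := eqVneq r 0%R.
  rewrite expr0n /= mulr0 integral0_eq// => x _; rewrite sub0r ler0_sqrtr ?mulr0//.
  by rewrite oppr_le0 sqr_ge0.
rewrite -integral_circle ?lt_neqAle 1?eq_sym ?rn0// [RHS]integral_mkcond.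
apply: eq_integral => x _; rewrite patchE; case: ifPn => //.
rewrite notin_setE/= in_itv/= => /negP; rewrite -ler_norml -ltNge => rx.
rewrite ler0_sqrtr ?mulr0// subr_le0 -(real_normK (num_real x)) lerXn2r ?nnegrE//.
exact: ltW.
Qed.

(** Its vertical slice at [x >= 0] has length [x], which realizes the radial density [u] as the
    image of an area under a projection. *)
Definition wedge : set (R * R) := [set p | (0 <= p.2 <= p.1)%R].

Lemma measurable_wedge : measurable wedge.
Proof. by apply: measurable_pred; mfun. Qed.

Lemma wedge_section (D : set R) (x : R) :
  leb (xsection (wedge `&` fst @^-1` D) x) = ((x * (0 <= x)%R%:R) * \1_D x)%:E.
Proof.
have [xD|xD] := pselect (D x); last first.
  rewrite indicE memNset// mulr0 (_ : xsection _ _ = set0) ?measure0//.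
  by apply/seteqP; split => y //=; rewrite /xsection/= in_setE /= => -[].
rewrite indicE mem_set// mulr1; have [x0|x0] := leP 0%R x.
  rewrite (_ : xsection _ _ = `[0%R, x]%classic); last first.
    apply/seteqP; split => y /=; rewrite /xsection/= in_setE /= in_itv/=; first by case.
    by move=> ?; split.
  rewrite lebesgue_measure_itv/= lte_fin; case: ifPn => [_|]; first by rewrite -EFinD; congr EFin; ring.
  by rewrite -leNgt => ?; congr EFin; lra.
rewrite mulr0 (_ : xsection _ _ = set0) ?measure0//.
apply/seteqP; split => y //=; rewrite /xsection/= in_setE /= => -[/andP[y0 yx] _].
by have := le_lt_trans (le_trans y0 yx) x0; rewrite ltxx.
Qed.

Definition radius_measure : {measure set R -> \bar R} :=
  measure_function_pushforward__canonical__measure_function_Measure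
    (leb \x leb)%E measurable_radius.

(** The measure [2 * pi * u] du on the half-line [u >= 0], built from the area of the wedge instead
    of from a density. *)
Definition wedge_measure : {measure set R -> \bar R} :=
  measure_function_mscale__canonical__measure_function_Measure
    (NngNum (mulr_ge0 (ler0n R 2) (pi_ge0 R)))
    (measure_function_pushforward__canonical__measure_function_Measure
      (measure_function_mrestr__canonical__measure_function_Measure
        (leb \x leb)%E measurable_wedge) (@measurable_fst _ _ R R)).

Lemma wedge_measureE (D : set R) : measurable D ->
  wedge_measure D = (2 * pi)%:E * \int[leb]_x ((x * (0 <= x)%R%:R) * \1_D x)%:E.
Proof.
move=> mD; rewrite /wedge_measure /= /mscale /=; congr (_ * _).
rewrite /pushforward /mrestr /= setIC; apply: eq_integral => x _ /=.
exact: wedge_section.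
Qed.

Lemma radius_measureE (b : R) :
  radius_measure `]-oo, b[%classic = (pi * Num.max b 0 ^+ 2)%:E.
Proof.
rewrite /radius_measure /= /pushforward.
have [b0|b0] := leP 0%R b.
  by rewrite -lebesgue2_disk//; congr (product_measure1 _ _ _).
rewrite expr0n/= mulr0 (_ : _ @^-1` _ = set0) ?measure0//.
apply/seteqP; split => x //=; rewrite in_itv/= => xb.
by have := lt_trans xb b0; rewrite ltNge radius_ge0.
Qed.

Lemma integral_id (b : R) : (0 <= b)%R ->
  \int[leb]_(x in `[0%R, b]) x%:E = (b ^+ 2 / 2)%:E.
Proof.
move=> b0; have dF (x : R) : is_derive x 1%R (fun x : R => x ^+ 2 / 2)%R x.
  by apply: is_derive_eq; rewrite /GRing.scale/=; field.
rewrite (@integral_FTC (fun x => x) (fun x : R => x ^+ 2 / 2)%R 0%R b b0 dF).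
  by rewrite expr0n/= mul0r subr0.
by move=> x; exact: cvg_id.
Qed.

Lemma wedge_measure_itv (b : R) :
  wedge_measure `]-oo, b[%classic = (pi * Num.max b 0 ^+ 2)%:E.
Proof.
rewrite wedge_measureE//.
have [b0|b0] := leP 0%R b; last first.
  rewrite expr0n/= mulr0 integral0_eq ?mule0// => x _.
  rewrite indicE; have [x0|x0] := leP 0%R x; last by rewrite mulr0 mul0r.
  by rewrite memNset ?mulr0//= in_itv/= => /lt_trans/(_ b0); rewrite ltNge x0.
transitivity ((2 * pi)%:E * \int[leb]_(x in `[0%R, b[) x%:E).
  congr (_ * _); rewrite [RHS]integral_mkcond; apply: eq_integral => x _.
  rewrite patchE indicE; have [x0|x0] := leP 0%R x.
    rewrite mulr1 /=; case: ifPn; rewrite ?in_setE ?notin_setE/= in_itv/= x0/=.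
      by move=> xb; rewrite mem_set ?mulr1//= in_itv.
    by move=> xb; rewrite memNset ?mulr0//= in_itv.
  rewrite mulr0 mul0r; case: ifPn => //; rewrite in_setE/= in_itv/= => /andP[].
  by rewrite leNgt x0.
rewrite integral_itv_bndo_bndc//.
by rewrite integral_id// -EFinM; congr EFin; field.
Qed.

(** Both measures give the area of a disk to the rays []-oo, b[], which are stable under
    intersection, generate the sigma-algebra and exhaust the line with finite mass. *)
Lemma radius_measure_wedge (A : set R) : measurable A ->
  radius_measure A = wedge_measure A.
Proof.
apply: (@measure_unique _ R R (@RGenInftyO.G R) (fun n : nat => `]-oo, n%:R[%classic) _ _ _ _ radius_measure wedge_measure).
- exact: RGenInftyO.measurableE.
- move=> _ _ [a ->] [b ->]; exists (Num.min a b).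
  by apply/seteqP; split => x /=; rewrite !in_itv/= lt_min => /andP.
- by move=> n; exists n%:R.
- rewrite -subTset => x _; exists (Num.truncn `|x|%R).+1 => //=; rewrite in_itv/=.
  by rewrite (le_lt_trans (ler_norm x))// truncnS_gt.
- by move=> _ [b ->]; rewrite radius_measureE wedge_measure_itv.
- by move=> n; rewrite radius_measureE ltry.
Qed.

Lemma ge0_integral_mrestr d (T : measurableType d)
  (mu : {measure set T -> \bar R}) (D : set T) (mD : measurable D) (f : T -> \bar R) :
  measurable_fun [set: T] f -> (forall x, 0 <= f x) ->
  \int[mrestr mu mD]_x f x = \int[mu]_(x in D) f x.
Proof.
move=> mf f0; rewrite -(setUv D) ge0_integral_setU//; last 3 first.
- exact: measurableC.
- by rewrite setUv.
- exact/disj_setPCl.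
rewrite [X in _ + X](_ : _ = 0) ?adde0.
  apply: eq_measure_integral => A mA AD.
  by rewrite -[in RHS](setIidl AD).
apply: null_set_integral => //; [exact: measurableC|exact: measurable_funTS|].
by rewrite -(measure0 mu) -(setICl D).
Qed.

(** Polar coordinates without a change of variables in the plane: the image of the area under
    [radius] is [wedge_measure], and Tonelli on the wedge turns each slice into the factor [u]. *)
Lemma ge0_integral_radial (G : R -> \bar R) :
  measurable_fun [set: R] G -> (forall x, 0 <= G x) ->
  \int[(leb \x leb)%E]_p G (radius p) =
  (2 * pi)%:E * \int[leb]_u ((u * (0 <= u)%R%:R)%:E * G u).
Proof.
move=> mG G0.
rewrite -[LHS](@ge0_integral_pushforward _ _ (measurableTypeR R * measurableTypeR R)%type R R _ measurable_radius (leb \x leb)%E setT G)//.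
transitivity (\int[wedge_measure]_x G x).
  by apply: (@eq_measure_integral _ _ _ _ wedge_measure radius_measure) => A mA _; exact: radius_measure_wedge.
rewrite /wedge_measure ge0_integral_mscale//=; congr (_ * _).
rewrite (@ge0_integral_pushforward _ _ (measurableTypeR R * measurableTypeR R)%type R R _ (@measurable_fst _ _ R R)
  (measure_function_mrestr__canonical__measure_function_Measure (leb \x leb)%E measurable_wedge) setT G)//.
have mGf : measurable_fun [set: R * R] (G \o fst) by exact: (measurableT_comp mG measurable_fst).
rewrite preimage_setT (@ge0_integral_mrestr _ _ (leb \x leb)%E _ measurable_wedge _ mGf)//.
rewrite integral_mkcond (fubini_tonelli1 (m1:=leb) (m2:=leb)); last 2 first.
- by apply: (measurable_restrictT _ measurable_wedge).1; apply: (measurable_funS measurableT _ mGf).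
- by move=> p; apply: erestrict_ge0 => q _ /=.
apply: eq_integral => u _; rewrite /fubini_F /=.
transitivity (\int[leb]_(y in xsection (wedge `&` fst @^-1` setT) u) G u).
  rewrite [RHS]integral_mkcond; apply: eq_integral => y _.
  rewrite !patchE /xsection /= preimage_setT setIT.
  suff -> : (y \in [set y0 | (u, y0) \in wedge]) = ((u, y) \in wedge) by [].
  by apply/idP/idP => [/set_mem|/mem_set].
rewrite integral_cst//; last first.
  by apply: measurable_xsection; rewrite setIT; exact: measurable_wedge.
  by rewrite [X in _ * X]wedge_section indicT mulr1 muleC.
by move=> x; exact: G0.
Qed.
End Lebesgue.

Lemma integral_bool d (T : measurableType d) (R : realType)
  (mu : {measure set T -> \bar R}) (D : set T) (b : T -> bool) :
  measurable D -> measurable_fun [set: T] b ->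
  (\int[mu]_(x in D) ((b x)%:R : R)%:E = mu (D `&` [set x | b x]))%E.
Proof.
move=> mD mb; have mE := measurable_pred mb.
rewrite setIC -integral_indic//; apply: eq_integral => x _.
suff E : (x \in [set x | b x]) = b x by rewrite indicE E.
by apply/idP/idP => [/set_mem|/mem_set].
Qed.

(** * Uniform directions and the arccosine *)

Section Angle.
Context {R : realType}.
Local Notation leb := (@lebesgue_measure R).

Lemma polar_angle (a b : R) (r : R) : r = Num.sqrt (a ^+ 2 + b ^+ 2) -> 0 < r ->
  exists2 phi, 0 <= phi <= 2 * pi & a = r * cos phi /\ b = r * sin phi.
Proof.
move=> rE r0; have rn0 : r != 0 by rewrite gt_eqF.
have r2 : r ^+ 2 = a ^+ 2 + b ^+ 2.
  by rewrite rE sqr_sqrtr// addr_ge0// sqr_ge0.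
have a1 : -1 <= a / r <= 1.
  rewrite -ler_norml normrM normfV (gtr0_norm r0) ler_pdivrMr// mul1r.
  by rewrite -sqrtr_sqr rE ler_sqrt ?addr_ge0 ?sqr_ge0// lerDl sqr_ge0.
have p0 := acos_ge0 a1; have p1 := acos_lepi a1.
have ca : cos (acos (a / r)) = a / r by rewrite acosK// in_itv.
have aE : a = r * cos (acos (a / r)) by rewrite ca mulrC divfK.
have sE : r * sin (acos (a / r)) = `|b|.
  rewrite sin_acos// -{1}(gtr0_norm r0) -sqrtr_sqr -sqrtrM ?sqr_ge0// -sqrtr_sqr; congr Num.sqrt.
  by rewrite mulrBr mulr1 -exprMn mulrC divfK// r2 addrAC subrr add0r.
have [b0|b0] := leP 0 b.
  exists (acos (a / r)); first by rewrite p0/= (le_trans p1)//; have := @pi_ge0 R; lra.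
  by split => //; rewrite sE ger0_norm.
exists (2 * pi - acos (a / r)).
  by rewrite subr_ge0 gerBl p0 andbT (le_trans p1)//; have := @pi_ge0 R; lra.
have c2 : cos (2 * pi : R) = 1 by rewrite mulr_natl cos2pi.
have s2 : sin (2 * pi : R) = 0 by rewrite mulr_natl sin2pi.
rewrite cosB sinB c2 s2 !mul0r !mul1r addr0 sub0r mulrN sE; split => //.
by rewrite ltr0_norm// opprK.
Qed.

Lemma integral_periodic (T phi : R) (f : R -> R) :
  0 <= phi <= T -> (forall x, f (x + T) = f x) -> (forall x, 0 <= f x) ->
  measurable_fun [set: R] f ->
  (\int[leb]_(x in `[0%R, T[) (f (x - phi))%:E = \int[leb]_(x in `[0%R, T[) (f x)%:E)%E.
Proof.
move=> /andP[p0 pT] fT f0 mf.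
have mfD (D : set R) : measurable_fun D (EFin \o f) by apply/measurable_EFinP; exact: measurable_funTS.
have shift (c : R) (D : interval R) (E : interval R) :
    (forall x : R, (x \in D) = (x + c \in E)) ->
    (\int[leb]_(x in [set` D]) (f (x + c))%:E = \int[leb]_(x in [set` E]) (f x)%:E)%E.
  move=> DE; rewrite [LHS]integral_mkcond [RHS]integral_mkcond.
  rewrite -[RHS](ge0_integral_shift c (f := _ \_ _)).
  - by apply: eq_integral => x _; rewrite !patchE !mem_setE DE.
  - by apply/(measurable_restrictT _ _).1 => //; exact: mfD.
  - by move=> x; apply: erestrict_ge0 => y _; rewrite lee_fin.
rewrite (shift (- phi) _ `[- phi, T - phi[); last first.
  by move=> x; rewrite !in_itv/=; apply/idP/idP; lra.
have split_itv (a b c : R) : a <= b -> b <= c ->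
    (\int[leb]_(x in `[a, c[) (f x)%:E = \int[leb]_(x in `[a, b[) (f x)%:E + \int[leb]_(x in `[b, c[) (f x)%:E)%E.
  move=> ab bc; rewrite -ge0_integral_setU//.
  - by congr integral; apply/seteqP; split => x /=; rewrite !in_itv/=; [|]; lra.
  - exact: mfD.
  - by move=> x _; rewrite lee_fin.
  - by apply/disj_setPS => x /= []; rewrite !in_itv/=; lra.
(* The window [[- phi, T - phi[] is cut at 0 and its negative part is carried forward by one
   period. *)
rewrite (split_itv _ 0)//; [|lra|lra].
rewrite [RHS](split_itv _ (T - phi))//; [|lra|lra].
rewrite addeC; congr (_ + _)%E.
rewrite -(shift T `[- phi, 0[ `[T - phi, T[); first by apply: eq_integral => x _; rewrite fT.
by move=> x; rewrite !in_itv/=; apply/idP/idP; lra.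
Qed.

(** Distribution function at [k] of the cosine of a uniform angle. *)
Definition arc_frac (k : R) : R :=
  if k < -1 then 0 else if 1 <= k then 1 else 1 - acos k / pi.

Lemma measure_cos_le (k : R) :
  leb (`[0%R, (2 * pi)%R[%classic `&` [set th | cos th <= k]) = (2 * pi * arc_frac k)%:E.
Proof.
have pi0 := @pi_gt0 R; rewrite /arc_frac.
case: ifPn => [k1|]; [|rewrite -leNgt => k1; case: ifPn => [k2|]; [|rewrite -ltNge => k2]].
- rewrite mulr0 (_ : _ `&` _ = set0) ?measure0//.
  apply/seteqP; split => x //= -[_ xk]; have := lt_le_trans (le_lt_trans xk k1) (cos_geN1 x).
  by rewrite ltxx.
- rewrite mulr1 (_ : _ `&` _ = `[0%R, (2 * pi)%R[%classic); last first.
    by apply/setIidl => x _ /=; exact: le_trans (cos_le1 x) k2.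
  by rewrite lebesgue_measure_itv/= lte_fin mulr_gt0// -EFinD subr0.
- have k3 : -1 <= k <= 1 by rewrite k1 ltW.
  have a0 : 0 < acos k by rewrite acos_gt0// k1.
  have a1 := acos_lepi k3; have ca : cos (acos k) = k by rewrite acosK// in_itv.
  (* The cosine decreases on [[0, pi]], and the reflection [2 * pi - th] carries the other half of
     the circle there. *)
  rewrite (_ : _ `&` _ = `[acos k, (2 * pi - acos k)%R]%classic); last first.
    have half th : 0 <= th <= pi -> (cos th <= k) = (acos k <= th).
      by move=> th0; rewrite -{1}ca !leNgt ltr_cos// in_itv/= ?(ltW a0) ?a1.
    have c2 : cos (2 * pi : R) = 1 by rewrite mulr_natl cos2pi.
    have s2 : sin (2 * pi : R) = 0 by rewrite mulr_natl sin2pi.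
    have refl (th : R) : cos (2 * pi - th) = cos th by rewrite cosB c2 s2 mul0r mul1r addr0.
    apply/seteqP; split => th /=; rewrite !in_itv/=.
      move=> [/andP[t0 t1]]; have [tp|tp] := leP th pi.
        by rewrite half ?t0// => ->/=; lra.
      by rewrite -refl half; lra.
    move=> /andP[t0 t1]; split; first lra.
    have [tp|tp] := leP th pi; first by rewrite half//; lra.
    by rewrite -refl half; lra.
  rewrite lebesgue_measure_itv/= lte_fin; case: ifPn => [_|].
    have -> : 2 * pi * (1 - acos k / pi) = 2 * pi - acos k - acos k.
      by rewrite mulrBr mulr1 mulrA mulrAC mulfK ?gt_eqF//; ring.
    by rewrite -EFinD.
  rewrite -leNgt => H; have -> : acos k = pi by lra.
  by rewrite divff ?gt_eqF// subrr mulr0.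
Qed.

(** In polar form [a * cos th + b * sin th] is [r * cos (th - phi)], and the phase disappears by
    periodicity. *)
Lemma integral_angle (a b c r : R) : r = Num.sqrt (a ^+ 2 + b ^+ 2) -> 0 < r ->
  (\int[leb]_(th in `[0%R, (2 * pi)%R[) ((a * cos th + b * sin th <= c)%R%:R : R)%:E
   = (2 * pi * arc_frac (c / r))%:E)%E.
Proof.
move=> rE r0; have [phi phi0 [-> ->]] := polar_angle rE r0.
pose f (x : R) : R := (cos x <= c / r)%R%:R.
transitivity (\int[leb]_(th in `[0%R, (2 * pi)%R[) (f (th - phi))%:E)%E.
  apply: eq_integral => x _; rewrite /f cosB; congr (nat_of_bool _)%:R%:E.
  by rewrite ler_pdivlMr//; congr (_ <= _); ring.
have mb : measurable_fun [set: R] (fun x : R => cos x <= c / r) by mfun.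
rewrite integral_periodic//.
- by rewrite -measure_cos_le -integral_bool.
- by move=> x; rewrite /f mulr_natl cosD2pi.
- by rewrite /f; mfun.
Qed.
End Angle.

(** * Poisson counts *)

Definition pois {R : realType} (a : R) (k : nat) : R := expR (- a) * a ^+ k / k`!%:R.

Lemma pois_ge0 {R : realType} (a : R) k : 0 <= a -> 0 <= pois a k.
Proof. by move=> a0; rewrite /pois divr_ge0// mulr_ge0 ?expR_ge0 ?exprn_ge0. Qed.

(** Probability generating function of the Poisson law, as an exponential series. *)
Lemma cvg_pois {R : realType} (a y : R) :
  (fun M => \sum_(j < M) (pois a j * y ^+ j)) @ \oo --> expR (- (a * (1 - y))).
Proof.
have -> : expR (- (a * (1 - y))) = expR (- a) * expR (a * y).
  by rewrite -expRD; congr expR; ring.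
have -> : (fun M => \sum_(j < M) (pois a j * y ^+ j)) =
          (fun M => expR (- a) * series (exp_coeff (a * y)) M).
  apply/funext => M; rewrite /series/= big_mkord mulr_sumr; apply: eq_bigr => j _.
  by rewrite /pois /exp_coeff/= exprMn; ring.
apply: cvgMr; rewrite expRE.
have -> : pseries (fun n => (n`!%:R)^-1) (a * y) = series (exp_coeff (a * y)).
  by rewrite exp_coeffE.
exact: is_cvg_series_exp_coeff.
Qed.

Section Counting.
Context {T : choiceType} {R : realType}.
Local Notation counting := (@counting T R).
Implicit Types A : set T.

Definition card_of A : nat := #|` fset_set A|.

Lemma counting_fin A : finite_set A -> counting A = (card_of A)%:R%:E.
Proof. by move=> fA; rewrite /counting_measure.counting asboolT. Qed.

Lemma counting_natP A (k : nat) :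
  counting A = k%:R%:E <-> finite_set A /\ card_of A = k.
Proof.
split=> [|[fA <-]]; last exact: counting_fin.
rewrite /counting_measure.counting; case: ifPn => // /asboolP fA [/eqP].
by rewrite eqr_nat => /eqP.
Qed.

Lemma counting_eq0 A : counting A = 0%:E <-> A = set0.
Proof.
split=> [/(counting_natP A 0)[fA]|->]; last by rewrite counting_fin// /card_of fset_set0.
by rewrite /card_of => /cardfs0_eq/(congr1 (fun X => [set` X])); rewrite fset_setK// => ->; apply/seteqP; split => x //=; rewrite inE.
Qed.

Lemma counting_eq1 A : counting A = 1%:E <-> exists p, A = [set p].
Proof.
split=> [/(counting_natP A 1)[fA]|[p ->]].
  rewrite /card_of => /eqP/cardfs1P[p Ap]; exists p.
  by rewrite -(fset_setK fA) Ap; apply/seteqP; split => x /=; rewrite inE => /eqP.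
by rewrite counting_fin// /card_of fset_set1 cardfs1.
Qed.
End Counting.

Lemma measure_fin_exists {d} {T : measurableType d} {R : realType}
  (mu : {measure set T -> \bar R}) (I : finType) (F : I -> set T) :
  (forall i, measurable (F i)) -> (forall i j w, F i w -> F j w -> i = j) ->
  measurable [set w | exists i, F i w] /\
  mu [set w | exists i, F i w] = (\sum_i mu (F i))%E.
Proof.
move=> mF dF.
have -> : [set w | exists i, F i w] = \bigcup_(i in [set: I]) F i.
  by apply/seteqP; split => w /= [i]; [exists i|move=> _; exists i].
split; first by apply: fin_bigcup_measurable.
rewrite measure_fin_bigcup//; last by move=> i j _ _ [w [Fi Fj]]; exact: dF Fi Fj.
rewrite [RHS]fsbig_seq ?index_enum_uniq//; apply: eq_fsbigl.
  by apply/seteqP; split => i //= _; rewrite mem_index_enum.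
exact: finite_finset.
Qed.

Section PPP.
Context {R : realType} d (T : measurableType d) (Pr : probability T R).
Variables (mu : set (mpt R) -> \bar R) (Phi : T -> set (mpt R)).
Hypothesis HP : is_PPP Pr mu Phi.

Definition npts w A : \bar R := @counting _ R (Phi w `&` A).

(** Indexing by an arbitrary finite type lets the inner disk, the two parts of the annulus and the
    outer cells form one family over a sum type. *)
Lemma PPP_fin (I : finType) (A : I -> set (mpt R)) (k : I -> nat) :
  (forall i, measurable (A i)) -> (forall i, (mu (A i) < +oo)%E) ->
  (forall i j, i != j -> A i `&` A j = set0) ->
  measurable [set w | forall i, npts w (A i) = (k i)%:R%:E] /\
  Pr [set w | forall i, npts w (A i) = (k i)%:R%:E] =
    (\prod_i pois (fine (mu (A i))) (k i))%:E.
Proof.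
move=> mA fA dA; have := @HP #|I| (fun i => A (enum_val i)) (fun i => k (enum_val i)).
case.
- by move=> i; exact: mA.
- by move=> i; exact: fA.
- by move=> i j ij; apply: dA; rewrite (inj_eq enum_val_inj).
set E := [set w | _]; have -> : E = [set w | forall i, npts w (A i) = (k i)%:R%:E].
  apply/seteqP; split => w /= H i; last exact: H.
  by have := H (enum_rank i); rewrite enum_rankK.
move=> mE PE; split => //; rewrite PE; congr EFin.
by rewrite -(big_enum_val (A := I) (fun i => pois (fine (mu (A i))) (k i))).
Qed.

Lemma PPP_count (A : set (mpt R)) (k : nat) :
  measurable A -> (mu A < +oo)%E ->
  measurable [set w | npts w A = k%:R%:E] /\
  Pr [set w | npts w A = k%:R%:E] = (pois (fine (mu A)) k)%:E.
Proof.
move=> mA fA; have [] := @PPP_fin unit (fun=> A) (fun=> k) (fun=> mA) (fun=> fA).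
  by move=> [] [].
rewrite (_ : [set w | _] = [set w | npts w A = k%:R%:E]); last first.
  by apply/seteqP; split => w /= => [/(_ tt)//|H _].
by move=> mE ->; split => //; rewrite (bigD1 tt)//= big1 ?mulr1// => -[].
Qed.

(** [is_PPP] does not mention infinite counts; they are excluded almost surely because the Poisson
    weights of the finite ones sum to 1. *)
Lemma PPP_finite (A : set (mpt R)) : measurable A -> (mu A < +oo)%E ->
  measurable [set w | finite_set (Phi w `&` A)] /\
  Pr [set w | finite_set (Phi w `&` A)] = 1%:E.
Proof.
move=> mA fA; pose F (j : nat) := [set w | npts w A = j%:R%:E].
have mF j : measurable (F j) := (PPP_count j mA fA).1.
pose E M := [set w | exists i : 'I_M, F i w].
have PE M : measurable (E M) /\ Pr (E M) = (\sum_(j < M) Pr (F j))%E.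
  apply: measure_fin_exists => // i j w; rewrite /F/= => -> [/eqP].
  by rewrite eqr_nat => /eqP ij; exact: val_inj.
have EE : \bigcup_M E M = [set w | finite_set (Phi w `&` A)].
  apply/seteqP; split => w /=; first by move=> [M _] [j] /counting_natP[].
  move=> fw; exists (card_of (Phi w `&` A)).+1 => //; exists ord_max.
  exact: counting_fin.
have mE M := (PE M).1.
have mU : measurable (\bigcup_M E M) by exact: bigcup_measurable.
split; first by rewrite -EE.
have : Pr \o E @ \oo --> 1%:E.
  rewrite (_ : Pr \o E = EFin \o (fun M => \sum_(j < M) (pois (fine (mu A)) j * 1 ^+ j))).
    apply: cvg_EFin; first exact: nearW.
    by have := @cvg_pois R (fine (mu A)) 1; rewrite subrr mulr0 oppr0 expR0.
  apply/funext => M /=; rewrite (PE M).2 -sumEFin; apply: eq_bigr => j _.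
  by rewrite expr1n mulr1 (PPP_count j mA fA).2.
move=> /cvg_lim <- //.
rewrite -EE; apply/esym/cvg_lim => //; apply: nondecreasing_cvg_mu => //.
move=> M N MN; apply/subsetPset => w [i H]; by exists (widen_ord MN i).
Qed.

End PPP.

(** * The nearest point and finitely many cells *)

Lemma cvgn_prod {R : realType} (I : finType) (f : I -> nat -> R) (l : I -> R) :
  (forall i, f i @ \oo --> l i) ->
  (fun M => \prod_i f i M) @ \oo --> \prod_i l i.
Proof.
move=> fl; elim: (index_enum I) => [|i r IH].
  by under eq_fun do rewrite big_nil; rewrite big_nil; exact: cvg_cst.
under eq_fun do rewrite big_cons.
by rewrite big_cons; apply: cvgM; [exact: fl|exact: IH].
Qed.

Section Cells.
Context {R : realType} d (T : measurableType d) (Pr : probability T R).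
Variables (mu : set (mpt R) -> \bar R) (Phi : T -> set (mpt R)).
Hypothesis HP : is_PPP Pr mu Phi.
Variables (nu : {measure set (mpt R) -> \bar R}) (W : mpt R -> R).
Hypotheses (mW : measurable_fun [set: mpt R] W) (W0 : forall p, 0 <= W p).
Hypothesis muE : forall A, measurable A -> mu A = (\int[nu]_(p in A) (W p)%:E)%E.
Local Notation npts := (npts Phi).
Local Notation leb := (@lebesgue_measure R).

Lemma mu_ge0 A : measurable A -> (0 <= mu A)%E.
Proof. by move=> mA; rewrite muE//; apply: integral_ge0 => p _; rewrite lee_fin. Qed.

Let mWE A : measurable_fun A (fun p => (W p)%:E).
Proof. by apply/measurable_EFinP; exact: measurable_funTS. Qed.

Lemma mu_setU A B : measurable A -> measurable B -> A `&` B = set0 ->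
  mu (A `|` B) = (mu A + mu B)%E.
Proof.
move=> mA mB AB; rewrite !muE//; last exact: measurableU.
rewrite ge0_integral_setU//; last exact/disj_set2P.
by move=> p _; rewrite lee_fin.
Qed.

Lemma le_mu A B : measurable A -> measurable B -> A `<=` B -> (mu A <= mu B)%E.
Proof.
move=> mA mB AB; rewrite !muE//; apply: ge0_subset_integral => //.
by move=> p _; rewrite lee_fin.
Qed.

(** Roles in the application: [B] is the disk that must be empty, [D] the annulus with the serving
    point, [phi] the largest interference that this point can stand, and the [A i] are outer cells
    in which each point contributes [c i]. *)
Variables (B D : set (mpt R)) (phi : mpt R -> R) (wt s : R * R -> R).
Hypotheses (mB : measurable B) (mD : measurable D).
Hypotheses (fB : (mu B < +oo)%E) (fD : (mu D < +oo)%E) (BD0 : B `&` D = set0).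
Hypotheses (mphi : measurable_fun [set: mpt R] phi).
Hypotheses (mwt : measurable_fun [set: R * R] wt) (wt0 : forall x, 0 <= wt x).
Hypotheses (ms : measurable_fun [set: R * R] s) (s0 : forall x, 0 <= s x).
(** The memoryless law of the serving gain: as a function of the interference level [x], the
    intensity is a mixture over positions [z] of exponentials with rate [s z]. *)
Hypothesis HD : forall x, 0 <= x -> mu (D `&` [set p | x <= phi p]) =
  (\int[(leb \x leb)%E]_z (wt z * expR (- (s z * x)))%:E)%E.

Let mge x : measurable (D `&` [set p | x <= phi p]).
Proof. by apply: measurableI => //; apply: measurable_pred; mfun. Qed.

Let mlt x : measurable (D `&` [set p | phi p < x]).
Proof. by apply: measurableI => //; apply: measurable_pred; mfun. Qed.

Variables (m : nat) (A : 'I_m -> set (mpt R)) (c : 'I_m -> R).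
Hypotheses (mA : forall i, measurable (A i)) (fA : forall i, (mu (A i) < +oo)%E).
Hypotheses (dA : forall i j, i != j -> A i `&` A j = set0).
Hypotheses (BA : forall i, B `&` A i = set0) (DA : forall i, D `&` A i = set0).
Hypothesis c0 : forall i, 0 <= c i.

(** That [D] has a single point and this point satisfies [x <= phi p] is expressed by two counts in
    disjoint sets, one above and one below the threshold, so that the Poisson law applies. *)
Let cell_event (x : R) (n : 'I_m -> nat) := [set w | npts w B = 0%:E /\
  npts w (D `&` [set p | x <= phi p]) = 1%:E /\
  npts w (D `&` [set p | phi p < x]) = 0%:E /\ forall i, npts w (A i) = (n i)%:R%:E].

Let cell_event_prob (x : R) (n : 'I_m -> nat) : 0 <= x ->
  measurable (cell_event x n) /\
  Pr (cell_event x n) = (expR (- (fine (mu B) + fine (mu D))) *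
    fine (mu (D `&` [set p | x <= phi p])) *
    \prod_i pois (fine (mu (A i))) (n i))%:E.
Proof.
move=> x0.
have disj (X Y : set (mpt R)) p : X `&` Y = set0 -> X p -> Y p -> False.
  by move=> XY Xp Yp; have : (X `&` Y) p by []; rewrite XY.
have BDf p := disj _ _ p BD0; have BAf i p := disj _ _ p (BA i).
have DAf i p := disj _ _ p (DA i).
pose F (i : unit + bool + 'I_m) : set (mpt R) := match i with
  | inl (inl _) => B
  | inl (inr true) => D `&` [set p | x <= phi p]
  | inl (inr false) => D `&` [set p | phi p < x]
  | inr i => A i end.
pose k (i : unit + bool + 'I_m) : nat := match i with
  | inl (inl _) => 0%N | inl (inr true) => 1%N | inl (inr false) => 0%N
  | inr i => n i end.
have := @PPP_fin R d T Pr mu Phi HP _ F k.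
case.
- by move=> [[[]|[]]|i] /=; [exact: mB|exact: mge|exact: mlt|exact: mA].
- move=> [[[]|[]]|i] //=; apply: le_lt_trans fD; apply: le_mu => //; exact: subIsetl.
- move=> i j ij; apply/seteqP; split => p //.
  case: i j ij => [[[]|[]]|i] [[[]|[]]|j] //= ij [].
  + by move=> Bp [Dp _]; exact: BDf Bp Dp.
  + by move=> Bp [Dp _]; exact: BDf Bp Dp.
  + by move=> Bp; exact: BAf.
  + by move=> [Dp _] Bp; exact: BDf Bp Dp.
  + by move=> [_ xp] [_ px]; move: (lt_le_trans px xp); rewrite ltxx.
  + by move=> [Dp _]; exact: DAf.
  + by move=> [Dp _] Bp; exact: BDf Bp Dp.
  + by move=> [_ px] [_ xp]; move: (lt_le_trans px xp); rewrite ltxx.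
  + by move=> [Dp _]; exact: DAf.
  + by move=> Ap Bp; exact: BAf Bp Ap.
  + by move=> Ap [Dp _]; exact: DAf Dp Ap.
  + by move=> Ap [Dp _]; exact: DAf Dp Ap.
  + by have Aij : A i `&` A j = set0 by [apply: dA]; exact: disj Aij.
rewrite (_ : [set w | _] = cell_event x n); last first.
  apply/seteqP; split => w /=.
    move=> H; split; first exact: (H (inl (inl tt))).
    split; first exact: (H (inl (inr true))).
    by split; [exact: (H (inl (inr false)))|move=> i; exact: (H (inr i))].
  by move=> [HB [H1 [H2 H3]]] [[[]|[]]|i] /=.
move=> mE ->; split => //; congr EFin.
rewrite big_sumType/= big_sumType/= big_bool (bigD1 tt)//= big1 ?mulr1; last by case.
rewrite /pois/= !expr0 expr1 !divr1 !mulr1; congr (_ * _).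
(* The void factors of the two parts of [D] recombine into [expR (- mu D)]; the upper part also
   leaves its mass as a factor, from its count 1. *)
have DE : fine (mu D) = fine (mu (D `&` [set p | x <= phi p])) + fine (mu (D `&` [set p | phi p < x])).
  rewrite -fineD.
  - congr fine; rewrite -mu_setU//; last first.
      by apply/seteqP; split => p //= -[[_ xp] [_ px]]; move: (lt_le_trans px xp); rewrite ltxx.
    congr mu; apply/seteqP; split => p /=; last by case=> -[].
    by move=> Dp; have [?|?] := leP x (phi p); [left|right].
  - rewrite ge0_fin_numE ?mu_ge0//; apply: le_lt_trans fD; apply: le_mu => //; exact: subIsetl.
  - rewrite ge0_fin_numE ?mu_ge0//; apply: le_lt_trans fD; apply: le_mu => //; exact: subIsetl.
rewrite DE !opprD !expRD; ring.
Qed.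

(** With all counts below [M] the event is a finite disjoint union, one piece for each count vector,
    and on each piece the interference is a constant to which [HD] applies. *)
Lemma cells_prob_trunc M : let G := [set w | exists n : {ffun 'I_m -> 'I_M},
    cell_event (\sum_i c i * (n i)%:R) (fun i => n i) w] in
  measurable G /\ Pr G = (\int[(leb \x leb)%E]_z
    (expR (- (fine (mu B) + fine (mu D))) * (wt z *
     \prod_i \sum_(j < M) pois (fine (mu (A i))) j * expR (- (s z * c i)) ^+ j))%:E)%E.
Proof.
move=> G; set K := expR _.
have x0 (n : {ffun 'I_m -> 'I_M}) : 0 <= \sum_i c i * (n i)%:R.
  by apply: sumr_ge0 => i _; rewrite mulr_ge0.
have [mG ->] := @measure_fin_exists _ _ _ Pr _
  (fun n : {ffun 'I_m -> 'I_M} => cell_event (\sum_i c i * (n i)%:R) (fun i => n i))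
  (fun n => (cell_event_prob _ (x0 n)).1)
  ltac:(by move=> n n' w [_ [_ [_ H]]] [_ [_ [_ H']]]; apply/ffunP => i; apply: val_inj;
    move: (H i); rewrite H' => -[/eqP]; rewrite eqr_nat => /eqP).
split => //.
have pg0 i j : 0 <= pois (fine (mu (A i))) j by rewrite pois_ge0// fine_ge0// mu_ge0.
have K0 (n : {ffun 'I_m -> 'I_M}) : 0 <= K * \prod_i pois (fine (mu (A i))) (n i).
  by rewrite mulr_ge0 ?expR_ge0// prodr_ge0.
have mI x : measurable_fun [set: R * R] (fun z => (wt z * expR (- (s z * x)))%:E) by mfun.
have I0 x z : (0 <= (wt z * expR (- (s z * x)))%:E)%E by rewrite lee_fin mulr_ge0// expR_ge0.
transitivity (\sum_(n : {ffun 'I_m -> 'I_M}) \int[(leb \x leb)%E]_z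
   ((K * \prod_i pois (fine (mu (A i))) (n i))%:E *
   (wt z * expR (- (s z * (\sum_i c i * (n i)%:R))))%:E))%E.
  apply: eq_bigr => n _; apply: (etrans (cell_event_prob (fun i => nat_of_ord (n i)) (x0 n)).2).
  rewrite mulrAC EFinM ge0_integralZl_EFin//; last exact: mI.
  rewrite -HD// fineK// ge0_fin_numE ?mu_ge0//.
  by apply: le_lt_trans fD; apply: le_mu => //; exact: subIsetl.
rewrite -ge0_integral_sum//; last 2 first.
- by move=> n; apply: measurable_funeM; exact: mI.
- by move=> n z _; rewrite mule_ge0// lee_fin.
apply: eq_integral => z _; rewrite sumEFin; congr EFin.
(* The exponential of the weighted sum of counts is a product over cells, so the sum over count
   vectors becomes a product of truncated generating functions. *)
rewrite bigA_distr_bigA !mulr_sumr; apply: eq_bigr => n _.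
rewrite [X in _ = _ * (_ * X)]big_split/=.
have -> : expR (- (s z * \sum_i c i * (n i)%:R)) = \prod_i expR (- (s z * c i)) ^+ n i.
  rewrite mulr_sumr -sumrN expR_sum; apply: eq_bigr => i _.
  by rewrite mulrA -mulNr expRM_natr.
by ring.
Qed.

(** The truncated events increase to [G]. On the other side monotone convergence lets [M] grow, and
    each factor tends to a Poisson generating function. *)
Lemma cells_prob : let G := [set w | npts w B = 0%:E /\
    exists2 p, Phi w `&` D = [set p] & (forall i, finite_set (Phi w `&` A i)) /\
      \sum_i c i * (card_of (Phi w `&` A i))%:R <= phi p] in
  measurable G /\ Pr G = (\int[(leb \x leb)%E]_z
    (expR (- (fine (mu B) + fine (mu D))) * (wt z *
     expR (- (\sum_i fine (mu (A i)) * (1 - expR (- (s z * c i)))))))%:E)%E.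
Proof.
move=> G; pose GM M := [set w | exists n : {ffun 'I_m -> 'I_M},
    cell_event (\sum_i c i * (n i)%:R) (fun i => n i) w].
have mGM M : measurable (GM M) := (cells_prob_trunc M).1.
have GE : \bigcup_M GM M = G.
  apply/seteqP; split => w /=.
    move=> [M _] [n [HB [H1 [H0 HA]]]]; split => //.
    have [p pE] := (counting_eq1 _).1 H1; have E0 := (counting_eq0 _).1 H0.
    have DE : Phi w `&` D = [set p].
      rewrite -pE; apply/seteqP; split => q; last by move=> [? []].
      move=> [Pq Dq]; split => //; split => //=; rewrite leNgt; apply/negP => qx.
      have : (Phi w `&` (D `&` [set q | phi q < \sum_i c i * (n i)%:R])) q by [].
      by rewrite E0.
    have fin i := (counting_natP _ _).1 (HA i).
    exists p => //; split; first by move=> i; have [] := fin i.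
    have : (Phi w `&` (D `&` [set p | \sum_i c i * (n i)%:R <= phi p])) p by rewrite pE.
    move=> [_ [_ /=]]; apply: le_trans; apply: ler_sum => i _.
    by have [_ ->] := fin i.
  move=> [HB [p pE [fin H]]].
  (* Each count is at most the sum of all counts, hence below its successor. *)
  pose M := (\sum_i card_of (Phi w `&` A i)).+1; exists M => //.
  have cM i : (card_of (Phi w `&` A i) < M)%N by rewrite ltnS (bigD1 i)//= leq_addr.
  exists [ffun i => Ordinal (cM i)]; set x := \sum_i _.
  have xE : x = \sum_i c i * (card_of (Phi w `&` A i))%:R.
    by apply: eq_bigr => i _; rewrite ffunE.
  have [Pp Dp] : (Phi w `&` D) p by rewrite pE.
  split => //; split; [|split].
  - apply/counting_eq1; exists p; apply/seteqP; split => q.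
      by move=> [Pq [Dq _]]; rewrite -pE.
    by move=> /= ->; split => //; split => //=; rewrite xE.
  - apply/counting_eq0; apply/seteqP; split => q // [Pq [Dq /= qx]].
    have : (Phi w `&` D) q by []. rewrite pE => /= qp.
    by move: qx; rewrite qp xE ltNge H.
  - by move=> i; apply/counting_natP; split => //; rewrite ffunE.
have mU : measurable (\bigcup_M GM M) by exact: bigcup_measurable.
split; first by rewrite -GE.
set K := expR _; have K0 : 0 <= K by exact: expR_ge0.
pose g M (z : R * R) : \bar R := (K * (wt z *
     \prod_i \sum_(j < M) pois (fine (mu (A i))) j * expR (- (s z * c i)) ^+ j))%:E.
have t0 i z j : 0 <= pois (fine (mu (A i))) j * expR (- (s z * c i)) ^+ j.
  by rewrite mulr_ge0 ?exprn_ge0 ?expR_ge0// pois_ge0// fine_ge0// mu_ge0.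
have prod0 z M : 0 <= \prod_i \sum_(j < M) pois (fine (mu (A i))) j * expR (- (s z * c i)) ^+ j.
  by apply: prodr_ge0 => i _; apply: sumr_ge0 => j _; exact: t0.
have mg M : measurable_fun [set: R * R] (g M).
  apply/measurable_EFinP; apply: mfun_mul; first by mfun.
  apply: mfun_mul => //; apply: measurable_prod => i _; apply: measurable_sum => j.
  by mfun.
have g0 M z : (0 <= g M z)%E by rewrite lee_fin mulr_ge0// mulr_ge0.
have gnd z : {homo g ^~ z : a b / (a <= b)%N >-> (a <= b)%E}.
  move=> a b ab; rewrite lee_fin ler_wpM2l// ler_wpM2l//; apply: ler_prod => i _.
  apply/andP; split; first by apply: sumr_ge0 => j _; exact: t0.
  rewrite -!(big_mkord xpredT (fun j => pois (fine (mu (A i))) j * expR (- (s z * c i)) ^+ j)).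
  rewrite [leRHS](big_cat_nat (leq0n a) ab)/= lerDl sumr_ge0// => j _; exact: t0.
transitivity (limn (fun M => \int[(leb \x leb)%E]_z g M z)%E).
  rewrite -GE; apply/esym/cvg_lim => //.
  rewrite (_ : (fun M => _) = Pr \o GM).
    apply: nondecreasing_cvg_mu => // M N MN; apply/subsetPset => w [n [HB [H1 [H2 H3]]]].
    exists [ffun i => widen_ord MN (n i)].
    rewrite (eq_bigr (fun i => c i * (n i)%:R)); last by move=> i _; rewrite ffunE.
    by split => //; split => //; split => // i; rewrite ffunE.
  by apply/funext => M /=; rewrite (cells_prob_trunc M).2.
rewrite -monotone_convergence//; apply: eq_integral => z _.
apply/cvg_lim => //; apply: cvg_EFin; first exact: nearW.
apply: cvgMr; apply: cvgMr.
rewrite -sumrN expR_sum; apply: cvgn_prod => i.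
exact: cvg_pois.
Qed.
End Cells.

Lemma probability_setI_full d (T : measurableType d) (R : realType)
  (Pr : probability T R) (O A : set T) :
  measurable O -> measurable A -> Pr O = 1%E -> Pr (O `&` A) = Pr A.
Proof.
move=> mO mA PO.
have nO : Pr (~` O) = 0%E by rewrite probability_setC// PO subee.
rewrite -[in RHS](setIT A) -(setUv O) setIUr setIC measureU; last 3 first.
- exact: measurableI.
- by apply: measurableI => //; exact: measurableC.
- by rewrite setIACA setICr setI0.
rewrite [X in (_ + X)%E](_ : _ = 0%E) ?adde0//.
apply/eqP; rewrite eq_le measure_ge0 andbT -nO le_measure//; apply/mem_set.
- by apply: measurableI => //; exact: measurableC.
- exact: measurableC.
Qed.

(** * Dyadic step functions increasing to the gain *)

Section Dyadic.
Context {R : realType} {X : Type}.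
Variables (C : set X) (U : nat -> set X) (f : X -> R).
Hypothesis f0 : forall p, 0 <= f p.
Hypothesis Und : forall k, U k `<=` U k.+1.
Hypothesis Ucover : forall p, exists k, U k p.

Definition dy_cell k (i : nat) : set X :=
  [set p | (C p /\ U k p) /\ i%:R <= 2 ^+ k * f p < i.+1%:R].

Definition dy_val k (i : nat) : R := i%:R / 2 ^+ k.

(** Rounding down to the grid of mesh [2 ^- k]. Setting the value to 0 outside [U k] and where [f]
    reaches [k] keeps the cells finite in number and, once [U k] has finite intensity in [C], of
    finite intensity. *)
Definition dy_fun k p : R :=
  if `[< (C p /\ U k p) /\ f p < k%:R >] then dy_val k (Num.truncn (2 ^+ k * f p)) else 0.

Lemma dy_cell_inj k i j p : dy_cell k i p -> dy_cell k j p -> i = j.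
Proof.
by move=> [_ iP] [_ jP]; rewrite -(truncn_def iP) (truncn_def jP).
Qed.

(** A point lies in at most one cell. Below height [k] the index is below [k * 2 ^ k]; a point
    without a cell has value 0, where [G] vanishes. *)
Lemma dy_funE k (G : R -> R) p : G 0 = 0 ->
  G (dy_fun k p) = \sum_(i < k * 2 ^ k) G (dy_val k i) * (p \in dy_cell k i)%:R.
Proof.
move=> G0; have p2 : 0 < 2 ^+ k :> R by rewrite exprn_gt0.
have f2 : 0 <= 2 ^+ k * f p by rewrite mulr_ge0// ltW.
rewrite /dy_fun; case: ifPn => [/asboolP[CUp fk]|/asboolPn H].
  set i0 := Num.truncn _; have := truncn_itv f2; rewrite -/i0 => i0P.
  have i0k : (i0 < k * 2 ^ k)%N.
    rewrite -(ltr_nat R); have /andP[h _] := i0P; apply: (le_lt_trans h).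
    by rewrite natrM natrX mulrC ltr_pM2r.
  rewrite (bigD1 (Ordinal i0k))//= mem_set ?mulr1; last by split.
  rewrite big1 ?addr0// => i ii0; rewrite memNset ?mulr0// => H.
  by move/eqP: ii0; apply; apply: val_inj => /=; apply: dy_cell_inj H _; split.
rewrite G0 big1// => i _; rewrite memNset ?mulr0// => -[CUp /andP[_ h]].
apply: H; split => //; rewrite -(ltr_pM2l p2); apply: (lt_le_trans h).
by rewrite -natrX -natrM ler_nat [X in (_ <= X)%N]mulnC.
Qed.

Lemma dy_fun_ge0 k p : 0 <= dy_fun k p.
Proof. by rewrite /dy_fun; case: ifP => // _; rewrite divr_ge0// exprn_ge0. Qed.

Lemma dy_fun_le k p : dy_fun k p <= f p.
Proof.
rewrite /dy_fun; case: ifP => // _; rewrite ler_pdivrMr ?exprn_gt0// mulrC.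
by rewrite mulrC truncn_le mulr_ge0// exprn_ge0.
Qed.

Lemma dy_fun_nd k p : dy_fun k p <= dy_fun k.+1 p.
Proof.
rewrite {1}/dy_fun; case: ifPn => [/asboolP[[Cp Up] fk]|_]; last exact: dy_fun_ge0.
rewrite /dy_fun asboolT; last first.
  by split; [split => //; exact: Und|rewrite (lt_trans fk)// ltr_nat].
(* Halving the mesh: twice the old integer part is at most the new one. *)
rewrite /dy_val ler_pdivrMr ?exprn_gt0// exprS invfM mulrA mulrVK ?unitfE ?gt_eqF ?exprn_gt0//.
rewrite ler_pdivlMr// -natrM ler_nat truncn_ge_nat; last by rewrite !mulr_ge0// exprn_ge0.
rewrite natrM mulrC -mulrA ler_pM2l// truncn_le mulr_ge0// exprn_ge0.
Qed.

Lemma dy_fun_cvg p : C p -> dy_fun ^~ p @ \oo --> f p.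
Proof.
move=> Cp; have [k0 Uk0] := Ucover p.
have Uk k : (k0 <= k)%N -> U k p.
  by move=> /subnKC <-; elim: (k - k0)%N => [|n IH]; [rewrite addn0|rewrite addnS; exact: Und].
apply/cvgrPdist_lt => e e0; near=> k.
have kk0 : (k0 <= k)%N by near: k; exact: nbhs_infty_ge.
have fk : f p < k%:R.
  apply: (lt_le_trans (truncnS_gt (f p))); rewrite ler_nat.
  by near: k; exact: nbhs_infty_ge.
rewrite /dy_fun asboolT; last by split => //; split => //; exact: Uk.
have p2 : 0 < 2 ^+ k :> R by rewrite exprn_gt0.
have f2 : 0 <= 2 ^+ k * f p by rewrite mulr_ge0// ltW.
have /andP[h1 h2] := truncn_itv f2; set i := Num.truncn _ in h1 h2 *.
have -> : f p - dy_val k i = (2 ^+ k * f p - i%:R) / 2 ^+ k.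
  by rewrite /dy_val mulrBl [2 ^+ k * _]mulrC mulfK ?gt_eqF.
rewrite normrM normfV (ger0_norm (ltW p2)) ger0_norm ?subr_ge0//.
apply: (@lt_trans _ _ (2 ^- k)).
  rewrite -[ltRHS]mul1r ltr_pM2r ?invr_gt0//; move: h2; rewrite -natr1; lra.
near: k.
have := @cvg_expr R 2^-1; rewrite ger0_norm ?invr_ge0// => /(_ _)/cvgrPdist_lt.
have h : (2^-1 : R) < 1 by rewrite invf_lt1// ltr1n.
move=> /(_ h e e0); apply: filterS => k; rewrite sub0r normrN exprVn.
by rewrite ger0_norm ?invr_ge0 ?exprn_ge0.
Unshelve. all: by end_near. Qed.

End Dyadic.

Lemma probability_bigcap_full d (T : measurableType d) (R : realType)
  (Pr : probability T R) (O : nat -> set T) :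
  (forall n, measurable (O n) /\ Pr (O n) = 1%E) ->
  measurable (\bigcap_n O n) /\ Pr (\bigcap_n O n) = 1%E.
Proof.
move=> HO; have mO : measurable (\bigcap_n O n).
  by apply: bigcapT_measurable => n; have [] := HO n.
split => //; suff : Pr (~` \bigcap_n O n) = 0%E.
  rewrite probability_setC// => /eqP; rewrite sube_eq ?fin_num_measure//.
  by rewrite add0e => /eqP.
apply/negligibleP; first exact: measurableC.
rewrite setC_bigcap; apply: negligible_bigcup => n.
have [mOn POn] := HO n.
apply/negligibleP; first exact: measurableC.
by have := probability_setC Pr mOn; rewrite POn subee.
Qed.

(** * One serving point against an arbitrary outer gain *)

Section OnePoint.
Context {R : realType} d (T : measurableType d) (Pr : probability T R).
Variables (mu : set (mpt R) -> \bar R) (Phi : T -> set (mpt R)).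
Hypothesis HP : is_PPP Pr mu Phi.
Variables (nu : {measure set (mpt R) -> \bar R}) (W : mpt R -> R).
Hypotheses (mW : measurable_fun [set: mpt R] W) (W0 : forall p, 0 <= W p).
Hypothesis muE : forall A, measurable A -> mu A = (\int[nu]_(p in A) (W p)%:E)%E.
Local Notation npts := (npts Phi).
Local Notation leb := (@lebesgue_measure R).
Variables (B D C : set (mpt R)) (phi : mpt R -> R) (wt s : R * R -> R).
Hypotheses (mB : measurable B) (mD : measurable D) (mC : measurable C).
Hypotheses (fB : (mu B < +oo)%E) (fD : (mu D < +oo)%E).
Hypotheses (BD0 : B `&` D = set0) (BC0 : B `&` C = set0) (DC0 : D `&` C = set0).
Hypotheses (mphi : measurable_fun [set: mpt R] phi).
Hypotheses (mwt : measurable_fun [set: R * R] wt) (wt0 : forall x, 0 <= wt x).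
Hypotheses (ms : measurable_fun [set: R * R] s) (s0 : forall x, 0 <= s x).
Hypothesis HD : forall x, 0 <= x -> mu (D `&` [set p | x <= phi p]) =
  (\int[(leb \x leb)%E]_z (wt z * expR (- (s z * x)))%:E)%E.
Variables (U : nat -> set (mpt R)) (f : mpt R -> R).
Hypotheses (mU : forall k, measurable (U k)) (fU : forall k, (mu (C `&` U k) < +oo)%E).
Hypotheses (Und : forall k, U k `<=` U k.+1) (Ucover : forall p, exists k, U k p).
Hypotheses (mf : measurable_fun [set: mpt R] f) (f0 : forall p, 0 <= f p).

(** Minus the logarithm of the Laplace functional, at [s z * f], of a Poisson process on [C] whose
    intensity has density [W]. *)
Definition laplace z : \bar R :=
  (\int[nu]_(p in C) ((1 - expR (- (s z * f p))) * W p)%:E)%E.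

Hypothesis laplace_fin : forall z, (laplace z < +oo)%E.

Let cell (k i : nat) := dy_cell C U f k i.
Let fk k := dy_fun C U f k.

Let mcell k i : measurable (cell k i).
Proof.
rewrite (_ : cell k i = C `&` U k `&` [set p | (i%:R <= 2 ^+ k * f p) && (2 ^+ k * f p < i.+1%:R)]).
  apply: measurableI; first exact: measurableI.
  by apply: measurable_pred; mfun.
by apply/seteqP; split => p /=; rewrite /cell /dy_cell/=.
Qed.

Let fcell k i : (mu (cell k i) < +oo)%E.
Proof.
apply: (le_lt_trans _ (fU k)); apply: (le_mu mW W0 muE) => //; first exact: measurableI.
by move=> p [[Cp Up] _].
Qed.

Let cellC k i : cell k i `<=` C.
Proof. by move=> p [[Cp Up] _]. Qed.

Let dcell k (i j : 'I_(k * 2 ^ k)%N) : i != j -> cell k i `&` cell k j = set0.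
Proof.
move=> ij; apply/seteqP; split => p // [pi pj]; move/eqP: ij; apply.
by apply: val_inj; exact: (dy_cell_inj pi pj).
Qed.

Let Bcell k i : B `&` cell k i = set0.
Proof.
apply/seteqP; split => p // [Bp /cellC Cp].
by have : (B `&` C) p by []; rewrite BC0.
Qed.

Let Dcell k i : D `&` cell k i = set0.
Proof.
apply/seteqP; split => p // [Dp /cellC Cp].
by have : (D `&` C) p by []; rewrite DC0.
Qed.

Let val0 k (i : nat) : 0 <= dy_val k i :> R.
Proof. by rewrite divr_ge0// exprn_ge0. Qed.

Let K := expR (- (fine (mu B) + fine (mu D))).

Let Gk k := [set w | npts w B = 0%:E /\
    exists2 p, Phi w `&` D = [set p] &
      (forall i : 'I_(k * 2 ^ k)%N, finite_set (Phi w `&` cell k i)) /\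
      \sum_(i < k * 2 ^ k) dy_val k i * (card_of (Phi w `&` cell k i))%:R <= phi p].

Let Gk_prob k := cells_prob HP mW W0 muE mB mD fB fD BD0 mphi mwt wt0 ms HD
  (fun i : 'I_(k * 2 ^ k)%N => mcell k i) (fun i => fcell k i) (@dcell k)
  (fun i => Bcell k i) (fun i => Dcell k i) (fun i => val0 k i).

Let mGfk k (G : R -> R) : G 0 = 0 -> measurable_fun [set: mpt R] (fun p => G (fk k p)).
Proof.
move=> G0; rewrite (_ : (fun p => _) =
  (fun p => \sum_(i < k * 2 ^ k) G (dy_val k i) * \1_(cell k i) p)).
  apply: measurable_sum => i; apply: mfun_mul; first exact: measurable_cst.
  exact: measurable_indic.
by apply/funext => p; rewrite (dy_funE _ _ _ _ _ G0).
Qed.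

Let mWE A : measurable_fun A (fun p => (W p)%:E).
Proof. by apply/measurable_EFinP; exact: measurable_funTS. Qed.

Let exp01 z x : 0 <= x -> 0 <= 1 - expR (- (s z * x)) <= 1.
Proof.
move=> x0; rewrite subr_ge0 gerBl expR_ge0 andbT.
by rewrite -expR0 ler_expR oppr_le0 mulr_ge0.
Qed.

(** For a step function the exponent given by [cells_prob] is an integral of the same form as
    [laplace], which makes the passage to the limit one of integrals. *)
Let lap_k k z : \sum_(i < k * 2 ^ k) fine (mu (cell k i)) * (1 - expR (- (s z * dy_val k i))) =
   fine (\int[nu]_(p in C) ((1 - expR (- (s z * fk k p))) * W p)%:E)%E.
Proof.
pose G (x : R) := 1 - expR (- (s z * x)).
have G0 : G 0 = 0 by rewrite /G mulr0 oppr0 expR0 subrr.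
have Gv (i : nat) : 0 <= G (dy_val k i) by have /andP[] := exp01 z (val0 k i).
have mI i : measurable_fun [set: mpt R] (fun p => (\1_(cell k i) p * W p)%:E).
  by apply/measurable_EFinP; apply: mfun_mul => //; exact: measurable_indic.
have I0 i p : (0 <= (\1_(cell k i) p * W p)%:E)%E by rewrite lee_fin mulr_ge0.
transitivity (fine (\int[nu]_(p in C)
    (\sum_(i < k * 2 ^ k) (G (dy_val k i))%:E * (\1_(cell k i) p * W p)%:E)))%E; last first.
  congr fine; apply: eq_integral => p _; rewrite -/(G (fk k p)) /fk (dy_funE _ _ _ _ _ G0)//.
  rewrite mulr_suml -sumEFin; apply: eq_bigr => i _.
  by rewrite -EFinM mulrA indicE.
rewrite ge0_integral_sum//; last 2 first.
- by move=> i; apply: measurable_funeM; exact: measurable_funTS.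
- by move=> i p _; rewrite mule_ge0// lee_fin.
under [in RHS]eq_bigr => i _.
  rewrite ge0_integralZl_EFin//; last exact: measurable_funTS.
  rewrite (_ : integral _ _ _ = mu (cell k i)); last first.
    rewrite muE// [LHS]integral_mkcond [RHS]integral_mkcond; apply: eq_integral => p _.
    rewrite !patchE indicE; case: (boolP (p \in cell k i)) => pc.
      by rewrite ifT ?mul1r//; apply/mem_set; exact: (cellC (set_mem pc)).
    by rewrite mul0r; case: ifP.
  rewrite -(@fineK _ (mu (cell k i))); last first.
    by rewrite ge0_fin_numE ?fcell// (mu_ge0 W0 muE).
  rewrite -EFinM; over.
by rewrite sumEFin/=; apply: eq_bigr => i _; rewrite mulrC.
Qed.

(** On this almost sure event all cells are finite, so the interference of each step function is a
    finite sum of counts. *)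
Let full := \bigcap_k \bigcap_i [set w | finite_set (Phi w `&` cell k i)].

Let mfull : measurable full /\ Pr full = 1%E.
Proof.
apply: probability_bigcap_full => k; apply: probability_bigcap_full => i.
exact: (PPP_finite HP).
Qed.

Let esum_cells w k : full w ->
  \esum_(q in Phi w `&` C) (fk k q)%:E =
  (\sum_(i < k * 2 ^ k) dy_val k i * (card_of (Phi w `&` cell k i))%:R)%:E.
Proof.
move=> fw.
transitivity (\esum_(q in Phi w `&` C) \sum_(i < k * 2 ^ k)
    ((if q \in cell k i then (dy_val k i)%:E else 0)%E : \bar R)).
  apply: eq_esum => q _; rewrite /fk (dy_funE _ _ _ _ _ (erefl : id 0 = 0))// -sumEFin.
  by apply: eq_bigr => i _; case: ifP => _; rewrite ?mulr1 ?mulr0.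
rewrite esum_sum; last by move=> q i _ _; case: ifP => // _; rewrite lee_fin.
rewrite -sumEFin; apply: eq_bigr => i _.
rewrite -esum_mkcondr -setIA (setIidr (@cellC k i)).
have fin : finite_set (Phi w `&` cell k i) by exact: fw.
rewrite esum_fset//; last by move=> q _; rewrite lee_fin.
rewrite fsbig_finite// sumEFin big_const_seq count_predT iter_addr_0; congr EFin.
by rewrite mulr_natr.
Qed.

Definition one_point_event := [set w | npts w B = 0%:E /\
  exists2 p, Phi w `&` D = [set p] & (\esum_(q in Phi w `&` C) (f q)%:E <= (phi p)%:E)%E].

Let GkP w k : full w -> Gk k w <-> npts w B = 0%:E /\
  exists2 p, Phi w `&` D = [set p] & (\esum_(q in Phi w `&` C) (fk k q)%:E <= (phi p)%:E)%E.
Proof.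
move=> fw; rewrite (esum_cells k fw); split.
  by move=> [HB [p Dp [_ H]]]; split => //; exists p.
move=> [HB [p Dp H]]; split => //; exists p => //; split => // i; exact: fw.
Qed.

(** The sum over a finite set of points is the limit of the sums of the step functions, each bounded
    by [phi p]; the supremum over finite sets then obeys the same bound. *)
Let event_lim w : full w -> (forall k, Gk k w) <-> one_point_event w.
Proof.
move=> fw; split => [H|[HB [p Dp H]] k].
  have [HB [p Dp _]] := (GkP 0 fw).1 (H 0%N); split => //; exists p => //.
  have Hp k : (\esum_(q in Phi w `&` C) (fk k q)%:E <= (phi p)%:E)%E.
    (* The point may a priori depend on [k], but it is the only one in [D]. *)
    have [_ [p' Dp' H']] := (GkP k fw).1 (H k).
    suff -> : p = p' by [].
    by have : [set p'] p by rewrite -Dp' Dp.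
  apply: ge_ereal_sup => _ [F [finF FS] <-].
  rewrite fsbig_finite// sumEFin lee_fin.
  have cv : (fun k => \sum_(q <- fset_set F) fk k q) @ \oo --> \sum_(q <- fset_set F) f q.
    have : forall q, q \in (fset_set F : seq (mpt R)) -> C q.
      by move=> q; rewrite in_fset_set// => /set_mem/FS[].
    move: (fset_set F : seq (mpt R)); elim=> [|q r IH] FC.
      by under eq_fun do rewrite big_nil; rewrite big_nil; exact: cvg_cst.
    under eq_fun do rewrite big_cons.
    rewrite big_cons; apply: cvgD.
      by apply: dy_fun_cvg => //; apply: FC; rewrite inE eqxx.
    by apply: IH => q' q'r; apply: FC; rewrite inE q'r orbT.
  rewrite -(cvg_lim (@Rhausdorff R) cv); apply: limr_le; first by apply/cvg_ex; eexists; exact: cv.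
  apply: nearW => k; rewrite -lee_fin; apply: le_trans (Hp k).
  apply: ereal_sup_ubound; exists F; first by split.
  by rewrite fsbig_finite// sumEFin.
apply/(GkP k fw); split => //; exists p => //.
by apply: le_trans H; apply: le_esum => q _; rewrite lee_fin; exact: dy_fun_le.
Qed.

(** Continuity from above for the decreasing events [Gk], dominated convergence for their
    probabilities. The almost sure [O] is part of the conclusion since [one_point_event] is shown
    measurable only inside it. *)
Lemma one_point_prob : exists2 O, measurable O /\ Pr O = 1%E &
  measurable (O `&` one_point_event) /\
  Pr (O `&` one_point_event) = (\int[(leb \x leb)%E]_z
    (K * (wt z * expR (- fine (laplace z))))%:E)%E.
Proof.
have [mfl Pfl] := mfull; exists full => //.
have mGk k : measurable (full `&` Gk k).
  by apply: measurableI => //; exact: (Gk_prob k).1.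
have GE : \bigcap_k (full `&` Gk k) = full `&` one_point_event.
  apply/seteqP; split => w.
    move=> H; have [fw _] := H 0%N I; split => //; apply/(event_lim fw) => k.
    by have [] := H k I.
  by move=> [fw /(event_lim fw) H] k _; split.
have mG : measurable (\bigcap_k (full `&` Gk k)) by exact: bigcap_measurable.
split; first by rewrite -GE.
rewrite -GE; have K0 : 0 <= K by exact: expR_ge0.
pose lk k z := fine (\int[nu]_(p in C) ((1 - expR (- (s z * fk k p))) * W p)%:E)%E.
pose g k (z : R * R) : \bar R := (K * (wt z * expR (- lk k z)))%:E.
have Pg k : Pr (full `&` Gk k) = (\int[(leb \x leb)%E]_z g k z)%E.
  rewrite (probability_setI_full mfl (Gk_prob k).1 Pfl) (Gk_prob k).2.
  by apply: eq_integral => z _; rewrite /g /lk -lap_k.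
have lk0 k z : 0 <= lk k z.
  rewrite fine_ge0// integral_ge0// => p _; rewrite lee_fin mulr_ge0//.
  by have /andP[] := exp01 z (dy_fun_ge0 C U f k p).
have cvPr : (fun k => Pr (full `&` Gk k)) @ \oo --> Pr (\bigcap_k (full `&` Gk k)).
  apply: nonincreasing_cvg_mu => //.
    by rewrite (le_lt_trans (probability_le1 _ _))// ltry.
  apply/nonincreasing_seqP => k; apply/subsetPset => w [fw Gw]; split => //.
  have [HB [p Dp H]] := (GkP k.+1 fw).1 Gw; apply/(GkP k fw); split => //; exists p => //.
  by apply: le_trans H; apply: le_esum => q _; rewrite lee_fin; exact: dy_fun_nd.
rewrite -(cvg_lim (@ereal_hausdorff R) cvPr); apply/cvg_lim => //.
under eq_fun do rewrite Pg.
apply: (@dominated_cvg _ _ _ (leb \x leb)%E setT measurableT g _ (fun z => (K * wt z)%:E)) => //.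
- move=> k; apply/measurable_EFinP; apply: mfun_mul; first by mfun.
  apply: mfun_mul => //; apply: mfun_expR; apply: mfun_opp.
  rewrite (_ : lk k = (fun z => \sum_(i < k * 2 ^ k) fine (mu (cell k i)) * (1 - expR (- (s z * dy_val k i))))).
    by apply: measurable_sum => i; mfun.
  by apply/funext => z; rewrite lap_k.
- move=> z _; apply: cvg_EFin; first exact: nearW.
  apply: cvgMr; apply: cvgMr; apply: continuous_cvg; first exact: continuous_expR.
  apply: cvgN; apply: fine_cvg; rewrite fineK; last first.
    rewrite ge0_fin_numE ?laplace_fin// integral_ge0// => p _; rewrite lee_fin mulr_ge0//.
    by have /andP[] := exp01 z (f0 p).
  rewrite (_ : laplace z = \int[nu]_(p in C) limn (fun k => ((1 - expR (- (s z * fk k p))) * W p)%:E))%E.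
    apply: cvg_monotone_convergence => //.
    + move=> k; apply: measurable_funTS; apply/measurable_EFinP; apply: mfun_mul => //.
      by apply: (@mGfk k (fun x => 1 - expR (- (s z * x)))); rewrite mulr0 oppr0 expR0 subrr.
    + move=> k p _; rewrite lee_fin mulr_ge0//.
      by have /andP[] := exp01 z (dy_fun_ge0 C U f k p).
    + move=> p Cp; apply/nondecreasing_seqP => k; rewrite lee_fin ler_wpM2r//.
      by rewrite lerD2l lerN2 ler_expR lerN2 ler_wpM2l//; exact: dy_fun_nd.
  apply: eq_integral => p /set_mem Cp; apply/esym/cvg_lim => //.
  apply: cvg_EFin; first exact: nearW.
  apply: cvgMl; apply: cvgB; first exact: cvg_cst.
  apply: continuous_cvg; first exact: continuous_expR.
  by apply: cvgN; apply: cvgMr; exact: dy_fun_cvg.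
- apply/integrableP; split; first by mfun.
  under eq_integral => z _ do rewrite abse_EFin ger0_norm ?mulr_ge0// EFinM.
  rewrite ge0_integralZl_EFin//; [|by move=> z _; rewrite lee_fin|by mfun].
  rewrite lte_mul_pinfty//.
  (* [HD] at level 0 identifies the integral of the dominating [wt] with the intensity of a part of
     [D], which is finite. *)
  have := HD (lexx 0); rewrite (_ : integral _ _ _ = \int[(leb \x leb)%E]_z (wt z)%:E)%E; last first.
    by apply: eq_integral => z _; rewrite mulr0 oppr0 expR0 mulr1.
  move=> <-; apply: le_lt_trans fD; apply: (le_mu mW W0 muE) => //.
  by apply: measurableI => //; apply: measurable_pred; mfun.
- move=> k z _; rewrite abse_EFin ger0_norm ?mulr_ge0 ?expR_ge0// lee_fin.
  by rewrite ler_wpM2l// ler_piMr// -expR0 ler_expR oppr_le0.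
Qed.

End OnePoint.

(** * The intensity measure *)

Section Intensity.
Context {R : realType}.
Local Notation leb := (@lebesgue_measure R).
Local Notation leb2 := (leb \x leb)%E.
Local Notation leb3 := (leb2 \x leb)%E.

Let leb2_sigma_finite : sigma_finite setT leb2.
Proof. by case: (lebesgue_integral_fubini.measure_function_Measure_isSigmaFinite__to__measure_function_isSigmaFinite leb leb). Qed.

(* Bare constant: the sigma-finite structure inferred for a product is the one of
   subprobabilities, which Lebesgue measure does not have. *)
Definition lebesgue2 : set (measurableTypeR R * measurableTypeR R) -> \bar R := leb2.
HB.instance Definition _ := Measure.copy lebesgue2 leb2.
HB.instance Definition _ := Measure_isSigmaFinite.Build _ _ _ lebesgue2 leb2_sigma_finite.

Let leb3_sigma_finite : sigma_finite setT leb3.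
Proof. by case: (lebesgue_integral_fubini.measure_function_Measure_isSigmaFinite__to__measure_function_isSigmaFinite lebesgue2 leb). Qed.

Definition lebesgue3 : set (measurableTypeR R * measurableTypeR R * measurableTypeR R) -> \bar R := leb3.
HB.instance Definition _ := Measure.copy lebesgue3 leb3.
HB.instance Definition _ := Measure_isSigmaFinite.Build _ _ _ lebesgue3 leb3_sigma_finite.

Let X4 := (measurableTypeR R * measurableTypeR R * measurableTypeR R *
  measurableTypeR R)%type.

Let measurable_id_mpt : measurable_fun [set: X4] (fun p : X4 => p : mpt R).
Proof. by move=> _ Y mY; rewrite setTI. Qed.

(* Lebesgue measure on [R ^ 4], transported to the canonical sigma-algebra of [mpt R]. *)
Definition lebm : {measure set (mpt R) -> \bar R} :=
  measure_function_pushforward__canonical__measure_function_Measure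
    (leb3 \x leb)%E measurable_id_mpt.

Lemma ge0_integral_lebm (F : mpt R -> \bar R) :
  measurable_fun [set: mpt R] F -> (forall p, 0 <= F p)%E ->
  (\int[lebm]_p F p = \int[(leb3 \x leb)%E]_p F p)%E.
Proof.
move=> mF F0; exact: (@ge0_integral_pushforward _ _ X4 (mpt R) _ _
  measurable_id_mpt (leb3 \x leb)%E setT F).
Qed.

(** The restricted domains of the iterated integral become indicator factors, so that the intensity
    has a density against [lebm] on the whole space. *)
Definition mark_density (lam0 : R) (p : mpt R) : R :=
  lam0 * ((2 * pi)^-1 * expR (- pfad p) *
    ((0 <= pdir p) && (pdir p < 2 * pi))%R%:R * (0 <= pfad p)%R%:R).

Lemma mark_density_ge0 lam0 p : 0 <= lam0 -> 0 <= mark_density lam0 p.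
Proof.
move=> l0; have := @pi_gt0 R => pi0.
by rewrite /mark_density !mulr_ge0// ?invr_ge0 ?expR_ge0// mulr_ge0// ltW.
Qed.

Lemma measurable_mark_density lam0 :
  measurable_fun [set: mpt R] (mark_density lam0).
Proof. by rewrite /mark_density /pfad /pdir; mfun. Qed.

Lemma integral_indicator d (T : measurableType d) (mu : {measure set T -> \bar R})
  (D : set T) (b : T -> bool) (f : T -> R) :
  (forall x, D x <-> b x) ->
  (\int[mu]_x (f x * (b x)%:R)%:E = \int[mu]_(x in D) (f x)%:E)%E.
Proof.
move=> Db; rewrite [RHS]integral_mkcond; apply: eq_integral => x _; rewrite patchE.
case: ifPn => [/set_mem/Db ->|]; first by rewrite mulr1.
by rewrite notin_setE => H; rewrite (_ : b x = false) ?mulr0//; apply/negP => /Db.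
Qed.

Lemma integral_lebm (lam0 : R) (F : mpt R -> R) : 0 <= lam0 ->
  measurable_fun [set: mpt R] F -> (forall p, 0 <= F p) ->
  (\int[lebm]_p (F p * mark_density lam0 p)%:E =
   lam0%:E * \int[leb2]_z \int[leb]_(th in `[0%R, (2 * pi)%R[%classic)
     \int[leb]_(g in `[0%R, +oo[%classic)
       (F (z, th, g) * (2 * pi)^-1 * expR (- g))%:E)%E.
Proof.
move=> l0 mF F0; have pi0 := @pi_gt0 R.
have c0 : 0 <= (2 * pi)^-1 :> R by rewrite invr_ge0 mulr_ge0// ltW.
pose H (p : mpt R) : R := F p * (2 * pi)^-1 * expR (- pfad p) *
    (0 <= pfad p)%R%:R * ((0 <= pdir p) && (pdir p < 2 * pi))%R%:R.
have H0 p : 0 <= H p by rewrite /H !mulr_ge0// expR_ge0.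
have mH : measurable_fun [set: mpt R] (fun p => (H p)%:E).
  by rewrite /H /pfad /pdir; mfun.
transitivity (lam0%:E * \int[lebm]_p (H p)%:E)%E.
  rewrite -ge0_integralZl_EFin//; last by move=> p _; rewrite lee_fin.
  by apply: eq_integral => p _; rewrite -EFinM; congr EFin; rewrite /H /mark_density; ring.
congr (_ * _)%E.
rewrite ge0_integral_lebm// (fubini_tonelli1 (m1:=lebesgue3) (m2:=leb))//.
rewrite (fubini_tonelli1 (m1:=lebesgue2) (m2:=leb)); last 2 first.
- exact: (measurable_fun_fubini_tonelli_F (m2:=leb) (fun p => (H p)%:E) mH (fun p => H0 p)).
- by move=> p; apply: integral_ge0 => g _; rewrite lee_fin.
apply: eq_integral => z _; rewrite /fubini_F/= [RHS]integral_mkcond.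
apply: eq_integral => th _; rewrite patchE; case: ifPn => [/set_mem|].
  rewrite /= in_itv/= => thI.
  rewrite -[RHS](integral_indicator leb (b := fun g => 0 <= g)); last by move=> g; rewrite /= in_itv/= andbT.
  by apply: eq_integral => g _; rewrite /H /pdir /pfad /= thI mulr1.
rewrite notin_setE/= in_itv/= => /negP/negbTE thI.
by rewrite integral0_eq// => g _; rewrite /H /pdir /= thI mulr0.
Qed.

(** Turns the iterated integral into one genuine measure, from which additivity and monotonicity
    follow. Merging the integrals over the two coordinates by Tonelli requires the measurability of
    the mark integral [J]. *)
Lemma intensityE (lam0 : R) (A : set (mpt R)) : 0 <= lam0 -> measurable A ->
  intensity lam0 A = (\int[lebm]_(p in A) (mark_density lam0 p)%:E)%E.
Proof.
move=> l0 mA; have pi0 := @pi_gt0 R.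
have c0 : 0 <= (2 * pi)^-1 :> R by rewrite invr_ge0 mulr_ge0// ltW.
transitivity (\int[lebm]_p (\1_A p * mark_density lam0 p)%:E)%E; last first.
  rewrite [RHS]integral_mkcond; apply: eq_integral => p _; rewrite patchE indicE.
  by case: ifP => _; rewrite ?mul1r ?mul0r.
rewrite integral_lebm//; congr (_ * _)%E.
pose J (z : R * R) : \bar R := (\int[leb]_(th in `[0%R, (2 * pi)%R[%classic)
     \int[leb]_(g in `[0%R, +oo[%classic)
       ((\1_A (z, th, g) : R) * (2 * pi)^-1 * expR (- g))%:E)%E.
have mJ : measurable_fun [set: R * R] J.
  pose H (p : mpt R) : R := \1_A p * (2 * pi)^-1 * expR (- pfad p) *
    (0 <= pfad p)%R%:R * ((0 <= pdir p) && (pdir p < 2 * pi))%R%:R.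
  have H0 p : 0 <= H p by rewrite /H !mulr_ge0// expR_ge0.
  have mH : measurable_fun [set: mpt R] (fun p => (H p)%:E).
    have m1 : measurable_fun [set: mpt R] (\1_A : mpt R -> R) by exact: measurable_indic.
    by rewrite /H /pfad /pdir; mfun.
  have mH1 := measurable_fun_fubini_tonelli_F (m2:=leb) (fun p => (H p)%:E) mH (fun p => H0 p).
  have mH2 := measurable_fun_fubini_tonelli_F (m2:=leb) _ mH1.
  rewrite (_ : J = fubini_F leb (fubini_F leb (fun p : mpt R => (H p)%:E))).
    by apply: mH2 => p; apply: integral_ge0 => g _; rewrite lee_fin.
  apply/funext => z; rewrite /J /fubini_F/= [LHS]integral_mkcond.
  apply: eq_integral => th _; rewrite patchE; case: ifPn => [/set_mem|].
    rewrite /= in_itv/= => thI.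
    rewrite -[LHS](integral_indicator leb (b := fun g => 0 <= g)); last by move=> g; rewrite /= in_itv/= andbT.
    by apply: eq_integral => g _; rewrite /H /pdir /pfad /= thI mulr1.
  rewrite notin_setE/= in_itv/= => /negP/negbTE thI.
  by rewrite integral0_eq// => g _; rewrite /H /pdir /= thI mulr0.
have J0 z : (0 <= J z)%E.
  apply: integral_ge0 => th _; apply: integral_ge0 => g _.
  by rewrite lee_fin !mulr_ge0// expR_ge0.
by rewrite (fubini_tonelli1 (m1:=leb) (m2:=leb) J mJ J0).
Qed.

Lemma integral_expR_ge (k a : R) : 0 < k ->
  (\int[leb]_(g in `[a, +oo[) (expR (- (k * g)))%:E = (expR (- (k * a)) / k)%:E)%E.
Proof.
move=> k0; have kn0 : k != 0 by rewrite gt_eqF.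
pose F (g : R) : R := - (expR (- (k * g)) / k).
have dF (x : R) : is_derive x 1 F (expR (- (k * x))).
  apply: is_derive_eq; rewrite /GRing.scale/=; field.
  exact: kn0.
have cf : continuous (fun g : R => expR (- (k * g))).
  move=> x; apply: continuous_comp; last exact: continuous_expR.
  by apply: continuousN; apply: cvgMr; exact: cvg_id.
have cF x : {for x, continuous F}.
  by apply: differentiable_continuous; apply/derivable1_diffP; have := dF x => -[].
rewrite (@ge0_continuous_FTC2y _ (fun g => expR (- (k * g))) F a 0).
- by rewrite /F -EFinD sub0r opprK.
- by move=> x _; exact: expR_ge0.
- exact: continuous_subspaceT.
- rewrite (_ : 0 = - (0 / k)); last by rewrite mul0r oppr0.
  apply: cvgN; apply: cvgMl.
  apply: (@cvg_comp _ _ _ (fun g => k * g) (fun y => expR (- y)) _ (pinfty_nbhs R)); last exact: cvgr_expR.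
  exact: gt0_cvgMry.
- by move=> x _; have := dF x => -[].
- exact/cvg_at_right_filter/cF.
- by move=> x _; rewrite derive1E; have := dF x => -[].
Qed.

Lemma integral_exp_tail (y : R) : 0 <= y ->
  (\int[leb]_(g in `[0%R, +oo[) ((y <= g)%R%:R * expR (- g))%:E = (expR (- y))%:E)%E.
Proof.
move=> y0; have := @integral_expR_ge 1 y ltr01; rewrite mul1r divr1 => <-.
rewrite [LHS]integral_mkcond [RHS]integral_mkcond; apply: eq_integral => g _.
rewrite !patchE !mem_setE !in_itv/= !andbT mul1r.
have [yg|yg] := leP y g; first by rewrite (le_trans y0 yg) mul1r.
by rewrite mul0r; case: ifP.
Qed.

Lemma integral_exp_laplace (b : R) : 0 <= b ->
  (\int[leb]_(g in `[0%R, +oo[) ((1 - expR (- (b * g))) * expR (- g))%:E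
   = (b / (1 + b))%:E)%E.
Proof.
move=> b0; have b1 : 0 < 1 + b by rewrite ltr_pwDl.
have I1 := @integral_expR_ge 1 0 ltr01; have I2 := @integral_expR_ge (1 + b) 0 b1.
rewrite mulr0 oppr0 expR0 divr1 in I1; rewrite mulr0 oppr0 expR0 div1r in I2.
(* Written as a sum of nonnegative functions, so that the value follows from two known integrals by
   subtracting a finite number. *)
have : (\int[leb]_(g in `[0%R, +oo[) (expR (- (1 * g)))%:E =
  \int[leb]_(g in `[0%R, +oo[) (((1 - expR (- (b * g))) * expR (- g))%:E + (expR (- ((1 + b) * g)))%:E))%E.
  apply: eq_integral => g _; rewrite -EFinD; congr EFin.
  by rewrite mulrBl -expRD !mul1r mulrDl mul1r opprD [- (b * g) - g]addrC subrK.
rewrite I1 ge0_integralD//.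
- rewrite I2 => /(congr1 (fun z => z - ((1 + b)^-1)%:E)%E); rewrite addeK// => <-.
  by rewrite -EFinB; congr EFin; field; exact: lt0r_neq0.
- move=> g; rewrite /= in_itv/= andbT => g0; rewrite lee_fin mulr_ge0 ?expR_ge0//.
  by rewrite subr_ge0 -expR0 ler_expR oppr_le0 mulr_ge0.
- by apply: measurable_funTS; mfun.
- by apply: measurable_funTS; mfun.
Qed.

End Intensity.

(** * Displacement of the interferers *)

Section LebesguePlane.
Context {R : realType}.
Local Notation leb := (@lebesgue_measure R).
Local Notation leb2 := (leb \x leb)%E.

Lemma integral_indicator_set d (T : measurableType d) (mu : {measure set T -> \bar R})
  (D : set T) (b : T -> bool) (f : T -> R) : (forall x, D x <-> b x) ->
  (\int[mu]_(x in D) (f x)%:E = \int[mu]_x ((b x)%:R * f x)%:E)%E.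
Proof.
move=> Db; rewrite -(integral_indicator mu f Db).
by apply: eq_integral => x _; rewrite mulrC.
Qed.

Lemma ge0_integral_shift2 (a b : R) (f : R * R -> \bar R) :
  measurable_fun [set: R * R] f -> (forall p, 0 <= f p)%E ->
  (\int[leb2]_p f ((p.1 + a)%R, (p.2 + b)%R) = \int[leb2]_p f p)%E.
Proof.
move=> mf f0.
have ms (T1 : measurableType _) (g : T1 -> R) c : measurable_fun [set: T1] g ->
  measurable_fun [set: T1] (fun x => g x + c) by move=> mg; mfun.
have mfs : measurable_fun [set: R * R] (fun p : R * R => f ((p.1 + a)%R, (p.2 + b)%R)).
  by apply: (measurableT_comp mf); mfun.
have fs0 (p : R * R) : (0 <= f ((p.1 + a)%R, (p.2 + b)%R))%E by exact: f0.
rewrite (fubini_tonelli1 (m1:=leb) (m2:=leb) _ mfs fs0) (fubini_tonelli1 (m1:=leb) (m2:=leb) _ mf f0).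
transitivity (\int[leb]_x fubini_F leb f (x + a)%R)%E.
  apply: eq_integral => x _; rewrite /fubini_F/=.
  apply: (@ge0_integral_shift _ b (fun y => f (x + a, y))) => //.
  by apply: (measurableT_comp mf); mfun.
apply: (@ge0_integral_shift _ a (fubini_F leb f)).
  exact: (measurable_fun_fubini_tonelli_F (m2:=leb) f mf).
by move=> x; exact: integral_ge0.
Qed.

Lemma twopi_neq0 : 2 * pi != 0 :> R.
Proof. by rewrite mulf_neq0 ?pnatr_eq0// gt_eqF// pi_gt0. Qed.

Lemma integral_angle_cst (c : R) :
  (\int[leb]_(th in `[0%R, (2 * pi)%R[%classic) c%:E = (c * (2 * pi))%:E)%E.
Proof.
have pi0 := @pi_gt0 R.
rewrite integral_cst//= lebesgue_measure_itv/= lte_fin mulr_gt0//.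
by rewrite oppr0 adde0 -EFinM.
Qed.

Lemma integral_lebm_fading (lam0 : R) (F : mpt R -> R) (G : R * R -> R -> R) : 0 <= lam0 ->
  measurable_fun [set: mpt R] F -> (forall p, 0 <= F p) ->
  (forall z th, \int[leb]_(g in `[0%R, +oo[%classic) (F (z, th, g) * expR (- g))%:E = (G z th)%:E)%E ->
  (\int[lebm]_p (F p * mark_density lam0 p)%:E = lam0%:E * \int[leb2]_z
    \int[leb]_(th in `[0%R, (2 * pi)%R[%classic) ((2 * pi)^-1 * G z th)%:E)%E.
Proof.
move=> l0 mF F0 FG; have pi0 := @pi_gt0 R.
have c0 : 0 <= (2 * pi)^-1 :> R by rewrite invr_ge0 mulr_ge0// ltW.
rewrite (integral_lebm l0 mF F0); congr (_ * _)%E; apply: eq_integral => z _.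
apply: eq_integral => th _; rewrite EFinM -FG -ge0_integralZl_EFin//.
- by apply: eq_integral => g _; rewrite -EFinM; congr EFin; ring.
- by move=> g _; rewrite lee_fin mulr_ge0// expR_ge0.
- have mz : measurable_fun [set: R] (fun g : R => F (z, th, g)).
    by apply: (measurableT_comp mF); mfun.
  by apply: measurable_funTS; mfun.
Qed.

(** For sets that do not look at the direction of a point: the uniform average over [th] is then
    trivial. *)
Lemma integral_lebm_isotropic (lam0 : R) (F : mpt R -> R) (G : R * R -> R) : 0 <= lam0 ->
  measurable_fun [set: mpt R] F -> (forall p, 0 <= F p) ->
  (forall z th, \int[leb]_(g in `[0%R, +oo[%classic) (F (z, th, g) * expR (- g))%:E = (G z)%:E)%E ->
  measurable_fun [set: R * R] G ->
  (\int[lebm]_p (F p * mark_density lam0 p)%:E = \int[leb2]_z (lam0 * G z)%:E)%E.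
Proof.
move=> l0 mF F0 FG mG; have pi0 := @pi_gt0 R.
rewrite (integral_lebm_fading (G := fun z _ => G z))//.
have G0 z : 0 <= G z.
  by rewrite -lee_fin -(FG z 0); apply: integral_ge0 => g _; rewrite lee_fin mulr_ge0// expR_ge0.
transitivity (lam0%:E * \int[leb2]_z (G z)%:E)%E.
  congr (_ * _)%E; apply: eq_integral => z _; rewrite integral_angle_cst; congr EFin.
  by rewrite mulrC mulVKf// twopi_neq0.
by rewrite -ge0_integralZl_EFin//; [move=> z _; rewrite lee_fin|exact/measurable_EFinP].
Qed.

Lemma arc_frac_ge0 (k : R) : 0 <= arc_frac k.
Proof.
rewrite /arc_frac; case: ifPn => //; rewrite -leNgt => k1; case: ifPn => //; rewrite -ltNge => k2.
have pi0 := @pi_gt0 R.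
by rewrite subr_ge0 ler_pdivrMr// mul1r acos_lepi// k1 ltW.
Qed.

Lemma arc_frac_le1 (k : R) : arc_frac k <= 1.
Proof.
rewrite /arc_frac; case: ifPn => //; rewrite -leNgt => k1; case: ifPn => //; rewrite -ltNge => k2.
have pi0 := @pi_gt0 R.
by rewrite gerBl divr_ge0 ?(ltW pi0)// acos_ge0// k1 ltW.
Qed.

(** By [measure_cos_le] it is, up to [2 * pi], the length of the sections of a measurable planar
    set, so Tonelli gives measurability without any study of [acos]. *)
Lemma measurable_arc_frac : measurable_fun [set: R] (@arc_frac R).
Proof.
have pi0 := @pi_gt0 R.
pose f (p : R * R) : \bar R :=
  ((cos p.2 <= p.1)%R%:R * ((0 <= p.2) && (p.2 < 2 * pi))%R%:R)%:E.
have mf : measurable_fun [set: R * R] f by rewrite /f; mfun.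
have f0 p : (0 <= f p)%E by rewrite lee_fin mulr_ge0.
have mF := measurable_fun_fubini_tonelli_F (m2:=leb) f mf f0.
rewrite (_ : @arc_frac R = fun k => fine (fubini_F leb f k) * (2 * pi)^-1).
  by mfun; exact: mF.
apply/funext => k; rewrite /fubini_F/=.
rewrite (integral_indicator leb (D := `[0%R, (2 * pi)%R[%classic)); last first.
  by move=> x; rewrite /= in_itv.
have mc : measurable_fun [set: R] (fun x : R => cos x <= k) by mfun.
have := integral_bool leb (measurable_itv `[0%R, (2 * pi)%R[) mc.
move=> /esym/(etrans (esym (measure_cos_le k))) => /= <- /=.
by rewrite mulrC mulKf// twopi_neq0.
Qed.

(* Proportion of directions [th] for which a point at distance [u] from the
   origin was, a displacement [d] in direction [th] earlier, at squared distance
   at least [c]; the first case is [u * d = 0]. *)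
Definition dir_frac (d c u : R) : R :=
  if 0 < 2 * d * u then arc_frac ((u ^+ 2 + d ^+ 2 - c) / (2 * d * u))
  else (c <= u ^+ 2 + d ^+ 2)%R%:R.

Lemma dir_frac_ge0 d c u : 0 <= dir_frac d c u.
Proof. by rewrite /dir_frac; case: ifP => // _; exact: arc_frac_ge0. Qed.

Lemma dir_frac_le1 d c u : dir_frac d c u <= 1.
Proof. by rewrite /dir_frac; case: ifP => _; [exact: arc_frac_le1|rewrite lern1; case: (_ <= _)%R]. Qed.

(** Expanding the squares makes the condition linear in [cos th] and [sin th], the case of
    [integral_angle]. If the displacement or the radius is 0, the condition does not involve
    [th]. *)
Lemma integral_dir_frac (d c : R) (z : R * R) : 0 <= d ->
  (\int[leb]_(th in `[0%R, (2 * pi)%R[%classic)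
     ((c <= (z.1 - d * cos th) ^+ 2 + (z.2 - d * sin th) ^+ 2)%R%:R)%:E
   = (2 * pi * dir_frac d c (radius z))%:E)%E.
Proof.
move=> d0.
have r2 : radius z ^+ 2 = z.1 ^+ 2 + z.2 ^+ 2.
  by rewrite /radius sqr_sqrtr// addr_ge0// sqr_ge0.
transitivity (\int[leb]_(th in `[0%R, (2 * pi)%R[%classic)
   ((2 * d * z.1 * cos th + 2 * d * z.2 * sin th <= radius z ^+ 2 + d ^+ 2 - c)%R%:R)%:E)%E.
  apply: eq_integral => th _; congr (_ %:R)%:E; congr nat_of_bool.
  rewrite r2; have := cos2Dsin2 th => cs.
  apply/idP/idP; nra.
have rr : 2 * d * radius z = Num.sqrt ((2 * d * z.1) ^+ 2 + (2 * d * z.2) ^+ 2).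
  rewrite -(ger0_norm (_ : 0 <= 2 * d * radius z)) -?sqrtr_sqr; last first.
    by rewrite !mulr_ge0// radius_ge0.
  by congr Num.sqrt; rewrite !exprMn r2 -!exprMn; ring.
rewrite /dir_frac; case: ifPn => [dz|]; first exact: integral_angle.
rewrite -leNgt => dz; have {}dz : 2 * d * radius z = 0.
  by apply/eqP; rewrite eq_le dz !mulr_ge0// radius_ge0.
have [d00|r0] : d = 0 \/ radius z = 0.
    by move/eqP: dz; rewrite !mulf_eq0 pnatr_eq0/= => /orP[/eqP|/eqP]; [left|right].
  rewrite d00; under eq_integral do rewrite mulr0 !mul0r addr0 subr_ge0.
  by rewrite integral_angle_cst mulrC.
have [z1 z2] : z.1 = 0 /\ z.2 = 0.
  by move: r2; rewrite r0 expr0n/= => r2; split; nra.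
rewrite z1 z2; under eq_integral do rewrite !mulr0 !mul0r addr0 subr_ge0.
by rewrite integral_angle_cst mulrC.
Qed.

Lemma measurable_dir_frac (d : R) d' (T : measurableType d') (c u : T -> R) :
  measurable_fun [set: T] c -> measurable_fun [set: T] u ->
  measurable_fun [set: T] (fun x => dir_frac d (c x) (u x)).
Proof.
move=> mc mu; have ma := measurable_arc_frac.
have m1 : measurable_fun [set: T]
    (fun x => arc_frac ((u x ^+ 2 + d ^+ 2 - c x) / (2 * d * u x))).
  by apply: (measurableT_comp ma); mfun.
by rewrite /dir_frac; mfun.
Qed.

(** For a fixed direction, translation makes the final position the variable: [G] becomes radial,
    and the direction survives only in the condition on the initial position. Its average is
    [dir_frac], again radial. *)
Lemma integral_displaced (d c : R) (G : R -> R) : 0 <= d ->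
  measurable_fun [set: R] G -> (forall u, 0 <= G u) ->
  (\int[leb2]_z \int[leb]_(th in `[0%R, (2 * pi)%R[%classic)
     ((2 * pi)^-1 * ((c <= z.1 ^+ 2 + z.2 ^+ 2)%R%:R *
        G (radius (z.1 + d * cos th, z.2 + d * sin th)%R)))%:E
   = (2 * pi)%:E * \int[leb]_u (u * (0 <= u)%R%:R * (G u * dir_frac d c u))%:E)%E.
Proof.
move=> d0 mG G0; have pi0 := @pi_gt0 R; have tp0 := twopi_neq0.
have c0 : 0 <= (2 * pi)^-1 :> R by rewrite invr_ge0 mulr_ge0// ltW.
have mrad := @measurable_radius R.
pose D (th : R) : R := ((0 <= th) && (th < 2 * pi))%R%:R.
pose H (p : R * R * R) : R := D p.2 * ((2 * pi)^-1 *
  ((c <= p.1.1 ^+ 2 + p.1.2 ^+ 2)%R%:R *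
   G (radius (p.1.1 + d * cos p.2, p.1.2 + d * sin p.2)))).
pose H' (p : R * R * R) : R := D p.2 * ((2 * pi)^-1 *
  ((c <= (p.1.1 - d * cos p.2) ^+ 2 + (p.1.2 - d * sin p.2) ^+ 2)%R%:R *
   G (radius p.1))).
have H0 p : (0 <= (H p)%:E)%E by rewrite lee_fin !mulr_ge0.
have H0' p : (0 <= (H' p)%:E)%E by rewrite lee_fin !mulr_ge0.
have mH : measurable_fun [set: R * R * R] (fun p => (H p)%:E).
  have m1 : measurable_fun [set: R * R * R]
      (fun p : R * R * R => G (radius (p.1.1 + d * cos p.2, p.1.2 + d * sin p.2))).
    by apply: (measurableT_comp mG); apply: (measurableT_comp mrad); mfun.
  by rewrite /H /D; mfun.
have mH' : measurable_fun [set: R * R * R] (fun p => (H' p)%:E).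
  have m1 : measurable_fun [set: R * R * R] (fun p : R * R * R => G (radius p.1)).
    by apply: (measurableT_comp mG); apply: (measurableT_comp mrad); mfun.
  by rewrite /H' /D; mfun.
have itvE x : x \in (`[0%R, (2 * pi)%R[%classic : set R) <-> (0 <= x) && (x < 2 * pi).
  by rewrite mem_setE in_itv.
have mk (f : R -> R) : (\int[leb]_(th in `[0%R, (2 * pi)%R[%classic) (f th)%:E =
    \int[leb]_th (D th * f th)%:E)%E.
  by apply: integral_indicator_set => x; rewrite /= in_itv.
transitivity (\int[lebesgue2]_z \int[leb]_th (H (z, th))%:E)%E.
  by apply: eq_integral => z _; rewrite mk.
rewrite (fubini_tonelli (m1 := lebesgue2) (m2 := leb) (fun p => (H p)%:E) mH H0).
transitivity (\int[leb]_th \int[lebesgue2]_z (H' (z, th))%:E)%E.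
  apply: eq_integral => th _.
  rewrite -(@ge0_integral_shift2 (d * cos th) (d * sin th) (fun z => (H' (z, th))%:E)).
  - by apply: eq_integral => z _; rewrite /H /H'/= !addrK.
  - by apply: (measurableT_comp mH'); mfun.
  - by move=> p; exact: H0'.
rewrite -(fubini_tonelli (m1 := lebesgue2) (m2 := leb) (fun p => (H' p)%:E) mH' H0').
transitivity (\int[leb2]_z (G (radius z) * dir_frac d c (radius z))%:E)%E.
  apply: eq_integral => z _; rewrite -mk.
  transitivity (((2 * pi)^-1 * G (radius z))%:E * (2 * pi * dir_frac d c (radius z))%:E)%E.
    rewrite -integral_dir_frac// -ge0_integralZl_EFin//.
    - by apply: eq_integral => th _; rewrite -EFinM; congr EFin; rewrite /=; ring.
    - by apply: measurable_funTS; mfun.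
    - by rewrite mulr_ge0.
  by rewrite -EFinM; congr EFin; rewrite mulrACA mulVf// mul1r.
rewrite (@ge0_integral_radial _ (fun u => (G u * dir_frac d c u)%:E)).
- by congr (_ * _)%E; apply: eq_integral => u _; rewrite -EFinM.
- have m1 : measurable_fun [set: R] (dir_frac d c) by apply: measurable_dir_frac; mfun.
  by mfun.
- by move=> u; rewrite lee_fin mulr_ge0// dir_frac_ge0.
Qed.

End LebesguePlane.

(** * Interference integral *)

Section PathLoss.
Context {R : realType}.
Variables (h alpha : R).
Hypotheses (h0 : 0 < h) (alpha2 : 2 < alpha).
Local Notation leb := (@lebesgue_measure R).

Definition pathloss (u : R) : R := (u ^+ 2 + h ^+ 2) `^ (- (alpha / 2)).

Lemma pathloss_gt0 u : 0 < pathloss u.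
Proof. by rewrite powR_gt0// ltr_wpDl ?sqr_ge0// exprn_gt0. Qed.

Lemma measurable_pathloss : measurable_fun [set: R] pathloss.
Proof. by rewrite /pathloss; mfun. Qed.

Let sq_gt0 (u : R) : 0 < u ^+ 2 + h ^+ 2.
Proof. by rewrite ltr_wpDl ?sqr_ge0// exprn_gt0. Qed.

Lemma integral_pathloss : (\int[leb]_(u in `[0%R, +oo[) (u * pathloss u)%:E < +oo)%E.
Proof.
pose b := alpha / 2 - 1.
have b0 : 0 < b by rewrite /b subr_gt0 ltr_pdivlMr// mul1r.
(* Primitive of [u * pathloss u]; it vanishes at infinity because [2 < alpha] makes [b] positive. *)
pose F (u : R) : R := - (2 * b)^-1 * (u ^+ 2 + h ^+ 2) `^ (- b).
have dF (x : R) : is_derive x 1 F (x * pathloss x).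
  have dq : is_derive x 1 (fun u : R => u ^+ 2 + h ^+ 2) (2 * x).
    by apply: is_derive_eq; rewrite /GRing.scale/=; ring.
  have dp := is_derive1_powR (- b) (sq_gt0 x).
  have dc : is_derive x 1 (fun u : R => (u ^+ 2 + h ^+ 2) `^ (- b))
      ((- b * (x ^+ 2 + h ^+ 2) `^ (- b - 1)) * (2 * x)).
    exact: (@is_derive1_comp _ (fun y => y `^ (- b)) (fun u : R => u ^+ 2 + h ^+ 2)).
  apply: is_derive_eq; rewrite /GRing.scale/= /pathloss.
  rewrite (_ : - b - 1 = - (alpha / 2)); last by rewrite /b; ring.
  by field; rewrite lt0r_neq0.
have cF x : {for x, continuous F}.
  by apply: differentiable_continuous; apply/derivable1_diffP; have := dF x => -[].
have cf : continuous (fun u : R => u * pathloss u).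
  move=> x; apply: differentiable_continuous; apply/derivable1_diffP.
  have dq : is_derive x 1 (fun u : R => u ^+ 2 + h ^+ 2) (2 * x).
    by apply: is_derive_eq; rewrite /GRing.scale/=; ring.
  have dp := is_derive1_powR (- (alpha / 2)) (sq_gt0 x).
  have dc := @is_derive1_comp _ (fun y => y `^ (- (alpha / 2))) (fun u : R => u ^+ 2 + h ^+ 2) x _ _ dp dq.
  by apply: derivableM => //; case: dc.
have limF : F u @[u --> +oo] --> 0.
  rewrite -(mulr0 (- (2 * b)^-1)); apply: cvgMr.
  under eq_fun do rewrite powRN.
  apply/gtr0_cvgV0; first by near=> u; rewrite powR_gt0.
  apply/cvgryPge => A; near=> u.
  have A0 : 0 <= Num.max A 0 by rewrite le_max lexx orbT.
  apply: (@le_trans _ _ (Num.max A 0)); first by rewrite le_max lexx.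
  rewrite -[leLHS](powRr1 A0) -(@mulVf _ b) ?gt_eqF// powRrM.
  apply: ge0_ler_powR; rewrite ?nnegrE ?powR_ge0 ?(ltW b0) ?(ltW (sq_gt0 _))//.
  (* The added 1 gives [1 <= u], so that [u ^+ 2] dominates [u] and hence the required power. *)
  have uB : Num.max A 0 `^ b^-1 + 1 <= u by near: u; exact: nbhs_pinfty_ge.
  have := powR_ge0 (Num.max A 0) b^-1; have := sqr_ge0 h.
  nra.
rewrite (@ge0_continuous_FTC2y _ (fun u => u * pathloss u) F 0 0).
- by rewrite /F -EFinB ltry.
- by move=> x x0; rewrite mulr_ge0// ltW// pathloss_gt0.
- exact: continuous_subspaceT.
- exact: limF.
- by move=> x _; have := dF x => -[].
- exact/cvg_at_right_filter/cF.
- by move=> x _; rewrite derive1E; have := dF x => -[].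
Unshelve. all: by end_near.
Qed.

(* Laplace transform deficit of one unit-mean exponential interferer: with
   [k = s * Pw], this is [1 - E exp (- s * Pw * g * pathloss u)]. *)
Definition deficit (k u : R) : R := k * pathloss u / (1 + k * pathloss u).

Lemma deficit_ge0 k u : 0 <= k -> 0 <= deficit k u.
Proof.
by move=> k0; have := pathloss_gt0 u => p0; rewrite divr_ge0 ?addr_ge0 ?mulr_ge0// ltW.
Qed.

Lemma deficit_le k u : 0 <= k -> deficit k u <= k * pathloss u.
Proof.
move=> k0; have p0 := pathloss_gt0 u; have kp : 0 <= k * pathloss u by rewrite mulr_ge0// ltW.
by rewrite ler_pdivrMr ?ltr_pwDl// ler_peMr// lerDl.
Qed.

Lemma measurable_deficit d (T : measurableType d) (k u : T -> R) :
  measurable_fun [set: T] k -> measurable_fun [set: T] u ->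
  measurable_fun [set: T] (fun x => deficit (k x) (u x)).
Proof. by move=> mk mu; rewrite /deficit /pathloss; mfun. Qed.

Variable d : R.
Hypothesis d0 : 0 <= d.

(* Interference integral, after the radial change of variables. *)
Definition deficit_radial (k c u : R) : R :=
  u * (0 <= u)%R%:R * (deficit k u * dir_frac d c u).

Lemma deficit_radial_ge0 k c u : 0 <= k -> 0 <= deficit_radial k c u.
Proof.
move=> k0; rewrite mulr_ge0//; last by rewrite mulr_ge0 ?deficit_ge0 ?dir_frac_ge0.
by case: (leP 0 u) => u0; rewrite ?mulr1 ?mulr0.
Qed.

Lemma measurable_deficit_radial d' (T : measurableType d') (k c u : T -> R) :
  measurable_fun [set: T] k -> measurable_fun [set: T] c -> measurable_fun [set: T] u ->
  measurable_fun [set: T] (fun x => deficit_radial (k x) (c x) (u x)).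
Proof.
move=> mk mc mu; have m1 := measurable_deficit mk mu.
by have m2 := @measurable_dir_frac _ d _ _ _ _ mc mu; rewrite /deficit_radial; mfun.
Qed.

Definition interf_mass (k c : R) : \bar R := (\int[leb]_u (deficit_radial k c u)%:E)%E.

Lemma interf_mass_ge0 k c : 0 <= k -> (0 <= interf_mass k c)%E.
Proof. by move=> k0; apply: integral_ge0 => u _; rewrite lee_fin deficit_radial_ge0. Qed.

(** Since the deficit is at most [k * pathloss u] and [dir_frac] at most 1, the integrable path loss
    dominates. *)
Lemma interf_mass_fin k c : 0 <= k -> (interf_mass k c < +oo)%E.
Proof.
move=> k0; rewrite /interf_mass; apply: (@le_lt_trans _ _ (k%:E * \int[leb]_(u in `[0%R, +oo[) (u * pathloss u)%:E)%E).
  rewrite (_ : \int[leb]_(u in `[0%R, +oo[%classic) (u * pathloss u)%:E = \int[leb]_u ((0 <= u)%R%:R * (u * pathloss u))%:E)%E; last first.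
    by apply: integral_indicator_set => u; rewrite /= in_itv/= andbT.
  rewrite -ge0_integralZl_EFin//.
  - apply: ge0_le_integral => //.
    + by move=> u _; rewrite lee_fin deficit_radial_ge0.
    + by apply/measurable_EFinP; apply: measurable_deficit_radial; mfun.
    + change (measurable_fun [set: R] (fun u : R => (k * ((0 <= u)%R%:R * (u * pathloss u)))%:E)).
      by rewrite /pathloss; mfun; apply: mfun_le; mfun.
    + move=> u _; rewrite lee_fin /deficit_radial; case: (leP 0 u) => // u0; rewrite ?mulr0 ?mul0r ?mulr0//.
      rewrite mulr1 mul1r [leRHS]mulrCA ler_wpM2l//.
      apply: (le_trans _ (deficit_le _ k0)).
      by rewrite ler_piMr ?deficit_ge0 ?dir_frac_le1.
  - move=> u _; rewrite lee_fin.
    by case: (leP 0 u) => // u0; rewrite ?mul0r// !mul1r mulr_ge0// ltW// pathloss_gt0.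
  - by rewrite /pathloss; mfun; apply: mfun_le; mfun.
have i0 : (0 <= \int[leb]_(u in `[0%R, +oo[) (u * pathloss u)%:E)%E.
  apply: integral_ge0 => u; rewrite /= in_itv/= andbT => u0.
  by rewrite lee_fin mulr_ge0// ltW// pathloss_gt0.
by rewrite lte_mul_pinfty// integral_pathloss.
Qed.

Lemma hdist0_radius (p : mpt R) : hdist0 p = radius p.1.1.
Proof. by []. Qed.

Lemma hdist0_sq (p : mpt R) : hdist0 p ^+ 2 = px p ^+ 2 + py p ^+ 2.
Proof. by rewrite sqr_sqrtr// addr_ge0// sqr_ge0. Qed.

(** The fading average yields the deficit by [integral_exp_laplace], the direction average is
    [integral_displaced]. Clipping the gain at 0 changes nothing where [mark_density] is nonzero and
    keeps the integrand nonnegative everywhere. *)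
Lemma integral_interference (lam0 c b : R) : 0 <= lam0 -> 0 <= b ->
  (\int[lebm]_(q in [set q | (c <= hdist0 q ^+ 2)%R])
    ((1 - expR (- (b * (Num.max (pfad q) 0 * pathloss (radius (px q + d * cos (pdir q), py q + d * sin (pdir q)))))))
      * mark_density lam0 q)%:E
  = (lam0 * (2 * pi))%:E * interf_mass b c)%E.
Proof.
move=> l0 b0.
pose F (q : mpt R) : R := (c <= hdist0 q ^+ 2)%R%:R *
  (1 - expR (- (b * (Num.max (pfad q) 0 * pathloss (radius (px q + d * cos (pdir q), py q + d * sin (pdir q))))))).
have mp := measurable_pathloss; have mrad := @measurable_radius R.
have mF : measurable_fun [set: mpt R] F.
  rewrite /F /hdist0 /px /py /pfad /pdir.
  have m1 : measurable_fun [set: mpt R]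
      (fun q : mpt R => pathloss (radius (q.1.1.1 + d * cos q.1.2, q.1.1.2 + d * sin q.1.2))).
    by apply: (measurableT_comp mp); apply: (measurableT_comp mrad); mfun.
  by mfun.
have F0 q : 0 <= F q.
  rewrite mulr_ge0// subr_ge0 -expR0 ler_expR oppr_le0 !mulr_ge0//.
    by rewrite le_max lexx orbT.
  by rewrite ltW// pathloss_gt0.
pose G (z : R * R) (th : R) := (c <= z.1 ^+ 2 + z.2 ^+ 2)%R%:R *
  deficit b (radius (z.1 + d * cos th, z.2 + d * sin th)).
transitivity (\int[lebm]_q (F q * mark_density lam0 q)%:E)%E.
  rewrite (@integral_indicator_set _ _ _ lebm _ (fun q => (c <= hdist0 q ^+ 2)%R))//.
  by apply: eq_integral => q _; rewrite /F mulrA.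
rewrite (integral_lebm_fading (G := G))//.
  rewrite integral_displaced//; last by move=> u; exact: deficit_ge0.
    by rewrite muleA -EFinM.
  by apply: measurable_deficit; mfun.
move=> z th; rewrite /G /deficit.
set ll := pathloss _.
have ll0 : 0 <= b * ll by rewrite mulr_ge0// ltW// pathloss_gt0.
rewrite EFinM -integral_exp_laplace// -ge0_integralZl_EFin//.
- apply: eq_integral => g; rewrite mem_setE in_itv/= andbT => g0.
  rewrite -EFinM /F hdist0_sq/= /px /py /pfad /pdir/= -/ll.
  by rewrite (max_l g0) (_ : b * (g * ll) = b * ll * g); [rewrite mulrA|ring].
- move=> g; rewrite /= in_itv/= andbT => g0; rewrite lee_fin mulr_ge0 ?expR_ge0//.
  by rewrite subr_ge0 -expR0 ler_expR oppr_le0 mulr_ge0.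
- by apply: measurable_funTS; mfun.
Qed.

End PathLoss.

(** * Identification with the integrals of the formula *)

Section Formula.
Context {R : realType}.
Variables (h v alpha gam t : R).
Hypotheses (h0 : 0 < h) (alpha2 : 2 < alpha) (v0 : 0 < v) (t0 : 0 <= t) (gam0 : 0 < gam).
Local Notation leb := (@lebesgue_measure R).
Local Notation d := (v * t).

Let d0 : 0 <= d. Proof. by rewrite mulr_ge0// ltW. Qed.

Let sq_gt0 (u : R) : 0 < u ^+ 2 + h ^+ 2.
Proof. by rewrite ltr_wpDl ?sqr_ge0// exprn_gt0. Qed.

(** Common form of [g1], with [m = h ^+ 2], and [g2], with [m = (u0 - v * t) ^+ 2 + h ^+ 2]: in
    both, [m] is the squared distance from the user to the serving station at time [t]. *)
Lemma deficitE (m u : R) : 0 < m ->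
  u / (1 + gam^-1 * ((u ^+ 2 + h ^+ 2) / m) `^ (alpha / 2)) =
  u * deficit h alpha (gam * m `^ (alpha / 2)) u.
Proof.
move=> m0; rewrite /deficit /pathloss.
have mr : m^-1 `^ (alpha / 2) = (m `^ (alpha / 2))^-1.
  by rewrite -powR_inv1 ?(ltW m0)// -powRrM mulN1r powRN.
rewrite powRM ?(ltW (sq_gt0 _)) ?invr_ge0 ?(ltW m0)// mr powRN.
have M0 : 0 < m `^ (alpha / 2) by exact: powR_gt0.
have X0 : 0 < (u ^+ 2 + h ^+ 2) `^ (alpha / 2) by exact: powR_gt0.
set M := m `^ _ in M0 *; set X := (_ + _) `^ _ in X0 *.
have N0 : 0 < X + gam * M by rewrite addr_gt0// mulr_gt0.
by field; rewrite !lt0r_neq0//= addrC ?N0.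
Qed.

(** The cosine threshold is never below [-1] because [u + d >= u0], and it is at least 1 unless the
    circles of radii [u] and [u0], with centers at distance [d], cross. So directions are lost only
    for [u] between [d - u0] and [d + u0]. *)
Lemma dir_frac_near (u0 u : R) : 0 <= u0 < d -> 0 < u ->
  dir_frac d (u0 ^+ 2) u = 1 - (d - u0 <= u <= d + u0)%R%:R *
    (acos ((- u0 ^+ 2 + u ^+ 2 + v ^+ 2 * t ^+ 2) / (2 * u * v * t)) / pi).
Proof.
move=> /andP[u00 u0d] u1; rewrite /dir_frac.
have dd : 0 < d by exact: le_lt_trans u0d.
have du : 0 < 2 * d * u by apply: mulr_gt0 => //; exact: mulr_gt0.
rewrite du (_ : - u0 ^+ 2 + u ^+ 2 + v ^+ 2 * t ^+ 2 = u ^+ 2 + d ^+ 2 - u0 ^+ 2); last first.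
  by rewrite exprMn; ring.
rewrite (_ : 2 * u * v * t = 2 * d * u); last by ring.
rewrite /arc_frac; set k := (_ / _).
have -> : (k < -1) = false.
  by apply/negbTE; rewrite -leNgt ler_pdivlMr//; nra.
have -> : (1 <= k) = ~~ (d - u0 < u < d + u0).
  rewrite ler_pdivlMr// mul1r; apply/idP/idP.
    by move=> H; apply/negP => /andP[H1 H2]; nra.
  rewrite negb_and -!leNgt => /orP[H|H]; nra.
case: ifPn => [|].
  (* At the two endpoints the threshold equals 1 and [acos 1 = 0], so the closed interval of the
     formula is harmless. *)
  rewrite negb_and -!leNgt => H; case: (boolP (d - u0 <= u <= d + u0)) => [/andP[H1 H2]|_]; last by rewrite mul0r subr0.
  rewrite (_ : k = 1) ?acos1 ?mul0r ?mulr0 ?subr0//.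
  have : (u = d - u0) \/ (u = d + u0) by case/orP: H => H; [left|right]; apply/eqP; rewrite eq_le; apply/andP.
  by move=> uE; rewrite /k -[RHS](divff (lt0r_neq0 du)); congr (_ / _); case: uE => ->; ring.
rewrite negbK => /andP[H1 H2]; rewrite !ltW//= ?mul1r//.
Qed.

(** No direction is compatible below [u0 - d] and all are above [u0 + d]. In between,
    [acos (- k) = pi - acos k] accounts for the opposite sign of the argument in [calB]. *)
Lemma dir_frac_far (u0 u : R) : d <= u0 -> 0 < d -> 0 < u ->
  dir_frac d (u0 ^+ 2) u = (u0 + d < u)%R%:R + (u0 - d <= u <= u0 + d)%R%:R *
    (acos ((u0 ^+ 2 - u ^+ 2 - v ^+ 2 * t ^+ 2) / (2 * u * v * t)) / pi).
Proof.
move=> u0d dd u1; rewrite /dir_frac; have pi0 := @pi_gt0 R.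
have du : 0 < 2 * d * u by apply: mulr_gt0 => //; exact: mulr_gt0.
rewrite du (_ : u0 ^+ 2 - u ^+ 2 - v ^+ 2 * t ^+ 2 = - (u ^+ 2 + d ^+ 2 - u0 ^+ 2)); last first.
  by rewrite exprMn; ring.
rewrite (_ : 2 * u * v * t = 2 * d * u); last by ring.
rewrite mulNr /arc_frac; set k := (_ / _).
have kN1 : (k < -1) = (u < u0 - d).
  by rewrite ltr_pdivrMr//; apply/idP/idP => H; nra.
have k1 : (1 <= k) = (u0 + d <= u).
  by rewrite ler_pdivlMr// mul1r; apply/idP/idP => H; nra.
rewrite kN1 k1; case: ltP => [H|H1].
  rewrite ltNge (_ : u <= u0 + d); last by lra.
  by rewrite mul0r addr0.
case: (ltgtP (u0 + d) u) => [H|H|H] /=; rewrite ?mul0r ?addr0 ?add0r ?mul1r//.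
  have kk : -1 <= k <= 1.
    by rewrite leNgt kN1 -leNgt H1/= ltW// ltNge k1 -ltNge.
  by rewrite acosN// mulrBl divff// gt_eqF.
have -> : k = 1.
  by rewrite /k -[RHS](divff (lt0r_neq0 du)); congr (_ / _); rewrite -H; ring.
by rewrite acosN1 divff// gt_eqF.
Qed.

Local Notation interf := (interf_mass h alpha d).

(* Integrand of the interference integral without the exclusion disk. *)
Let defl (k u : R) : R := u * (0 <= u)%R%:R * deficit h alpha k u.

Let defl_ge0 k u : 0 <= k -> 0 <= defl k u.
Proof.
move=> k0; rewrite /defl; case: (leP 0 u) => u0; rewrite ?mulr0 ?mul0r// mulr1.
by rewrite mulr_ge0// deficit_ge0.
Qed.

Let mdefl k : measurable_fun [set: R] (defl k).
Proof.
have m1 : measurable_fun [set: R] (fun u => deficit h alpha k u).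
  by apply: measurable_deficit; mfun.
by rewrite /defl; mfun; apply: mfun_le; mfun.
Qed.

Let defl_fin k : 0 <= k -> (\int[leb]_u (defl k u)%:E < +oo)%E.
Proof.
(* A squared exclusion radius of [-1] excludes nothing: [dir_frac] is then identically 1. *)
move=> k0; apply: le_lt_trans (interf_mass_fin h0 alpha2 d (-1) k0).
apply: ge0_le_integral => //.
- by move=> u _; rewrite lee_fin; exact: defl_ge0.
- by apply/measurable_EFinP; exact: mdefl.
- by apply/measurable_EFinP; apply: measurable_deficit_radial; mfun.
move=> u _; rewrite lee_fin /deficit_radial mulrA -/(defl k u).
rewrite (_ : dir_frac d (-1) u = 1) ?mulr1//.
rewrite /dir_frac; case: ifPn => du.
  rewrite /arc_frac ltr_pdivrMr// ler_pdivlMr//.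
  have -> : (u ^+ 2 + d ^+ 2 - -1 < -1 * (2 * d * u)) = false by apply/negbTE; rewrite -leNgt; nra.
  by have -> : (1 * (2 * d * u) <= u ^+ 2 + d ^+ 2 - -1) by have := sqr_ge0 (u - d); lra.
by have -> : (-1 <= u ^+ 2 + d ^+ 2) by nra.
Qed.

(** The unrestricted integral splits into the compatible share [A] and the lost share [B]; both are
    finite, so the first is a difference of reals. *)
Lemma interference_calA (u0 : R) : 0 <= u0 < d ->
  fine (interf (gam * h `^ alpha) (u0 ^+ 2)) = calA h v alpha gam t u0.
Proof.
move=> u0d; have /andP[u00 u0d'] := u0d; have pi0 := @pi_gt0 R.
have hh : h `^ alpha = (h ^+ 2) `^ (alpha / 2).
  by rewrite -powR_mulrn ?(ltW h0)// -powRrM mulrCA mulfV ?mulr1// pnatr_eq0.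
set k := gam * h `^ alpha; have k0 : 0 <= k by rewrite mulr_ge0 ?powR_ge0// ltW.
have g1E u : 0 <= u -> g1 h alpha gam u = defl k u.
  by move=> u1; rewrite /g1 deficitE ?exprn_gt0// -hh /defl u1 mulr1.
pose A u := defl k u * dir_frac d (u0 ^+ 2) u.
pose B u := defl k u * (1 - dir_frac d (u0 ^+ 2) u).
have md : measurable_fun [set: R] (dir_frac d (u0 ^+ 2)) by apply: measurable_dir_frac; mfun.
have mk := @mdefl k.
have A0 u : 0 <= A u by rewrite mulr_ge0 ?dir_frac_ge0 ?defl_ge0.
have B0 u : 0 <= B u by rewrite mulr_ge0 ?defl_ge0// subr_ge0 dir_frac_le1.
have mA : measurable_fun [set: R] (fun u => (A u)%:E).
  by apply/measurable_EFinP; exact: (mfun_mul mk md).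
have mB : measurable_fun [set: R] (fun u => (B u)%:E).
  apply/measurable_EFinP; apply: (mfun_mul mk).
  by apply: mfun_add; mfun; exact: mfun_opp.
have AB : (\int[leb]_u (defl k u)%:E = \int[leb]_u (A u)%:E + \int[leb]_u (B u)%:E)%E.
  rewrite -ge0_integralD//; first by apply: eq_integral => u _; rewrite -EFinD; congr EFin; rewrite /A /B; ring.
  by move=> u _; rewrite lee_fin.
  by move=> u _; rewrite lee_fin.
have fin := defl_fin k0.
have iA : (0 <= \int[leb]_u (A u)%:E)%E by apply: integral_ge0 => u _; rewrite lee_fin.
have iB : (0 <= \int[leb]_u (B u)%:E)%E by apply: integral_ge0 => u _; rewrite lee_fin.
have fA : (\int[leb]_u (A u)%:E)%E \is a fin_num.
  by rewrite ge0_fin_numE// (le_lt_trans _ fin)// AB leeDl.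
have fB : (\int[leb]_u (B u)%:E)%E \is a fin_num.
  by rewrite ge0_fin_numE// (le_lt_trans _ fin)// AB leeDr.
have -> : interf k (u0 ^+ 2) = (\int[leb]_u (A u)%:E)%E.
  by apply: eq_integral => u _; rewrite /deficit_radial /A mulrA.
rewrite /calA /Rintegral.
have -> : (\int[leb]_(u in `[0%R, +oo[%classic) (g1 h alpha gam u)%:E = \int[leb]_u (defl k u)%:E)%E.
  rewrite (integral_indicator_set leb (b := fun u => 0 <= u)); last first.
    by move=> u; rewrite /= in_itv/= andbT.
  apply: eq_integral => u _; case: (leP 0 u) => u1; first by rewrite mul1r g1E.
  by rewrite /defl (leNgt 0 u) u1 mulr0 !mul0r.
rewrite [X in _ - fine X](_ : _ = \int[leb]_u (B u)%:E)%E; last first.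
  rewrite (integral_indicator_set leb (b := fun u => d - u0 <= u <= d + u0)); last first.
    by move=> u; rewrite /= in_itv/=.
  apply: eq_integral => u _; congr EFin; rewrite /B.
  have [u1|u1|<-] := ltgtP 0 u; last first.
  - by rewrite /g1 /defl !mul0r mulr0.
  - rewrite /defl (leNgt 0 u) u1 mulr0 !mul0r.
    by rewrite leNgt (_ : u < d - u0) ?mul0r//; lra.
  - by rewrite dir_frac_near// (g1E _ (ltW u1)); move: (_%:R) => X; ring.
by rewrite AB (fineD fA fB) addrK.
Qed.

Lemma interference_calB (u0 : R) : d <= u0 ->
  fine (interf (gam * ((u0 - d) ^+ 2 + h ^+ 2) `^ (alpha / 2)) (u0 ^+ 2)) = calB h v alpha gam t u0.
Proof.
move=> u0d; have u00 : 0 <= u0 := le_trans d0 u0d; have pi0 := @pi_gt0 R.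
set k := gam * _ `^ _; have k0 : 0 <= k by rewrite mulr_ge0 ?powR_ge0// ltW.
have g2E u : 0 <= u -> g2 h v alpha gam t u0 u = defl k u.
  by move=> u1; rewrite /g2 deficitE// /defl u1 mulr1.
have mk := @mdefl k.
have fin := defl_fin k0.
(* Opening the left end makes the two domains disjoint, matching the indicators in [A] and [B]. *)
rewrite /calB /Rintegral -integral_itv_obnd_cbnd; last first.
  by apply: measurable_funTS; rewrite /g2; mfun.
have md : measurable_fun [set: R] (dir_frac d (u0 ^+ 2)) by apply: measurable_dir_frac; mfun.
pose A u := defl k u * dir_frac d (u0 ^+ 2) u * (u0 + d < u)%R%:R.
pose B u := defl k u * dir_frac d (u0 ^+ 2) u * (u <= u0 + d)%R%:R.
have AB0 u : 0 <= defl k u * dir_frac d (u0 ^+ 2) u by rewrite mulr_ge0 ?defl_ge0 ?dir_frac_ge0.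
have A0 u : 0 <= A u by rewrite mulr_ge0.
have B0 u : 0 <= B u by rewrite mulr_ge0.
have mm : measurable_fun [set: R] (fun u => defl k u * dir_frac d (u0 ^+ 2) u) := mfun_mul mk md.
have mA : measurable_fun [set: R] (fun u => (A u)%:E) by rewrite /A; mfun; apply: mfun_lt; mfun.
have mB : measurable_fun [set: R] (fun u => (B u)%:E) by rewrite /B; mfun; apply: mfun_le; mfun.
have AB : (interf k (u0 ^+ 2) = \int[leb]_u (A u)%:E + \int[leb]_u (B u)%:E)%E.
  rewrite -ge0_integralD//.
  - apply: eq_integral => u _; rewrite -EFinD; congr EFin; rewrite /A /B -mulrDr /deficit_radial mulrA.
    by case: leP => _; rewrite ?addr0 ?add0r mulr1.
  - by move=> u _; rewrite lee_fin.
  - by move=> u _; rewrite lee_fin.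
have iA : (0 <= \int[leb]_u (A u)%:E)%E by apply: integral_ge0 => u _; rewrite lee_fin.
have iB : (0 <= \int[leb]_u (B u)%:E)%E by apply: integral_ge0 => u _; rewrite lee_fin.
have fin2 := interf_mass_fin h0 alpha2 d (u0 ^+ 2) k0.
have fA : (\int[leb]_u (A u)%:E)%E \is a fin_num.
  by rewrite ge0_fin_numE// (le_lt_trans _ fin2)// -/(interf _ _) AB leeDl.
have fB : (\int[leb]_u (B u)%:E)%E \is a fin_num.
  by rewrite ge0_fin_numE// (le_lt_trans _ fin2)// -/(interf _ _) AB leeDr.
rewrite AB fineD//; congr (_ + _).
  congr fine.
  rewrite [RHS](integral_indicator_set leb (b := fun u => u0 + d < u)); last first.
    by move=> u; rewrite /= in_itv/= andbT.
  apply: eq_integral => u _; congr EFin; rewrite /A [LHS]mulrC.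
  case: ltP => H; rewrite ?mul0r// !mul1r.
  have u1 : 0 < u by apply: le_lt_trans H; rewrite addr_ge0.
  rewrite (g2E _ (ltW u1)) (_ : dir_frac _ _ _ = 1) ?mulr1//.
  have [dz|dz] := eqVneq d 0.
    rewrite /dir_frac dz mulr0 mul0r ltxx expr0n/= addr0.
    by rewrite ler_sqr ?nnegrE ?(ltW u1)// (_ : u0 <= u)//; apply: ltW; apply: le_lt_trans H; rewrite lerDl.
  rewrite dir_frac_far//; last by rewrite lt_neqAle eq_sym dz d0.
  by rewrite H [u <= _]leNgt H andbF mul0r addr0.
(* At [t = 0] the arccosine has denominator 0, but its interval is the single point [u0], and [B]
   vanishes away from that point as well. *)
have [dz|dz] := eqVneq d 0.
  congr fine; rewrite dz subr0 addr0 set_itv1 integral_set1 -(@integral_set1 _ (fun u => (defl k u)%:E) u0).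
  rewrite [RHS](integral_indicator_set leb (b := fun u => u == u0)); last first.
    by move=> u; split=> [->|/eqP->].
  apply: eq_integral => u _; congr EFin; rewrite /B dz addr0 [RHS]mulrC.
  have [u1|u1] := leP 0 u; last by rewrite /defl (leNgt 0 u) u1 mulr0 !mul0r.
  rewrite /dir_frac mulr0 mul0r ltxx expr0n/= addr0.
  rewrite ler_sqr ?nnegrE// -mulrA -natrM mulnb -eq_le eq_sym.
  by [].
have dd : 0 < d by rewrite lt_neqAle eq_sym dz d0.
congr fine.
rewrite [RHS](integral_indicator_set leb (b := fun u => u0 - d <= u <= u0 + d)); last first.
  by move=> u; rewrite /= in_itv/=.
apply: eq_integral => u _; congr EFin; rewrite /B.
have [u1|u1|<-] := ltgtP 0 u; last first.
- by rewrite /g2 /defl !mul0r mulr0.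
- rewrite /defl (leNgt 0 u) u1 mulr0 !mul0r.
  by rewrite leNgt (_ : u < u0 - d) ?mul0r//; lra.
- rewrite dir_frac_far// (g2E _ (ltW u1)).
  case: (ltP (u0 + d) u) => H; first by rewrite mulr0 andbF mul0r.
  by rewrite andbT add0r mulr1; move: (_%:R) => X; ring.
Qed.

End Formula.

(** * One annulus *)

Section Annulus.
Context {R : realType}.
Local Notation leb := (@lebesgue_measure R).
Local Notation leb2 := (leb \x leb)%E.

Lemma measurable_exp_tail (c : R) :
  measurable_fun [set: R] (fun x : R => ((c <= x)%R%:R * expR (- x))%:E).
Proof.
apply/measurable_EFinP.
apply: mfun_mul; [apply: mfun_bool; apply: mfun_le; mfun|].
by apply: mfun_expR; apply: mfun_opp; mfun.
Qed.

(** Endpoints are squared distances, which makes the intensity linear in them. *)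
Definition annulus (a b : R) : set (mpt R) := [set p | a <= hdist0 p ^+ 2 < b].

Lemma measurable_annulus a b : measurable (annulus a b).
Proof. by apply: measurable_pred; rewrite /hdist0 /px /py; mfun. Qed.

Lemma lebesgue2_annulus a b : 0 <= a -> a <= b ->
  leb2 [set z : R * R | a <= radius z ^+ 2 < b] = (pi * (b - a))%:E.
Proof.
move=> a0 ab; have b0 := le_trans a0 ab; have mrad := @measurable_radius R.
have m1 c : measurable [set z : R * R | radius z ^+ 2 < c].
  by apply: measurable_pred; mfun.
have disk c : 0 <= c -> leb2 [set z : R * R | radius z ^+ 2 < c] = (pi * c)%:E.
  move=> c0; rewrite -[in RHS](sqr_sqrtr c0) -lebesgue2_disk ?sqrtr_ge0//.
  congr (leb2 _); apply/seteqP; split => z /=.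
    by rewrite -{1}(sqr_sqrtr c0) ltr_sqr ?nnegrE ?radius_ge0 ?sqrtr_ge0.
  by rewrite -{2}(sqr_sqrtr c0) ltr_sqr ?nnegrE ?radius_ge0 ?sqrtr_ge0.
rewrite (_ : [set z | _] = [set z : R * R | radius z ^+ 2 < b] `\` [set z : R * R | radius z ^+ 2 < a]).
  have fb : (leb2 [set z : R * R | (radius z ^+ 2 < b)%R] < +oo)%E by rewrite disk// ltry.
  apply: (etrans (@measureD _ _ _ lebesgue2 _ _ (m1 b) (m1 a) fb)).
  rewrite (_ : _ `&` _ = [set z : R * R | radius z ^+ 2 < a]).
    apply: (etrans (congr2 (fun x y => x - y)%E (disk b b0) (disk a a0))).
    by rewrite -EFinB mulrBr.
  by apply/seteqP; split => z /=; [case|move=> H; split => //; exact: lt_le_trans ab].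
apply/seteqP; split => z /=; first by move=> /andP[H1 H2]; split => //; apply/negP; rewrite -leNgt.
by move=> [H1 /negP]; rewrite -leNgt => -> .
Qed.

Variable lam0 : R.
Hypothesis l0 : 0 <= lam0.
Local Notation mu := (intensity lam0).

Lemma intensityI_isotropic (A : set (mpt R)) (b : mpt R -> bool) (G : R * R -> R) :
  measurable_fun [set: mpt R] b -> A = [set p | b p] ->
  (forall z th, \int[leb]_(g in `[0%R, +oo[%classic) ((b (z, th, g))%:R * expR (- g))%:E = (G z)%:E)%E ->
  measurable_fun [set: R * R] G ->
  mu A = (\int[leb2]_z (lam0 * G z)%:E)%E.
Proof.
move=> mb -> bG mG.
rewrite intensityE//; last exact: measurable_pred.
rewrite (@integral_indicator_set _ _ _ lebm _ b)//.
by apply: integral_lebm_isotropic => //; mfun.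
Qed.

Lemma intensity_annulus a b : 0 <= a -> a <= b ->
  mu (annulus a b) = (lam0 * (pi * (b - a)))%:E.
Proof.
move=> a0 ab; have mrad := @measurable_radius R.
have mb : measurable_fun [set: R * R] (fun z : R * R => a <= radius z ^+ 2 < b) by mfun.
rewrite (@intensityI_isotropic _ (fun p => a <= hdist0 p ^+ 2 < b)
   (fun z => (a <= radius z ^+ 2 < b)%R%:R))//.
- rewrite EFinM -lebesgue2_annulus//.
  under eq_integral do rewrite EFinM.
  rewrite ge0_integralZl_EFin//; last by mfun.
  by rewrite integral_bool// setTI.
- by rewrite /hdist0 /px /py; mfun.
- move=> z th; have e0 := @integral_exp_tail R 0 (lexx 0); rewrite oppr0 expR0 in e0.
  rewrite -[RHS]mule1 -e0 -ge0_integralZl_EFin//.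
  + apply: eq_integral => g; rewrite mem_setE in_itv/= andbT => g0.
    by rewrite g0 mul1r -EFinM.
  + by apply: measurable_funTS; exact: measurable_exp_tail.
- by mfun.
Qed.

Lemma intensity_finite_annulus a b : (mu (annulus a b) < +oo)%E.
Proof.
pose c := Num.max b 0.
have : (mu (annulus 0 c) < +oo)%E by rewrite intensity_annulus ?ltry ?le_max ?lexx ?orbT.
apply: le_lt_trans.
apply: (le_mu (measurable_mark_density lam0) (fun p => mark_density_ge0 p l0)
  (fun A mA => intensityE l0 mA)); [exact: measurable_annulus|exact: measurable_annulus|].
move=> p /= /andP[_ H]; rewrite /annulus/= sqr_ge0/= lt_max H.
by [].
Qed.

End Annulus.

(** * Coverage within one annulus and its density *)

Section Model.
Context {R : realType}.
Variables (lam0 h v alpha Pw N0 gam t : R).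
Hypotheses (l0 : 0 < lam0) (h0 : 0 < h) (v0 : 0 < v) (Pw0 : 0 < Pw) (N00 : 0 <= N0)
  (alpha2 : 2 < alpha) (t0 : 0 <= t) (gam0 : 0 < gam).
Local Notation leb := (@lebesgue_measure R).
Local Notation leb2 := (leb \x leb)%E.
Local Notation mu := (intensity lam0).
Local Notation d := (v * t).

Let d0 : 0 <= d. Proof. by rewrite mulr_ge0// ltW. Qed.

(* [gam] divided by the path loss of a serving station initially at distance [u]. *)
Definition kap (u : R) : R := gam * (Num.max (u - d) 0 ^+ 2 + h ^+ 2) `^ (alpha / 2).

(** A serving station starting at [z] covers the user when its gain is at least [srate z] times
    interference plus noise. *)
Definition srate (z : R * R) : R := kap (radius z) / Pw.

(** Clipped at 0 because the approximation by step functions wants a gain nonnegative at every mark;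
    almost surely the clipping has no effect. *)
Definition fgain (q : mpt R) : R := Pw * Num.max (pfad q) 0 * intf_pl h v alpha t q.

(* The SINR is at least [gam] iff the interference is at most this quantity. *)
Definition sgain (p : mpt R) : R := Pw * pfad p * serv_pl h v alpha t p / gam - N0.

(** Total exponent for a serving distance [u]: the mean number of points within squared radius [c],
    where there must be no other, plus the Laplace exponent of the interferers outside. *)
Definition excess (u c : R) : R :=
  lam0 * (pi * c) + lam0 * (2 * pi) * fine (interf_mass h alpha d (kap u) c).

(** Density, with respect to area, of the initial position of the serving station on the event of
    coverage. *)
Definition dens (u : R) : R :=
  lam0 * (expR (- (kap u / Pw * N0)) * expR (- excess u (u ^+ 2))).

Lemma kap_gt0 u : 0 < kap u.
Proof. by rewrite mulr_gt0// powR_gt0// ltr_wpDl ?sqr_ge0// exprn_gt0. Qed.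

Lemma measurable_kap : measurable_fun [set: R] kap.
Proof. by rewrite /kap; mfun. Qed.

Lemma srate_gt0 z : 0 < srate z.
Proof. by rewrite divr_gt0// kap_gt0. Qed.

Lemma measurable_srate : measurable_fun [set: R * R] srate.
Proof. by have mrad := @measurable_radius R; rewrite /srate /kap; mfun. Qed.

Lemma fgain_ge0 q : 0 <= fgain q.
Proof. by rewrite !mulr_ge0 ?powR_ge0 ?(ltW Pw0)// le_max lexx orbT. Qed.

Lemma measurable_fgain : measurable_fun [set: mpt R] fgain.
Proof. by rewrite /fgain /intf_pl /px /py /pdir /pfad; mfun. Qed.

Lemma measurable_sgain : measurable_fun [set: mpt R] sgain.
Proof. by rewrite /sgain /serv_pl /hdist0 /px /py /pfad; mfun. Qed.

Lemma sgainE p : sgain p = pfad p / srate p.1.1 - N0.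
Proof.
rewrite /sgain /srate /kap /serv_pl hdist0_radius powRN.
have : 0 < (Num.max (radius p.1.1 - d) 0 ^+ 2 + h ^+ 2) `^ (alpha / 2).
  by rewrite powR_gt0// ltr_wpDl ?sqr_ge0// exprn_gt0.
by move: (_ `^ _) => X X0; field; rewrite !lt0r_neq0.
Qed.

(** Provides the hypothesis [HD] of the one-point computation: the tail at [srate z * (x + N0)]
    splits into a noise weight and an exponential in [x]. *)
Lemma intensity_serving a b x : 0 <= x ->
  mu (annulus a b `&` [set p | x <= sgain p]) =
  (\int[leb2]_z (lam0 * ((a <= radius z ^+ 2 < b)%R%:R * expR (- (srate z * N0)))
     * expR (- (srate z * x)))%:E)%E.
Proof.
move=> x0; have mrad := @measurable_radius R; have ms := measurable_srate.
have mg := measurable_sgain.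
rewrite (@intensityI_isotropic _ lam0 (ltW l0) _ (fun p => (a <= hdist0 p ^+ 2 < b) && (x <= sgain p))
   (fun z => (a <= radius z ^+ 2 < b)%R%:R * expR (- (srate z * (x + N0))))).
- apply: eq_integral => z _; congr EFin; rewrite mulrDr opprD expRD; ring.
- have mh : measurable_fun [set: mpt R] (@hdist0 R) by rewrite /hdist0 /px /py; mfun.
  by apply: mfun_and; [mfun|apply: mfun_le; mfun].
- by apply/seteqP; split => p /=; [move=> [-> ->]|move=> /andP[H1 H2]].
- move=> z th.
  have xs : 0 <= srate z * (x + N0) by rewrite mulr_ge0 ?addr_ge0// ltW// srate_gt0.
  rewrite EFinM -integral_exp_tail// -ge0_integralZl_EFin//.
  + apply: eq_integral => g _; rewrite -EFinM hdist0_radius sgainE/= /pfad/=.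
    rewrite lerBrDr ler_pdivlMr ?srate_gt0// [(x + N0) * _]mulrC.
    by rewrite -mulnb natrM mulrA.
  + by apply: measurable_funTS; exact: measurable_exp_tail.
- by mfun.
Qed.

Lemma rate_fgain u q : kap u / Pw * fgain q = kap u * (Num.max (pfad q) 0 *
  pathloss h alpha (radius (px q + d * cos (pdir q), py q + d * sin (pdir q)))).
Proof.
rewrite /fgain /pathloss /intf_pl; move: (kap _) => K.
rewrite /radius/= sqr_sqrtr ?addr_ge0 ?sqr_ge0//.
by move: (_ `^ _) (Num.max _ _) => X Y; field; exact: lt0r_neq0.
Qed.

Lemma laplace_fgain c z :
  laplace lebm (mark_density lam0) [set q | c <= hdist0 q ^+ 2] srate fgain z =
  (lam0 * (2 * pi) * fine (interf_mass h alpha d (kap (radius z)) c))%:E.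
Proof.
have k0 := ltW (kap_gt0 (radius z)).
rewrite EFinM fineK; last first.
  by rewrite ge0_fin_numE ?interf_mass_ge0// interf_mass_fin.
rewrite -(integral_interference alpha h0 d0 c (ltW l0) k0).
by apply: eq_integral => q _; rewrite /srate rate_fgain.
Qed.

(** Enlarging the exclusion disk by an annulus adds its mass and removes its share of the Laplace
    exponent. That share is an integral with weight [1 - expR (- _)], between 0 and 1, so the net
    change lies between 0 and the mass. *)
Lemma excess_homo u c c' : 0 <= c -> c <= c' ->
  excess u c <= excess u c' /\ excess u c' - excess u c <= lam0 * (pi * (c' - c)).
Proof.
move=> c0 cc; pose z : R * R := (`|u|, 0).
have W0 := fun p => mark_density_ge0 p (ltW l0).
pose F q := (1 - expR (- (kap u / Pw * fgain q))) * mark_density lam0 q.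
have e01 q : 0 <= expR (- (kap u / Pw * fgain q)) <= 1.
  by rewrite expR_ge0 -expR0 ler_expR oppr_le0 mulr_ge0 ?fgain_ge0// divr_ge0 ?(ltW Pw0)// ltW// kap_gt0.
have F0 q : 0 <= F q by rewrite mulr_ge0// subr_ge0; have /andP[] := e01 q.
have mW := measurable_mark_density lam0; have mg := measurable_fgain.
have mF : measurable_fun [set: mpt R] F by rewrite /F; mfun.
have mC a : measurable [set q : mpt R | a <= hdist0 q ^+ 2].
  by apply: measurable_pred; rewrite /hdist0 /px /py; mfun.
have k0 := ltW (kap_gt0 u).
have fin a : interf_mass h alpha d (kap u) a \is a fin_num.
  by rewrite ge0_fin_numE ?interf_mass_ge0// interf_mass_fin.
have lapE a : (\int[lebm]_(q in [set q | (a <= hdist0 q ^+ 2)%R]) (F q)%:E =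
    (lam0 * (2 * pi) * fine (interf_mass h alpha d (kap u) a))%:E)%E.
  rewrite EFinM fineK// -(integral_interference alpha h0 d0 a (ltW l0) k0).
  by apply: eq_integral => q _; rewrite -rate_fgain.
have split : (\int[lebm]_(q in [set q | (c <= hdist0 q ^+ 2)%R]) (F q)%:E =
   \int[lebm]_(q in annulus c c') (F q)%:E +
   \int[lebm]_(q in [set q | (c' <= hdist0 q ^+ 2)%R]) (F q)%:E)%E.
  rewrite -ge0_integral_setU//.
  - congr (integral _ _ _); apply/seteqP; split => q; rewrite /annulus/=.
      by move=> H; rewrite H/=; case: (ltP _ c') => H1; [left|right].
    by move=> [/andP[]//|]; apply: le_trans.
  - exact: measurable_annulus.
  - by apply/measurable_EFinP; exact: measurable_funTS.
  - by move=> q _; rewrite lee_fin.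
  - apply/disj_setPS => q [/andP[_ H1]]/=; rewrite leNgt H1.
    by [].
have le1 : (\int[lebm]_(q in annulus c c') (F q)%:E <= (lam0 * (pi * (c' - c)))%:E)%E.
  rewrite -(intensity_annulus (ltW l0) c0 cc) intensityE ?(ltW l0)//; last exact: measurable_annulus.
  apply: ge0_le_integral => //; first exact: measurable_annulus.
  - by move=> q _; rewrite lee_fin.
  - by apply/measurable_EFinP; exact: measurable_funTS.
  - by apply/measurable_EFinP; exact: measurable_funTS.
  - by move=> q _; rewrite lee_fin ler_piMl ?W0// gerBl; have /andP[] := e01 q.
have ge0 : (0 <= \int[lebm]_(q in annulus c c') (F q)%:E)%E.
  by apply: integral_ge0 => q _; rewrite lee_fin.
move: split le1 ge0; rewrite !lapE.
case: (\int[lebm]_(q in annulus c c') (F q)%:E)%E => [r||]//.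
rewrite -EFinD !lee_fin => -[E]; rewrite /excess E => H1 H2; split; lra.
Qed.

Lemma annulus_prob dT (T : measurableType dT) (Pr : probability T R)
  (Phi : T -> set (mpt R)) a b : is_PPP Pr mu Phi -> 0 <= a -> a <= b ->
  exists2 O : set T, measurable O /\ Pr O = 1%E &
    let E := O `&` one_point_event Phi (annulus 0 a) (annulus a b)
      [set q | b <= hdist0 q ^+ 2] sgain fgain in
    measurable E /\ Pr E = (\int[leb2]_z ((a <= radius z ^+ 2 < b)%R%:R *
      (lam0 * (expR (- (srate z * N0)) * expR (- excess (radius z) b))))%:E)%E.
Proof.
move=> HP a0 ab; have b0 := le_trans a0 ab.
have mrad := @measurable_radius R; have ms := measurable_srate.
have mh : measurable_fun [set: mpt R] (@hdist0 R) by rewrite /hdist0 /px /py; mfun.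
pose wt z := lam0 * ((a <= radius z ^+ 2 < b)%R%:R * expR (- (srate z * N0))).
pose U (k : nat) : set (mpt R) := annulus 0 k%:R.
pose C : set (mpt R) := [set q | b <= hdist0 q ^+ 2].
have mC : measurable C by apply: measurable_pred; mfun.
have mwt : measurable_fun [set: R * R] wt by rewrite /wt; mfun.
have wt0 z : 0 <= wt z by rewrite !mulr_ge0 ?expR_ge0// ltW.
have BD0 : annulus 0 a `&` annulus a b = set0 :> set (mpt R).
  by apply/seteqP; split => // p [/= /andP[_ H1] /andP[H2 _]]; move: H1; rewrite ltNge H2.
have BC0 : annulus 0 a `&` C = set0.
  apply/seteqP; split => // p [/= /andP[_ H1]]; rewrite /C/= => H2.
  by have := le_lt_trans (le_trans ab H2) H1; rewrite ltxx.
have DC0 : annulus a b `&` C = set0.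
  apply/seteqP; split => // p [/= /andP[_ H1]]; rewrite /C/= => H2.
  by have := le_lt_trans H2 H1; rewrite ltxx.
have mA c e := @measurable_annulus R c e.
have fA c e := @intensity_finite_annulus R lam0 (ltW l0) c e.
have fU k : (mu (C `&` U k) < +oo)%E.
  apply: le_lt_trans (fA 0 k%:R).
  have mCU : measurable (C `&` U k) by apply: measurableI => //; exact: mA.
  by apply: (le_mu (measurable_mark_density lam0) (fun p => mark_density_ge0 p (ltW l0))
    (fun A mA => intensityE (ltW l0) mA)) => // p [].
have Und k : U k `<=` U k.+1.
  by move=> p; rewrite /U /annulus/= => /andP[-> H]/=; rewrite (lt_trans H)// ltr_nat.
have Ucov p : exists k, U k p.
  by exists (Num.truncn (hdist0 p ^+ 2)).+1; rewrite /U /annulus/= sqr_ge0/= truncnS_gt.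
have HD x : 0 <= x -> mu (annulus a b `&` [set p | x <= sgain p]) =
    (\int[leb2]_z (wt z * expR (- (srate z * x)))%:E)%E := @intensity_serving a b x.
have lfin z : (laplace lebm (mark_density lam0) C srate fgain z < +oo)%E.
  by rewrite laplace_fgain ltry.
have [Om fO [mE PE]] := one_point_prob HP (measurable_mark_density lam0)
  (fun p => mark_density_ge0 p (ltW l0)) (fun A mA => intensityE (ltW l0) mA)
  (mA 0 a) (mA a b) mC (fA 0 a) (fA a b) BD0 BC0 DC0 measurable_sgain mwt wt0 ms
  (fun z => ltW (srate_gt0 z)) HD (fun k => mA _ _) fU Und Ucov measurable_fgain fgain_ge0 lfin.
exists Om => //; split => //; rewrite PE; apply: eq_integral => z _; congr EFin.
rewrite !intensity_annulus ?(ltW l0)//= laplace_fgain/= /wt /excess.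
(* The void exponents of the disk and of the annulus add up to that of the disk of squared radius
   [b], hence [excess] at [b]. *)
rewrite [expR (- (_ + lam0 * (2 * pi) * _))](_ : _ = expR (- (lam0 * (pi * (a - 0)) + lam0 * (pi * (b - a)))) *
   expR (- (lam0 * (2 * pi) * fine (interf_mass h alpha d (kap (radius z)) b)))).
  by move: (_%:R) (expR _) (expR _) (expR _) => X Y Z V; ring.
by rewrite -expRD; congr expR; ring.
Qed.

Lemma measurable_excess d' (T : measurableType d') (f c : T -> R) :
  measurable_fun [set: T] f -> measurable_fun [set: T] c ->
  measurable_fun [set: T] (fun x => excess (f x) (c x)).
Proof.
move=> mf mc; pose g (p : T * R) : \bar R := (deficit_radial h alpha d (kap (f p.1)) (c p.1) p.2)%:E.
have mk : measurable_fun [set: T * R] (fun p : T * R => kap (f p.1)).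
  by rewrite /kap; mfun; apply: (measurableT_comp mf); mfun.
have mg : measurable_fun [set: T * R] g.
  apply/measurable_EFinP; apply: measurable_deficit_radial => //.
  by apply: (measurableT_comp mc); mfun.
have g0 p : (0 <= g p)%E by rewrite lee_fin deficit_radial_ge0// ltW// kap_gt0.
have mF := measurable_fun_fubini_tonelli_F (m2:=leb) g mg g0.
have mI : measurable_fun [set: T] (fun x => fine (interf_mass h alpha d (kap (f x)) (c x))).
  by apply: mfun_fine; exact: mF.
by rewrite /excess; mfun.
Qed.

Lemma dens_ge0 u : 0 <= dens u.
Proof. by rewrite !mulr_ge0 ?expR_ge0// ltW. Qed.

Lemma measurable_dens : measurable_fun [set: R] dens.
Proof.
have me : measurable_fun [set: R] (fun u => excess u (u ^+ 2)).
  by apply: measurable_excess; mfun.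
by have mk := measurable_kap; rewrite /dens /kap; mfun.
Qed.

Lemma integral_dens :
  (\int[leb2]_z (dens (radius z))%:E = PC_formula lam0 h v alpha Pw N0 gam t)%E.
Proof.
have pi0 := @pi_gt0 R; have md := measurable_dens.
rewrite (@ge0_integral_radial _ (fun u => (dens u)%:E)); first last.
- by move=> u; rewrite lee_fin dens_ge0.
- exact/measurable_EFinP.
pose H u := 2 * pi * (u * dens u).
have mH : measurable_fun [set: R] (fun u => (H u)%:E).
  by apply/measurable_EFinP; apply: mfun_mul; mfun; apply: mfun_mul; mfun.
have H0 u : 0 <= u -> 0 <= H u by move=> u0; rewrite !mulr_ge0 ?dens_ge0// ltW.
transitivity (\int[leb]_(u in `[0%R, +oo[%classic) (H u)%:E)%E.
  rewrite [RHS](integral_indicator_set leb (b := fun u => 0 <= u)); last first.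
    by move=> u; rewrite /= in_itv/= andbT.
  rewrite -ge0_integralZl_EFin ?mulr_ge0// ?(ltW pi0)//.
  - apply: eq_integral => u _; rewrite -!EFinM; congr EFin; rewrite /H.
    by move: (_%:R) => X; ring.
  - move=> u _; rewrite lee_fin mulr_ge0 ?dens_ge0//.
    by case: (leP 0 u) => u0; rewrite ?mulr1 ?mulr0.
  - apply/measurable_EFinP; apply: mfun_mul => //; apply: mfun_mul; first by mfun.
    by apply: mfun_bool; apply: mfun_le; mfun.
have -> : (`[0%R, +oo[%classic : set R) = `[0%R, d[%classic `|` `[d, +oo[%classic.
  apply/seteqP; split => u /=; rewrite !in_itv/= !andbT.
    by move=> u0; case: (ltP u d) => ud; [left; rewrite u0|right].
  by move=> [/andP[]//|]; exact: le_trans.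
rewrite ge0_integral_setU//=; last 3 first.
- exact: measurable_funTS.
- move=> u; rewrite /= !in_itv/= andbT => -[/andP[u0 _]|u0]; rewrite lee_fin H0//.
  exact: le_trans u0.
- apply/disj_setPS => u [/=]; rewrite !in_itv/= andbT => /andP[_ H1] H2.
  by move: H1; rewrite ltNge H2.
have near u : 0 <= u < d -> H u = 2 * pi * lam0 * u *
    expR (- (pi * lam0 * u ^+ 2) - gam * h `^ alpha / Pw * N0
               - 2 * pi * lam0 * calA h v alpha gam t u).
  move=> ud; have kE : kap u = gam * h `^ alpha.
    (* Below [d] the serving station has already stopped above the user. *)
    rewrite /kap max_r; last by rewrite subr_le0 ltW//; case/andP: ud.
    rewrite expr0n/= add0r -powR_mulrn ?(ltW h0)// -powRrM mulrCA mulfV ?mulr1//.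
  rewrite /H /dens -expRD /excess kE interference_calA//.
  set e1 := expR _; set e2 := expR _; have -> : e1 = e2 by rewrite /e1 /e2; congr expR; ring.
  by ring.
have far u : d <= u -> H u = 2 * pi * lam0 * u *
    expR (- (pi * lam0 * u ^+ 2) - gam * ((u - d) ^+ 2 + h ^+ 2) `^ (alpha / 2) / Pw * N0
               - 2 * pi * lam0 * calB h v alpha gam t u).
  move=> ud; have kE : kap u = gam * ((u - d) ^+ 2 + h ^+ 2) `^ (alpha / 2).
    by rewrite /kap max_l// subr_ge0.
  rewrite /H /dens -expRD /excess kE interference_calB//.
  set e1 := expR _; set e2 := expR _; have -> : e1 = e2 by rewrite /e1 /e2; congr expR; ring.
  by ring.
congr (_ + _)%E.
  (* [interference_calA] covers [u < d] only; the endpoint [d] is a null set. *)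
  rewrite -integral_itv_bndo_bndc; last first.
    apply: (eq_measurable_fun (fun u => (H u)%:E)); last exact: measurable_funTS.
    by move=> u; rewrite mem_setE in_itv/= => ud; rewrite near.
  by apply: eq_integral => u; rewrite mem_setE in_itv/= => ud; rewrite near.
by apply: eq_integral => u; rewrite mem_setE in_itv/= andbT => ud; rewrite far.
Qed.

End Model.

(** * Coverage probability *)

Section AlmostSure.
Context {R : realType} d (T : measurableType d) (Pr : probability T R).
Variables (lam0 : R) (Phi : T -> set (mpt R)).
Hypotheses (l0 : 0 < lam0) (HP : is_PPP Pr (intensity lam0) Phi).
Local Notation leb := (@lebesgue_measure R).
Local Notation mu := (intensity lam0).

(** Gains are integrated over [g >= 0], where only the null set of [g = 0] remains. *)
Lemma intensity_fading_le0 : mu [set p | pfad p <= 0] = 0%E.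
Proof.
rewrite (@intensityI_isotropic _ _ (ltW l0) _ (fun p => pfad p <= 0) (fun=> 0))//.
- by rewrite integral0_eq// => z _; rewrite mulr0.
- by rewrite /pfad; apply: mfun_le; mfun.
move=> z th; rewrite -[RHS](@integral_set1 _ (fun g : R => (expR (- g))%:E) 0).
rewrite (integral_indicator_set leb (b := fun g => 0 <= g)); last first.
  by move=> g; rewrite /= in_itv/= andbT.
rewrite [RHS](integral_indicator_set leb (b := fun g => g == 0)); last first.
  by move=> u; split=> [->|/eqP->].
apply: eq_integral => g _; congr EFin; rewrite /pfad/= eq_le.
by case: (0 <= g); case: (g <= 0); rewrite ?mul1r ?mul0r ?mulr0.
Qed.

Lemma fading_gt0_as : measurable [set w | npts Phi w [set p | pfad p <= 0] = 0%:E] /\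
  Pr [set w | npts Phi w [set p | pfad p <= 0] = 0%:E] = 1%E.
Proof.
have mA : measurable [set p : mpt R | pfad p <= 0].
  by apply: measurable_pred; rewrite /pfad; apply: mfun_le; mfun.
have fA : (mu [set p | (pfad p <= 0)%R] < +oo)%E by rewrite intensity_fading_le0.
have [m ->] := PPP_count HP 0 mA fA; split => //.
by rewrite intensity_fading_le0/= /pois oppr0 expR0 expr0 mulr1 divr1.
Qed.

(** The annulus from [n] to [n + k] is empty with probability [expR (- (lam0 * pi * k))], which
    tends to 0. *)
Lemma far_points_as (n : nat) : exists2 O : set T, measurable O /\ Pr O = 1%E &
  forall w, O w -> exists2 p, Phi w p & n%:R <= hdist0 p ^+ 2.
Proof.
pose Z (k : nat) := [set w | npts Phi w (annulus n%:R (n + k)%:R) = 0%:E].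
have ZP k := PPP_count HP 0 (@measurable_annulus R n%:R (n + k)%:R)
  (@intensity_finite_annulus R lam0 (ltW l0) n%:R (n + k)%:R).
have mZ k : measurable (Z k) := (ZP k).1.
have PZ k : Pr (Z k) = (expR (- (lam0 * pi * k%:R)))%:E.
  rewrite (ZP k).2 intensity_annulus ?(ltW l0) ?ler_nat ?leq_addr// /pois expr0 mulr1 divr1/=.
  by rewrite natrD [_ + _ - _]addrAC subrr add0r mulrA.
have mZZ : measurable (\bigcap_k Z k) by exact: bigcapT_measurable.
exists (~` (\bigcap_k Z k)).
  split; first exact: measurableC.
  rewrite probability_setC//; suff -> : Pr (\bigcap_k Z k) = 0%E by rewrite sube0.
  apply/eqP; rewrite eq_le measure_ge0 andbT.
  have lp : 0 < lam0 * pi by rewrite mulr_gt0// pi_gt0.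
  have le k : (Pr (\bigcap_k Z k) <= (expR (- (lam0 * pi * k%:R)))%:E)%E.
    by rewrite -PZ; apply: (le_measure Pr (mem_set mZZ) (mem_set (mZ k))) => w; apply.
  have cv : (fun k : nat => expR (- (lam0 * pi * k%:R))) @ \oo --> (0 : R).
    have e0 : `|expR (- (lam0 * pi))| < 1.
      by rewrite ger0_norm ?expR_ge0// -expR0 ltr_expR oppr_lt0.
    under eq_fun do rewrite -mulNr expRM_natr.
    exact: cvg_expr.
  have cvE : (fun k : nat => (expR (- (lam0 * pi * k%:R)))%:E) @ \oo --> 0%:E.
    by apply/fine_cvgP; split; [exact: nearW|exact: cv].
  rewrite -[leRHS](cvg_lim (@ereal_hausdorff R) cvE).
  by apply: lime_ge; [apply/cvg_ex; eexists; exact: cvE|exact: nearW].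
move=> w /= H; apply: contrapT => H'; apply: H => k _ /=; apply/counting_eq0.
apply/seteqP; split => // p [Pp /andP[Hp _]]; apply: H'; exists p => //.
Qed.

(* Almost surely all gains are positive and there are points arbitrarily far
   away, hence the interference is positive even when [N0 = 0]. *)
Definition regular (C : set (mpt R)) : Prop :=
  (forall p, C p -> 0 < pfad p) /\
  (forall n : nat, exists2 p, C p & n%:R <= hdist0 p ^+ 2).

Lemma regular_as : exists2 O : set T, measurable O /\ Pr O = 1%E &
  forall w, O w -> regular (Phi w).
Proof.
have [mF PF] := fading_gt0_as.
pose F0 := [set w | npts Phi w [set p | (pfad p <= 0)%R] = 0%:E].
pose O (n : nat) := sval (cid2 (far_points_as n)).
have OP n : (measurable (O n) /\ Pr (O n) = 1%E) /\
    forall w, O n w -> exists2 p, Phi w p & n%:R <= hdist0 p ^+ 2.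
  by rewrite /O; case: cid2.
have [mO PO] := probability_bigcap_full (fun n => (OP n).1).
exists (F0 `&` \bigcap_n O n).
  split; first exact: measurableI.
  by rewrite (probability_setI_full mF mO PF).
move=> w [/counting_eq0 fw Ow]; split => [p Pp|n].
  rewrite ltNge; apply/negP => H.
  by have : (Phi w `&` [set p | pfad p <= 0]) p by []; rewrite fw.
by apply: (OP n).2; exact: Ow.
Qed.

End AlmostSure.

(** * Coverage of a configuration as a bound on the interference *)

Section SINREvent.
Context {R : realType}.
Variables (h v alpha Pw N0 gam t : R).
Hypotheses (h0 : 0 < h) (Pw0 : 0 < Pw) (N00 : 0 <= N0) (gam0 : 0 < gam).
Local Notation SINR := (SINR h v alpha Pw N0 t).
Local Notation gain := (fgain h v alpha Pw t).
Local Notation sgain := (sgain h v alpha Pw N0 gam t).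

Lemma intf_pl_gt0 q : 0 < intf_pl h v alpha t q.
Proof. by rewrite powR_gt0// ltr_wpDl ?addr_ge0 ?sqr_ge0// exprn_gt0. Qed.

Lemma serving_unique (C : set (mpt R)) p q : serving C p -> serving C q -> p = q.
Proof.
move=> [Cp Hp] [Cq Hq]; apply: contrapT => pq.
have H1 := Hp q Cq (fun e => pq (esym e)); have H2 := Hq p Cp pq.
by have := lt_trans H1 H2; rewrite ltxx.
Qed.

Lemma SINR_serving (C : set (mpt R)) p : serving C p ->
  SINR C = let I := interference h v alpha Pw t C p in
    if (I \is a fin_num)%E then
      Pw * pfad p * serv_pl h v alpha t p / (fine I + N0)
    else 0.
Proof.
move=> Cp; rewrite /Defs.SINR.
have -> : xget (mpt0 R) (serving C) = p by apply: xget_unique => // q Cq; exact: serving_unique Cq Cp.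
by rewrite asboolT.
Qed.

(** The isolated point [p] is the serving one and all others lie beyond [b]. Clearing the positive
    denominator gives the bound by [sgain p]. *)
Lemma SINR_ge (C : set (mpt R)) a b p : 0 <= b -> regular C ->
  C `&` annulus 0 a = set0 -> C `&` annulus a b = [set p] ->
  (gam <= SINR C) <->
  (\esum_(q in C `&` [set q | (b <= hdist0 q ^+ 2)%R]) (gain q)%:E <= (sgain p)%:E)%E.
Proof.
move=> b0 [Cpos Cfar] C0 Cp.
have [Cpp /andP[ap pb]] : (C `&` annulus a b) p by rewrite Cp.
have far q : C q -> q <> p -> b <= hdist0 q ^+ 2.
  move=> Cq qp; rewrite leNgt; apply/negP => qb.
  have [qa|qa] := ltP (hdist0 q ^+ 2) a.
    have : (C `&` annulus 0 a) q by split => //; rewrite /annulus/= sqr_ge0.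
    by rewrite C0.
  have : (C `&` annulus a b) q by split => //; rewrite /annulus/= qa.
  by rewrite Cp.
have Csub : C `\ p = C `&` [set q | b <= hdist0 q ^+ 2].
  apply/seteqP; split => q /= [Cq H]; split => //; first exact: far.
  by move=> qp; move: H; rewrite qp leNgt pb.
have hd0 q : 0 <= hdist0 q :> R by exact: sqrtr_ge0.
have sp : serving C p.
  split => // q Cq qp; rewrite -(@ltr_pXn2r _ 2)// ?nnegrE//.
  exact: lt_le_trans (far _ Cq qp).
rewrite (SINR_serving sp)/= /interference Csub.
have -> : (\esum_(q in C `&` [set q | (b <= hdist0 q ^+ 2)%R]) (Pw * pfad q * intf_pl h v alpha t q)%:E =
  \esum_(q in C `&` [set q | (b <= hdist0 q ^+ 2)%R]) (gain q)%:E)%E.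
  apply: eq_esum => q [Cq _]; congr (_ * _ * _)%:E.
  by rewrite max_l// ltW// Cpos.
set I := esum _ _.
(* For [N0 = 0] a vanishing interference would make the quotient 0 by the convention on division; a
   far point with positive gain rules this out. *)
have Igt0 : (0 < I)%E.
  have [q Cq Hq] := Cfar (Num.truncn b).+1.
  have bq : b <= hdist0 q ^+ 2 by apply: le_trans Hq; rewrite ltW// truncnS_gt.
  apply: (@lt_le_trans _ _ (gain q)%:E).
    rewrite lte_fin /fgain max_l ?(ltW (Cpos _ Cq))//.
    by rewrite !mulr_gt0// ?Cpos// intf_pl_gt0.
  apply: esum_ge; exists [set q]; last by rewrite fsbig_set1.
  by split; [exact: finite_set1|move=> _ ->].
have [Ifin|Ifin] := boolP (I \is a fin_num).
  have I0 : 0 < fine I by rewrite fine_gt0// Igt0 ltey_eq Ifin.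
  have IN : 0 < fine I + N0 by rewrite ltr_wpDr.
  rewrite ler_pdivlMr// -{2}(fineK Ifin) lee_fin /sgain lerBrDr ler_pdivlMr//.
  by rewrite mulrC.
(* Infinite interference: the SINR is 0 by convention, below [gam], and the bound on the right fails
   too. *)
split=> [|H]; first by rewrite leNgt gam0.
have := le_lt_trans H (ltry _); rewrite -ge0_fin_numE; last exact: ltW.
by rewrite (negbTE Ifin).
Qed.

End SINREvent.

Section AnnulusBounds.
Context {R : realType}.
Variables (lam0 h v alpha Pw N0 gam t : R).
Hypotheses (l0 : 0 < lam0) (h0 : 0 < h) (v0 : 0 < v) (Pw0 : 0 < Pw)
  (alpha2 : 2 < alpha) (t0 : 0 <= t) (gam0 : 0 < gam).
Local Notation leb := (@lebesgue_measure R).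
Local Notation leb2 := (leb \x leb)%E.
Local Notation dens := (dens lam0 h v alpha Pw N0 gam t).

Let sandwich (X Y : R * R -> R) (c : R) : 0 <= c ->
  measurable_fun [set: R * R] X -> measurable_fun [set: R * R] Y ->
  (forall z, 0 <= X z) -> (forall z, c * X z <= Y z <= X z) ->
  (\int[leb2]_z (Y z)%:E <= \int[leb2]_z (X z)%:E)%E /\
  (c%:E * \int[leb2]_z (X z)%:E <= \int[leb2]_z (Y z)%:E)%E.
Proof.
move=> c0 mX mY X0 XY.
have Y0 z : 0 <= Y z by have /andP[+ _] := XY z; apply: le_trans; rewrite mulr_ge0.
have mXE : measurable_fun [set: R * R] (fun z => (X z)%:E) by exact/measurable_EFinP.
have mYE : measurable_fun [set: R * R] (fun z => (Y z)%:E) by exact/measurable_EFinP.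
have mcE : measurable_fun [set: R * R] (fun z => (c * X z)%:E).
  by apply/measurable_EFinP; apply: mfun_mul => //; mfun.
have X0E z : setT z -> (0 <= (X z)%:E)%E by rewrite lee_fin.
have Y0E z : setT z -> (0 <= (Y z)%:E)%E by rewrite lee_fin.
split.
  apply: (ge0_le_integral leb2 measurableT Y0E mYE mXE) => z _.
  by rewrite lee_fin; have /andP[] := XY z.
rewrite -(ge0_integralZl_EFin leb2 measurableT X0E mXE c0).
apply: (@ge0_le_integral _ _ _ leb2 setT measurableT (fun z => (c * X z)%:E) (fun z => (Y z)%:E) _ mcE mYE).
  by move=> z _; rewrite lee_fin mulr_ge0.
by move=> z _; rewrite lee_fin; have /andP[] := XY z.
Qed.

(* On the annulus [a <= radius ^ 2 < b] replacing the exclusion radius by the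
   outer radius costs at most a factor [expR (- c)], [c] the mean number of points. *)
Lemma annulus_integral_bounds a b : a <= b ->
  let X z := (a <= radius z ^+ 2 < b)%R%:R * dens (radius z) in
  let Y z := (a <= radius z ^+ 2 < b)%R%:R * (lam0 *
    (expR (- (srate h v alpha Pw gam t z * N0)) * expR (- excess lam0 h v alpha gam t (radius z) b))) in
  (\int[leb2]_z (Y z)%:E <= \int[leb2]_z (X z)%:E)%E /\
  ((expR (- (lam0 * (pi * (b - a)))))%:E * \int[leb2]_z (X z)%:E <= \int[leb2]_z (Y z)%:E)%E.
Proof.
move=> ab X Y; have mrad := @measurable_radius R.
have d0 u : 0 <= dens u := dens_ge0 h v alpha Pw N0 gam t l0 u.
apply: sandwich; rewrite ?expR_ge0//.
- apply: mfun_mul; first by mfun.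
  by apply: (measurableT_comp (measurable_dens lam0 v alpha Pw N0 t h0 gam0)).
- have me : measurable_fun [set: R * R] (fun z : R * R => excess lam0 h v alpha gam t (radius z) b).
    by apply: measurable_excess => //; mfun.
  have ms := @measurable_srate R h v alpha Pw gam t.
  by apply: mfun_mul; mfun.
- by move=> z; rewrite mulr_ge0.
move=> z; rewrite /X /Y; case: (boolP (_ <= _ < _)) => [/andP[z1 z2]|_]; last by rewrite !mul0r mulr0 lexx.
have [H1 H2] := excess_homo l0 h0 v0 Pw0 alpha2 t0 gam0 (radius z) (sqr_ge0 (radius z)) (ltW z2).
have gen (l x e y y' : R) : 0 <= l -> 0 <= x -> e * y <= y' -> y' <= y ->
    e * (l * (x * y)) <= l * (x * y') <= l * (x * y).
  by move=> l1 x1 H H'; rewrite mulrCA [e * (x * y)]mulrCA !ler_wpM2l.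
rewrite !mul1r; apply: (gen _ _ _ (expR (- excess lam0 h v alpha gam t (radius z) (radius z ^+ 2)))).
- exact: ltW.
- exact: expR_ge0.
- rewrite -expRD ler_expR -opprD lerN2.
  have : lam0 * (pi * (b - radius z ^+ 2)) <= lam0 * (pi * (b - a)).
    by rewrite ler_pM2l// ler_pM2l ?pi_gt0// lerB.
  by move: H2; lra.
- by rewrite ler_expR lerN2.
Qed.

End AnnulusBounds.

(** * Summation over the annuli *)

Section Coverage.
Context {R : realType} d (T : measurableType d) (Pr : probability T R).
Variables (lam0 h v alpha Pw N0 gam t : R) (Phi : T -> set (mpt R)).
Hypotheses (l0 : 0 < lam0) (h0 : 0 < h) (v0 : 0 < v) (Pw0 : 0 < Pw) (N00 : 0 <= N0)
  (alpha2 : 2 < alpha) (t0 : 0 <= t) (gam0 : 0 < gam).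
Hypothesis HP : is_PPP Pr (intensity lam0) Phi.
Local Notation leb := (@lebesgue_measure R).
Local Notation leb2 := (leb \x leb)%E.
Local Notation mu := (intensity lam0).
Local Notation SINR := (SINR h v alpha Pw N0 t).
Local Notation dens := (dens lam0 h v alpha Pw N0 gam t).
Let S := [set w | gam <= SINR (Phi w)].
Hypothesis mS : measurable S.

Let PC := (\int[leb2]_z (dens (radius z))%:E)%E.

Variable c : R.
Hypothesis c0 : 0 < c.
(* Width of the annuli in squared distance: each has intensity [c]. *)
Let w0 := c / (lam0 * pi).

Let lp : 0 < lam0 * pi.
Proof. by rewrite mulr_gt0// pi_gt0. Qed.

Let w00 : 0 < w0. Proof. by rewrite divr_gt0. Qed.

Let lo (j : nat) := j%:R * w0.

Let lo_ge0 j : 0 <= lo j. Proof. by rewrite mulr_ge0// ltW. Qed.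

Let lo_lt j k : (j < k)%N -> lo j < lo k.
Proof. by move=> jk; rewrite /lo ltr_pM2r// ltr_nat. Qed.

Let lo_le j k : (j <= k)%N -> lo j <= lo k.
Proof. by move=> jk; rewrite /lo ler_pM2r// ler_nat. Qed.

Let event j := one_point_event Phi (annulus 0 (lo j)) (annulus (lo j) (lo j.+1))
  [set q | lo j.+1 <= hdist0 q ^+ 2] (sgain h v alpha Pw N0 gam t) (fgain h v alpha Pw t).

Let single j := [set w | npts Phi w (annulus 0 (lo j)) = 0%:E /\
  npts Phi w (annulus (lo j) (lo j.+1)) = 1%:E].

Let lo_mass j : lam0 * (pi * (lo j - 0)) = c * j%:R.
Proof.
by rewrite subr0 mulrA /lo mulrCA /w0 [_ * (c / _)]mulrC divfK ?lt0r_neq0// mulrC.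
Qed.

Let ann_mass j : lam0 * (pi * (lo j.+1 - lo j)) = c.
Proof.
by rewrite mulrA /lo -natr1 mulrDl mul1r [_ + w0]addrC addrK /w0 mulrC divfK ?lt0r_neq0.
Qed.

Let single_prob j : measurable (single j) /\
  Pr (single j) = (c * expR (- c) * expR (- c) ^+ j)%:E.
Proof.
pose A (b : bool) := if b then annulus 0 (lo j) else annulus (lo j) (lo j.+1) : set (mpt R).
have mA b : measurable (A b) by rewrite /A; case: b; exact: measurable_annulus.
have fA b : (mu (A b) < +oo)%E.
  by rewrite /A; case: b; apply: intensity_finite_annulus; exact: ltW.
have AA : A true `&` A false = set0.
  apply/seteqP; split => // p [/andP[_ H1] /andP[H2 _]].
  by move: H1; rewrite ltNge H2.
have dA a b : a != b -> A a `&` A b = set0.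
  by case: a; case: b => // _; rewrite // setIC.
have := PPP_fin HP (fun b : bool => (~~ b : nat)) mA fA dA.
have -> : [set w | forall b, npts Phi w (A b) = (~~ b : nat)%:R%:E] = single j.
  apply/seteqP; split => w /=; first by move=> H; split; [exact: (H true)|exact: (H false)].
  by move=> [H1 H2] [].
rewrite big_bool/= !intensity_annulus ?(ltW l0)//; last exact: lo_le.
rewrite lo_mass ann_mass => -[mm ->]; split => //; congr EFin.
rewrite /pois/= expr0 expr1 mulr1 !divr1 -expRM_natr mulNr; ring.
Qed.

Let event_single j : event j `<=` single j.
Proof. by move=> w [H [p Dp _]]; split => //; apply/counting_eq1; exists p. Qed.

(** The point isolated by the inner annulus would lie in the disk that the outer event requires to
    be empty. *)
Let single_disj : trivIset setT single.
Proof.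
apply/trivIsetP => j k _ _; wlog jk : j k / (j < k)%N.
  move=> H; rewrite neq_ltn => /orP[jk|jk]; first by apply: H => //; rewrite neq_ltn jk.
  by rewrite setIC; apply: H => //; rewrite neq_ltn jk.
move=> _; apply/seteqP; split => // w [[_ /counting_eq1[p Hp]] [/counting_eq0 H0 _]].
have [Pp /andP[_ pk]] : (Phi w `&` annulus (lo j) (lo j.+1)) p by rewrite Hp.
have : (Phi w `&` annulus 0 (lo k)) p.
  by split => //; rewrite /annulus/= sqr_ge0 (lt_le_trans pk)// lo_le.
by rewrite H0.
Qed.

(** Each annulus comes with its own almost sure event; a countable intersection yields one that
    serves all annuli and makes the configuration regular. *)
Let good_ex : exists2 O : set T, measurable O /\ Pr O = 1%E &
  (forall w, O w -> regular (Phi w)) /\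
  forall j, measurable (O `&` event j) /\ Pr (O `&` event j) =
    (\int[leb2]_z ((lo j <= radius z ^+ 2 < lo j.+1)%R%:R *
      (lam0 * (expR (- (srate h v alpha Pw gam t z * N0)) * expR (- excess lam0 h v alpha gam t (radius z) (lo j.+1)))))%:E)%E.
Proof.
have [G1 [mG1 PG1] G1P] := regular_as l0 HP.
have H j := annulus_prob l0 h0 v0 Pw0 N00 alpha2 t0 gam0 HP (lo_ge0 j) (ltW (lo_lt (ltnSn j))).
pose G (n : nat) := sval (cid2 (H n)).
have GP n : (measurable (G n) /\ Pr (G n) = 1%E) /\
    (measurable (G n `&` event n) /\ Pr (G n `&` event n) =
    (\int[leb2]_z ((lo n <= radius z ^+ 2 < lo n.+1)%R%:R *
      (lam0 * (expR (- (srate h v alpha Pw gam t z * N0)) * expR (- excess lam0 h v alpha gam t (radius z) (lo n.+1)))))%:E)%E).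
  by rewrite /G; case: cid2.
have [mG PG] := probability_bigcap_full (fun n => (GP n).1).
have mGG : measurable (G1 `&` \bigcap_n G n) by exact: measurableI.
have PGG : Pr (G1 `&` \bigcap_n G n) = 1%E by rewrite (probability_setI_full mG1 mG PG1).
exists (G1 `&` \bigcap_n G n) => //; split => [w [Gw _]|j]; first exact: G1P.
have -> : (G1 `&` \bigcap_n G n) `&` event j = (G1 `&` \bigcap_n G n) `&` (G j `&` event j).
  apply/seteqP; split => w [Gw]; last by case.
  by move=> Ew; split => //; split => //; exact: Gw.2.
have [mE PE] := (GP j).2.
split; first exact: measurableI.
by rewrite (probability_setI_full mGG mE PGG).
Qed.

(* Squeezes the coverage probability: the event of a unique nearest station in
   its annulus fails with probability at most [1 - expR (- c)]. *)
Lemma coverage_squeeze : ((expR (- c))%:E * PC <= Pr S <= PC + (1 - expR (- c))%:E)%E.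
Proof.
have [G [mG PG] [Greg GE]] := good_ex.
pose E j := G `&` event j.
have mE j : measurable (E j) := (GE j).1.
have tE : trivIset setT E.
  apply/trivIsetP => j k _ _ jk; move/trivIsetP : single_disj => /(_ j k I I jk) H.
  apply/seteqP; split => // w [[_ /event_single H1] [_ /event_single H2]].
  by have : (single j `&` single k) w by []; rewrite H.
have mEU : measurable (\bigcup_j E j) by exact: bigcup_measurable.
have PEU : Pr (\bigcup_j E j) = (\sum_(j <oo) Pr (E j))%E by exact: measure_semi_bigcup.
have mSi j : measurable (single j) := (single_prob j).1.
have mSU : measurable (\bigcup_j single j) by exact: bigcup_measurable.
have SE w : G w -> forall j, single j w -> S w <-> event j w.
  move=> Gw j [/counting_eq0 H0 /counting_eq1[p Hp]].
  have := SINR_ge v alpha t h0 Pw0 N00 gam0 (lo_ge0 j.+1) (Greg _ Gw) H0 Hp.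
  move=> [K1 K2]; split.
    by move=> /K1 K; split; [apply/counting_eq0|exists p].
  move=> [_ [q Hq K]]; apply: K2.
  suff -> : p = q by [].
  by have : [set q] p by rewrite -Hq Hp.
have ES : \bigcup_j E j `<=` S.
  by move=> w [j _ [Gw Ew]]; apply/(SE w Gw j) => //; exact: event_single.
(* Coverage can escape the summed events only if no annulus isolates the nearest point. *)
have SSub : G `&` S `<=` \bigcup_j E j `|` ~` \bigcup_j single j.
  move=> w [Gw Sw]; case: (pselect ((\bigcup_j single j) w)) => [[j _ Hj]|H]; [left|by right].
  by exists j => //; split => //; exact/(SE w Gw j).
(* The geometric series sums to [c * expR (- c) / (1 - expR (- c))], and [1 - expR (- c) <= c]. *)
have PSU : ((expR (- c))%:E <= Pr (\bigcup_j single j))%E.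
  rewrite measure_semi_bigcup//.
  rewrite (eq_eseriesr (fun j _ => (single_prob j).2)).
  have e1 : `|expR (- c)| < 1 by rewrite ger0_norm ?expR_ge0// -expR0 ltr_expR oppr_lt0.
  have cvg := @cvg_geometric_series _ (c * expR (- c)) _ e1.
  have -> : (\sum_(j <oo) (c * expR (- c) * expR (- c) ^+ j)%:E = (c * expR (- c) / (1 - expR (- c)))%:E)%E.
    rewrite -(cvg_lim (@Rhausdorff R) cvg) -EFin_lim; last by apply/cvg_ex; eexists; exact: cvg.
    by congr (limn _); apply/funext => n; rewrite /= sumEFin.
  have e2 : 0 < 1 - expR (- c) by rewrite subr_gt0 -expR0 ltr_expR oppr_lt0.
  rewrite lee_fin ler_pdivlMr// mulrC ler_wpM2r ?expR_ge0//.
  by have := expR_ge1Dx (- c); lra.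
have PCE : PC = (\sum_(j <oo) \int[leb2]_z ((lo j <= radius z ^+ 2 < lo j.+1)%R%:R * dens (radius z))%:E)%E.
  have mrad := @measurable_radius R.
  pose F j := [set z : R * R | lo j <= radius z ^+ 2 < lo j.+1].
  have mF j : measurable (F j) by apply: measurable_pred; mfun.
  have FU : \bigcup_j F j = setT.
    apply/seteqP; split => // z _; exists (Num.truncn (radius z ^+ 2 / w0)) => //.
    have := truncn_itv (divr_ge0 (sqr_ge0 (radius z)) (ltW w00)).
    by rewrite /F/= /lo ler_pdivlMr// ltr_pdivrMr.
  have tF : trivIset setT F.
    apply/trivIsetP => j k _ _ jk; apply/seteqP; split => // z [] /=.
    wlog lt_jk : j k jk / (j < k)%N.
      move=> H H1 H2; move: jk; rewrite neq_ltn => /orP[jk|jk]; first by apply: (H j k) => //; rewrite neq_ltn jk.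
      by apply: (H k j) => //; rewrite neq_ltn jk.
    move=> /andP[_ H1] /andP[H2 _].
    by have := lt_le_trans H1 (le_trans (lo_le lt_jk) H2); rewrite ltxx.
  have md : measurable_fun [set: R * R] (fun z => (dens (radius z))%:E).
    apply/measurable_EFinP; by apply: (measurableT_comp (measurable_dens lam0 v alpha Pw N0 t h0 gam0)).
  rewrite /PC -[in LHS]FU ge0_integral_bigcup//; last first.
  - by move=> z _; rewrite lee_fin; exact: dens_ge0.
  - by rewrite FU.
  apply: eq_eseriesr => j _.
  exact: (@integral_indicator_set R _ (measurableTypeR R * measurableTypeR R)%type leb2 (F j)
    (fun z => lo j <= radius z ^+ 2 < lo j.+1) (fun z => dens (radius z)) (fun z => conj id id)).
have bd j := annulus_integral_bounds N0 l0 h0 v0 Pw0 alpha2 t0 gam0 (ltW (lo_lt (ltnSn j))).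
have I0 j : (0 <= \int[leb2]_z ((lo j <= radius z ^+ 2 < lo j.+1)%R%:R * dens (radius z))%:E)%E.
  by apply: integral_ge0 => z _; rewrite lee_fin mulr_ge0//; exact: dens_ge0.
have up : (Pr (\bigcup_j E j) <= PC)%E.
  rewrite PEU PCE; apply: lee_nneseries => [j _ _|j _]; first exact: measure_ge0.
  by rewrite (GE j).2; exact: (bd j).1.
have dn : ((expR (- c))%:E * PC <= Pr (\bigcup_j E j))%E.
  rewrite PEU PCE -nneseriesZl; last by move=> j _; exact: I0.
  apply: lee_nneseries => [j _ _|j _].
    by rewrite mule_ge0 ?lee_fin ?expR_ge0//; exact: I0.
  by rewrite (GE j).2; have := (bd j).2; rewrite ann_mass.
apply/andP; split.
  by apply: (le_trans dn); apply: (le_measure Pr (mem_set mEU) (mem_set mS)).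
rewrite -(probability_setI_full mG mS PG).
have mcU : measurable (~` \bigcup_j single j) by exact: measurableC.
have mGS : measurable (G `&` S) by exact: measurableI.
have mR : measurable (\bigcup_j E j `|` ~` \bigcup_j single j) by exact: measurableU.
apply: (le_trans (le_measure Pr (mem_set mGS) (mem_set mR) SSub)).
apply: (le_trans (measureU2 Pr mEU mcU)); apply: leeD => //.
have PC1 : Pr (~` \bigcup_j single j) = (1 - Pr (\bigcup_j single j))%E by exact: probability_setC.
apply: (@le_trans _ _ (1 - Pr (\bigcup_j single j))%E).
  by rewrite le_eqVlt; apply/orP; left; apply/eqP; exact: PC1.
have : Pr (\bigcup_j single j) \is a fin_num by exact: fin_num_measure.
move: PSU; case: (Pr (\bigcup_j single j)) => [r||]//.
by rewrite -EFinB !lee_fin => H _; rewrite lerB.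
Qed.

End Coverage.

Lemma coverage (R : realType) d (T : measurableType d) (Pr : probability T R)
  (lam0 h v alpha Pw N0 gam t : R) (Phi : T -> set (mpt R)) :
  0 < lam0 -> 0 < h -> 0 < v -> 0 < Pw -> 0 <= N0 -> 2 < alpha -> 0 <= t -> 0 < gam ->
  is_PPP Pr (intensity lam0) Phi ->
  measurable [set w | gam <= SINR h v alpha Pw N0 t (Phi w)] ->
  Pr [set w | gam <= SINR h v alpha Pw N0 t (Phi w)] =
  PC_formula lam0 h v alpha Pw N0 gam t.
Proof.
move=> l0 h0 v0 Pw0 N00 alpha2 t0 gam0 HP mS.
rewrite -integral_dens//.
have H c (c0 : 0 < c) := coverage_squeeze l0 h0 v0 Pw0 N00 alpha2 t0 gam0 HP mS c0.
have fS : Pr [set w | gam <= SINR h v alpha Pw N0 t (Phi w)] \is a fin_num.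
  exact: fin_num_measure.
move: H fS; set X := (\int[_]_z _)%E; move: (Pr _) => Y H.
have X0 : (0 <= X)%E by apply: integral_ge0 => z _; rewrite lee_fin dens_ge0.
case: Y H => [y||]// H _; case: X X0 H => [x||]//; last first.
  (* An infinite integral would contradict the lower half of the squeeze, here with [c = 1]. *)
  move=> _ /(_ 1 ltr01) /andP[+ _].
  by rewrite gt0_muley ?lte_fin ?expR_gt0.
rewrite lee_fin => x0 H; congr EFin.
(* Linearizes the squeeze by [1 - c <= expR (- c)]; neither [x] nor [y] depends on [c], which is
   then made small. *)
have HH c : 0 < c -> x - c * x <= y /\ y <= x + c.
  move=> c0; have /andP[] := H c c0; rewrite -EFinM -EFinD !lee_fin => H1 H2.
  have e1 := expR_ge1Dx (- c); split.
    by apply: le_trans H1; rewrite -[leLHS]mul1r; nra.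
  by apply: (le_trans H2); rewrite lerD2l; lra.
apply/eqP; rewrite eq_le; apply/andP; split.
  by apply/ler_addgt0Pr => e e0; exact: (HH e e0).2.
apply/ler_addgt0Pr => e e0.
have x1 : 0 < x + 1 by rewrite ltr_wpDl.
(* This choice makes [c * x] at most [e]; the added 1 covers [x = 0]. *)
have [H1 _] := HH (e / (x + 1)) (divr_gt0 e0 x1).
rewrite -lerBlDr; apply: le_trans H1; rewrite lerD2l lerN2.
by rewrite mulrAC ler_pdivrMr// ler_pM2l// lerDl.
Qed.

(** * Rate *)

Section Rate.
Context {R : realType} d (T : measurableType d) (Pr : probability T R).
Local Notation leb := (@lebesgue_measure R).

Lemma integral_inv1D (s : R) : 0 <= s ->
  (\int[leb]_(x in `]0%R, s]%classic) ((1 + x)^-1)%:E = (ln (1 + s))%:E)%E.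
Proof.
move=> s0; rewrite integral_itv_obnd_cbnd; last first.
  by apply: measurable_funTS; mfun; apply: mfun_add; mfun.
move: s0; rewrite le_eqVlt => /predU1P[<-|s0].
  by rewrite set_itv1 integral_set1 addr0 ln1.
pose F (x : R) : R := ln (x + 1).
have dF (x : R) : 0 <= x -> is_derive x 1 F ((1 + x)^-1).
  move=> x0; have x1 : 0 < x + 1 by rewrite ltr_wpDl.
  have dq : is_derive x 1 (fun u : R => u + 1) 1 by apply: is_derive_eq; rewrite addr0.
  have dl := is_derive1_ln x1.
  have dc := @is_derive1_comp _ (@ln R) (fun u : R => u + 1) x _ _ dl dq.
  by apply: is_derive_eq; rewrite mulr1 addrC.
have cF (x : R) : 0 <= x -> {for x, continuous F}.
  move=> x0; apply: differentiable_continuous; apply/derivable1_diffP.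
  by have := dF x x0 => -[].
rewrite (@continuous_FTC2 _ (fun x => (1 + x)^-1) F)//.
- by rewrite /F add0r ln1 sube0 addrC.
- apply: continuous_in_subspaceT => x /set_mem; rewrite /= in_itv/= => /andP[x0 _].
  apply: cvgV; first by rewrite gt_eqF// ltr_pwDl.
  by apply: cvgD; [exact: cvg_cst|exact: cvg_id].
- split.
  + by move=> x; rewrite in_itv/= => /andP[/ltW/dF[]].
  + exact/cvg_at_right_filter/cF.
  + exact/cvg_at_left_filter/cF/ltW.
- by move=> x; rewrite in_itv/= => /andP[/ltW/dF[_ xE] _]; rewrite derive1E.
Qed.

(** Layer cake: [ln (1 + Y w)] is the integral of [(1 + x)^-1] over [0 < x <= Y w], and Tonelli
    exchanges it with the expectation. *)
Lemma integral_ln1D (Y : T -> R) : measurable_fun [set: T] Y -> (forall w, 0 <= Y w) ->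
  (\int[Pr]_w (ln (1 + Y w))%:E =
   \int[leb]_(x in `]0%R, +oo[%classic) (Pr [set w | (x <= Y w)%R] * ((1 + x)^-1)%:E))%E.
Proof.
move=> mY Y0.
pose f (p : T * R) : R := (p.2 <= Y p.1)%R%:R * ((0 < p.2)%R%:R * (1 + p.2)^-1).
have f0 p : (0 <= (f p)%:E)%E.
  rewrite lee_fin /f mulr_ge0//; case: ltP => H; rewrite ?mul0r// mul1r invr_ge0.
  by rewrite addr_ge0// ltW.
have mf : measurable_fun [set: T * R] (fun p => (f p)%:E).
  have m1 : measurable_fun [set: T * R] (fun p : T * R => Y p.1).
    by apply: (measurableT_comp mY); mfun.
  by rewrite /f; mfun.
transitivity (\int[Pr]_w \int[leb]_x (f (w, x))%:E)%E.
  apply: eq_integral => w _; rewrite -integral_inv1D//.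
  rewrite (integral_indicator_set leb (b := fun x => 0 < x <= Y w)); last first.
    by move=> x; rewrite /= in_itv.
  apply: eq_integral => x _; congr EFin; rewrite /f/= mulrA -natrM mulnb.
  by rewrite andbC.
rewrite (fubini_tonelli (m1 := Pr) (m2 := leb) (fun p => (f p)%:E) mf f0).
rewrite [RHS]integral_mkcond; apply: eq_integral => x _; rewrite patchE mem_setE in_itv/= andbT /f/=.
case: ifPn => x0; last first.
  by rewrite integral0_eq// => w _; rewrite mul0r mulr0.
have x1 : 0 <= (1 + x)^-1 by rewrite invr_ge0 addr_ge0// ltW.
have mb : measurable_fun [set: T] (fun w => x <= Y w) by apply: mfun_le; mfun.
have := integral_bool Pr measurableT mb; rewrite setTI => <-.
rewrite muleC -ge0_integralZl_EFin//.
- by apply: eq_integral => w _; rewrite -EFinM mul1r mulrC.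
- by apply/measurable_EFinP; exact: mfun_bool.
Qed.

End Rate.

Lemma SINR_ge0 (R : realType) (h v alpha Pw N0 t : R) (C : set (mpt R)) :
  0 < h -> 0 < Pw -> 0 <= N0 -> regular C -> 0 <= SINR h v alpha Pw N0 t C.
Proof.
move=> h0 Pw0 N00 [Cpos _]; rewrite /SINR.
case: ifPn => // /asboolP [Cp _]; case: ifPn => // _.
rewrite divr_ge0//; first by rewrite !mulr_ge0 ?powR_ge0// ltW// Cpos.
rewrite addr_ge0// fine_ge0// /interference; apply: esum_ge0 => q [Cq _].
by rewrite lee_fin !mulr_ge0 ?powR_ge0// ltW// Cpos.
Qed.

Lemma rate (R : realType) d (T : measurableType d) (Pr : probability T R)
  (lam0 h v alpha Pw N0 t : R) (Phi : T -> set (mpt R)) :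
  0 < lam0 -> 0 < h -> 0 < Pw -> 0 <= N0 ->
  is_PPP Pr (intensity lam0) Phi ->
  measurable_fun setT (fun w => SINR h v alpha Pw N0 t (Phi w)) ->
  (\int[Pr]_w (ln (1 + SINR h v alpha Pw N0 t (Phi w)))%:E
   = \int[@lebesgue_measure R]_(gam in `]0%R, +oo[%classic)
       (Pr [set w | (gam <= SINR h v alpha Pw N0 t (Phi w))%R] * ((1 + gam)^-1)%:E))%E.
Proof.
move=> l0 h0 Pw0 N00 HP; set s := fun w => SINR _ _ _ _ _ _ _ => ms.
(* Off the regular configurations negative gains may make the SINR negative; its positive part is
   almost surely equal to it and has the same events [gam <= _] for [gam > 0]. *)
have ms0 : measurable_fun [set: T] (fun w => Num.max (s w) 0) by mfun.
have [G [mG PG] Greg] := regular_as l0 HP.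
transitivity (\int[Pr]_w (ln (1 + Num.max (s w) 0))%:E)%E.
  apply: ae_eq_integral => //.
  - by apply/measurable_EFinP; apply: mfun_ln; mfun.
  - by apply/measurable_EFinP; apply: mfun_ln; mfun.
  exists (~` G); split.
  - exact: measurableC.
  - by apply: (etrans (probability_setC Pr mG)); rewrite PG subee.
  - move=> w /= H Gw; apply: H => _; congr (ln (1 + _))%:E.
    by rewrite max_l// SINR_ge0//; exact: Greg.
rewrite integral_ln1D//; last by move=> w; rewrite le_max lexx orbT.
apply: eq_integral => gam; rewrite mem_setE in_itv/= andbT => gam0.
congr (Pr _ * _)%E; apply/seteqP; split => w /=.
  by rewrite le_max [gam <= 0]leNgt gam0 orbF.
by rewrite le_max => ->.
Qed.

Unset Implicit Arguments.
Set Strict Implicit.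

Theorem theorem1 (R : realType) (d : measure_display) (T : measurableType d)
  (Pr : probability T R) (Phi : T -> set (mpt R))
  (lam0 h v Pw N0 alpha t : R) :
  0 < lam0 -> 0 < h -> 0 < v -> 0 < Pw -> 0 <= N0 -> 2 < alpha -> 0 <= t ->
  is_PPP Pr (intensity lam0) Phi ->
  measurable_fun setT (fun w => SINR h v alpha Pw N0 t (Phi w)) ->
  (forall gam : R, 0 < gam ->
     Pr [set w | gam <= SINR h v alpha Pw N0 t (Phi w)]
     = PC_formula lam0 h v alpha Pw N0 gam t)
  /\
  (\int[Pr]_w (ln (1 + SINR h v alpha Pw N0 t (Phi w)))%:E
   = \int[@lebesgue_measure R]_(gam in `]0%R, +oo[%classic)
       (Pr [set w | (gam <= SINR h v alpha Pw N0 t (Phi w))%R] * ((1 + gam)^-1)%:E))%E.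
Proof.
move=> l0 h0 v0 Pw0 N00 alpha2 t0 HP ms; split => [gam gam0|]; last exact: (rate l0).
apply: coverage => //; apply: measurable_pred.
by apply: measurable_fun_ler => //; exact: measurable_cst.
Qed.
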